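(* Suppose that the Regularity Assumption and the Fixed-Point Monotonicity Assumption (both stated in the context) hold. Then $\boldsymbol{a}^N=(a^{N,1},\dots,a^{N,N})$ is of class $C^4$, and there is a constant $C$ (independent of $N$) such that for all $N$ large enough and all $i,j,k,l\in\{1,\dots,N\}$, 1. $\|D_{x^j}a^{N,i}\|_\infty+\|D_{p^j}a^{N,i}\|_\infty\le C\,\omega^N_{i,j}$; 2. $\|D_{x^kx^j}a^{N,i}\|_\infty+\|D_{x^kp^j}a^{N,i}\|_\infty+\|D_{p^kp^j}a^{N,i}\|_\infty\le C\,\omega^N_{i,j,k}$; 3. $\|D_{x^lx^kx^j}a^{N,i}\|_\infty+\|D_{x^lx^kp^j}a^{N,i}\|_\infty+\|D_{x^lp^kp^j}a^{N,i}\|_\infty+\|D_{p^lp^kp^j}a^{N,i}\|_\infty\le C\,\omega^N_{i,j,k,l}$.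
   Context: Notation. Fix $d\ge1$. $\mathcal{P}_2(\mathbb{R}^n)$ is the set of Borel probability measures on $\mathbb{R}^n$ with finite second moment; $M_q(m)=\int|x|^q\,m(dx)$; $\mathbf{d}_1$ is the 1-Wasserstein distance; $\mathcal{L}(X)$ is the law of $X$. $D_m$ (or $D_\mu$) is the intrinsic (Wasserstein/Lions) derivative and $\frac{\delta}{\delta m}$ the linear functional derivative in the measure variable. $C^k$ regularity is understood jointly in Euclidean and measure variables. Data. $L:\mathbb{R}^d\times\mathbb{R}^d\times\mathcal{P}_2(\mathbb{R}^d\times\mathbb{R}^d)\to\mathbb{R}$, $(x,a,\mu)\mapsto L(x,a,\mu)$; $H(x,p,\mu)=\sup_{a\in\mathbb{R}^d}\{-a\cdot p-L(x,a,\mu)\}$; $G:\mathbb{R}^d\times\mathcal{P}_2(\mathbb{R}^d)\to\mathbb{R}$. Regularity Assumption. $G$ is $C^5$ and bounded from below, all its derivatives of order 2, 3, 4, 5 are uniformly bounded, and $D_mG$ is uniformly bounded. $L$ and $H$ are $C^5$ with derivatives of order 2, 3, 4, 5 uniformly bounded, and $D_\mu L$ is bounded. There is $C>0$ with $D_{aa}L\ge C I_{d\times d}$ everywhere and $\frac1C|a|^2-C\le L(x,a,\mu)\le C(1+|x|^2+|a|^2+M_2^{1/2}(\mu))$. The maps $(x,a,\mu,x',a')\mapsto\frac{\delta}{\delta m}D_xL(x,a,\mu,x',a')$, $\frac{\delta}{\delta m}D_aL$ and $\frac{\delta}{\delta m}D_xG$ are uniformly Lipschitz continuous, with respect to $\mathbf{d}_1$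 in the measure variable. Fixed-Point Monotonicity Assumption. There are constants $C_{L,a}>0$, $C_{L,x}\ge0$ such that for all square-integrable $\mathbb{R}^d$-valued random vectors $X,X',\alpha,\alpha'$, with $\Delta X=X-X'$, $\Delta\alpha=\alpha-\alpha'$, $$\mathbf{E}\big[(D_aL(X,\alpha,\mathcal{L}(X,\alpha))-D_aL(X',\alpha',\mathcal{L}(X',\alpha')))\cdot\Delta\alpha+(D_xL(X,\alpha,\mathcal{L}(X,\alpha))-D_xL(X',\alpha',\mathcal{L}(X',\alpha')))\cdot\Delta X\big]\ge C_{L,a}\mathbf{E}|\Delta\alpha|^2-C_{L,x}\mathbf{E}|\Delta X|^2.$$ The map $\boldsymbol{a}^N$. For $\boldsymbol{x}=(x^1,\dots,x^N)$, $\boldsymbol{a}=(a^1,\dots,a^N)\in(\mathbb{R}^d)^N$ set $m^{N,-i}_{\boldsymbol{x},\boldsymbol{a}}=\frac1{N-1}\sum_{j\ne i}\delta_{(x^j,a^j)}$. Under these assumptions it is known that for all $N$ large enough and every $(\boldsymbol{x},\boldsymbol{p})\in(\mathbb{R}^d)^N\times(\mathbb{R}^d)^N$ there is a unique $\boldsymbol{a}=:\boldsymbol{a}^N(\boldsymbol{x},\boldsymbol{p})\in(\mathbb{R}^d)^N$ with $a^i=-D_pH(x^i,p^i,m^{N,-i}_{\boldsymbol{x},\boldsymbol{a}})$ for all $i=1,\dots,N$, and $\boldsymbol{a}^N$ is Lipschitz with respect to the Euclidean norms, with constant independent of $N$. Weights. For a tuple of indices let $\mathrm{dist}(\cdot)$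 be the number of distinct integers in it; $\omega^N_{i,j}=N^{1-\mathrm{dist}(i,j)}$, $\omega^N_{i,j,k}=N^{1-\mathrm{dist}(i,j,k)}$, $\omega^N_{i,j,k,l}=N^{1-\mathrm{dist}(i,j,k,l)}$. $D_{x^j}$, $D_{p^j}$ denote derivatives with respect to the $\mathbb{R}^d$-valued blocks $x^j$, $p^j$, and $\|\cdot\|_\infty$ is the sup norm over $(\mathbb{R}^d)^N\times(\mathbb{R}^d)^N$. *)

(* Defs.v *)
From HB Require Import structures.
From mathcomp Require Import all_boot all_order all_algebra.
From mathcomp Require Import all_classical all_reals all_analysis.
From mathcomp Require Import measurable_realfun.

Set Implicit Arguments.
Unset Strict Implicit.
Unset Printing Implicit Defensive.
Import Order.TTheory GRing.Theory Num.Theory.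
Import numFieldNormedType.Exports.
Local Open Scope classical_set_scope.
Local Open Scope ring_scope.

Section Euclidean.
Variable R : realType.

Definition dotp n (x y : 'rV[R]_n) : R := \sum_(i < n) x 0 i * y 0 i.

(* The norm [`|x|] that the library puts on matrices is the sup norm; it gives
   the same topology but is not the Euclidean norm. *)
Definition norm2 n (x : 'rV[R]_n) : R := Num.sqrt (dotp x x).

Definition evec n (i : 'I_n) : 'rV[R]_n := delta_mx 0 i.

Definition grad n (f : 'rV[R]_n -> R) (x : 'rV[R]_n) : 'rV[R]_n :=
  \row_i 'D_(evec i) f x.

Definition hessian n (f : 'rV[R]_n -> R) (x : 'rV[R]_n) : 'M[R]_n :=
  \matrix_(i, j) 'D_(evec i) (fun y => 'D_(evec j) f y) x.

Definition borelV n := g_sigma_algebraType (@open 'rV[R]_n).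

Lemma dotp_ge0 n (x : 'rV[R]_n) : 0 <= dotp x x.
Proof. by apply: sumr_ge0 => i _; rewrite -expr2 sqr_ge0. Qed.

Lemma norm2_continuous n : continuous (@norm2 n).
Proof.
move=> x; apply: (@continuous_comp _ _ _ (fun y => dotp y y)); last first.
  exact: sqrt_continuous.
rewrite /dotp; apply: continuous_big => [|i _ {}x]; first exact: add_continuous.
by apply: cvgM; [exact: nbhs_filter|exact: coord_continuous|
  exact: coord_continuous].
Qed.

Lemma measurable_norm2X n q :
  measurable_fun setT (fun x : borelV n => (norm2 x ^+ q)%:E).
Proof.
apply/measurable_EFinP; apply: measurable_funX.
apply: (measurability _ (RGenOpens.measurableE R)) => _ [_ [a [b ->]] <-].
rewrite setTI; apply: sub_sigma_algebra.
by apply: open_comp => [y _|]; [exact: norm2_continuous|exact: interval_open].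
Qed.

End Euclidean.
Arguments evec {R n}.

Section P2.
Variable R : realType.

Definition moment n (q : nat) (m : {measure set (borelV R n) -> \bar R}) :
  \bar R := (\int[m]_x ((norm2 x) ^+ q)%:E)%E.

Record P2 n := MkP2 {
  P2_prob :> probability (borelV R n) R ;
  P2_moment : (moment 2 P2_prob < +oo)%E }.

Section mixture.
Variable n : nat.

Definition clamp01 (t : R) : R := Num.min 1 (Num.max 0 t).

Lemma clamp01_ge0 t : 0 <= clamp01 t.
Proof. by rewrite /clamp01 le_min ler01 le_max lexx. Qed.

Lemma onem_clamp01_ge0 t : 0 <= 1 - clamp01 t.
Proof. by rewrite subr_ge0 /clamp01 ge_min lexx. Qed.

Definition mix_measure (t : R) (m m' : probability (borelV R n) R) :=
  measure_add (mscale (NngNum (onem_clamp01_ge0 t)) m)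
              (mscale (NngNum (clamp01_ge0 t)) m').

HB.instance Definition _ t m m' := Measure.on (mix_measure t m m').

Lemma mix_measure_setT t m m' : mix_measure t m m' setT = 1%E.
Proof.
rewrite /mix_measure measure_addE /= /mscale /=.
by rewrite !probability_setT !mule1 -EFinD subrK.
Qed.

HB.instance Definition _ t m m' := Measure_isProbability.Build _ _ _
  (mix_measure t m m') (mix_measure_setT t m m').

Lemma mix_moment t (m m' : P2 n) :
  (moment 2 (mix_measure t m m' : probability _ _) < +oo)%E.
Proof.
rewrite /moment /mix_measure ge0_integral_measure_add//; last 2 first.
- by move=> x _; rewrite lee_fin exprn_ge0// sqrtr_ge0.
- exact: measurable_norm2X.
rewrite !ge0_integral_mscale//; try exact: measurable_norm2X;
  try by move=> x _; rewrite lee_fin exprn_ge0// sqrtr_ge0.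
by rewrite lte_add_pinfty// lte_mul_pinfty// ?lee_fin ?clamp01_ge0
  ?onem_clamp01_ge0// P2_moment.
Qed.

(* $(1-t) m + t m'$ for $t \in [0,1]$; [t] is truncated to [0,1] otherwise. *)
Definition mix t (m m' : P2 n) : P2 n := MkP2 (mix_moment t m m').

End mixture.

Section empirical.
Variables (n : nat) (x0 : 'rV[R]_n) (s : seq 'rV[R]_n).

Definition empirical_measure :=
  mscale ((size s).+1%:R^-1 : R)%:nng
    (msum (fun k => dirac (nth x0 (x0 :: s) k : borelV R n)) (size s).+1).

HB.instance Definition _ := Measure.on empirical_measure.

Lemma empirical_measure_setT : empirical_measure setT = 1%E.
Proof.
rewrite /empirical_measure /mscale /= /msum.
rewrite (eq_bigr (fun=> 1%E)); last by move=> i _; exact: diracT.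
by rewrite sumEFin sumr_const card_ord -EFinM mulVf ?pnatr_eq0.
Qed.

HB.instance Definition _ := Measure_isProbability.Build _ _ _
  empirical_measure empirical_measure_setT.

Lemma empirical_moment :
  (moment 2 (empirical_measure : probability _ _) < +oo)%E.
Proof.
have h (x : borelV R n) : setT x -> (0 <= ((norm2 x) ^+ 2)%:E)%E.
  by move=> _; rewrite lee_fin exprn_ge0// sqrtr_ge0.
rewrite /moment /empirical_measure ge0_integral_mscale//; last first.
  exact: measurable_norm2X.
rewrite lte_mul_pinfty ?lee_fin// ge0_integral_measure_sum//; last first.
  exact: measurable_norm2X.
apply: lte_sum_pinfty => i _; rewrite integral_dirac//; last first.
  exact: measurable_norm2X.
by rewrite diracT mul1e ltry.
Qed.

Definition empirical_cons : P2 n := MkP2 empirical_moment.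

End empirical.

(* The uniform measure on the entries of [s], counted with multiplicity; it is
   [\d_0] by convention when [s] is empty. *)
Definition empirical n (s : seq 'rV[R]_n) : P2 n :=
  if s is x :: s' then empirical_cons x s' else empirical_cons 0 [::].

Definition coupling n (m m' : P2 n)
    (pi : probability (borelV R n * borelV R n)%type R) : Prop :=
  forall A : set (borelV R n), measurable A ->
    pi (A `*` setT) = m A /\ pi (setT `*` A) = m' A.

Definition wasserstein n (q : nat) (m m' : P2 n) : R :=
  fine (ereal_inf [set (\int[pi]_z (norm2 ((z.1 : 'rV[R]_n) - z.2) ^+ q)%:E)%E
                  | pi in coupling m m']) `^ (q%:R^-1).

Definition jcontinuous n m (U : 'rV[R]_n -> P2 m -> R) : Prop :=
  forall x mu (e : R), 0 < e -> exists2 r : R, 0 < r &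
    forall x' mu', norm2 (x' - x) < r -> wasserstein 2 mu' mu < r ->
      `|U x' mu' - U x mu| < e.

(* The first three clauses determine [f] up to a function of the measure alone;
   the last one is the usual normalisation.  The growth clause makes the
   integrals of the third one meaningful. *)
Definition is_lfd m (U : P2 m -> R) (f : P2 m -> 'rV[R]_m -> R) : Prop :=
  [/\ jcontinuous (fun y mu => f mu y),
      (forall r : R, exists C : R, forall (mu : P2 m) y, (moment 2 mu <= r%:E)%E ->
         `|f mu y| <= C * (1 + norm2 y ^+ 2)),
      (forall mu nu : P2 m, U nu - U mu =
         \int[@lebesgue_measure R]_(t in `[0, 1])
           (\int[nu]_y f (mix t mu nu) y - \int[mu]_y f (mix t mu nu) y)) &
      (forall mu : P2 m, \int[mu]_y f mu y = 0)].

Definition lfd m (U : P2 m -> R) : P2 m -> 'rV[R]_m -> R :=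
  xget (fun _ _ => 0) [set f | is_lfd U f].

Definition lfdV m k (V : P2 m -> 'rV[R]_k) (mu : P2 m) (y : 'rV[R]_m) :
  'rV[R]_k := \row_i lfd (fun nu => V nu 0 i) mu y.

Definition intrinsicD m (U : P2 m -> R) (mu : P2 m) (y : 'rV[R]_m) :
  'rV[R]_m := grad (lfd U mu) y.

(* One differentiation of a function of n real variables and a measure: [partial]
   in a Euclidean variable, or [partial_m] in the measure.  The latter creates m
   new real variables y, which are appended to the n old ones. *)
Definition partial n m (i : 'I_n) (U : 'rV[R]_n -> P2 m -> R) :
  'rV[R]_n -> P2 m -> R := fun x mu => 'D_(evec i) (fun x' => U x' mu) x.

Definition partial_m n m (j : 'I_m) (U : 'rV[R]_n -> P2 m -> R) :
  'rV[R]_(n + m) -> P2 m -> R :=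
  fun z mu => intrinsicD (U (lsubmx z)) mu (rsubmx z) 0 j.

Fixpoint class_CP2 k n m (U : 'rV[R]_n -> P2 m -> R) : Prop :=
  jcontinuous U /\
  if k is k'.+1 then
    [/\ (forall i x mu, derivable (fun x' => U x' mu) x (evec i)),
        (forall i, class_CP2 k' (partial i U)),
        (forall x, exists f, is_lfd (U x) f),
        (forall j x mu y, derivable (lfd (U x) mu) y (evec j)) &
        (forall j, class_CP2 k' (partial_m j U))]
  else True.

Fixpoint derivatives_bounded k n m (U : 'rV[R]_n -> P2 m -> R) : Prop :=
  if k is k'.+1 then
    (forall i, derivatives_bounded k' (partial i U)) /\
    (forall j, derivatives_bounded k' (partial_m j U))
  else exists C : R, forall x mu, `|U x mu| <= C.

Definition class_C5_bounded n m (U : 'rV[R]_n -> P2 m -> R) : Prop :=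
  class_CP2 5 U /\
  forall k, (2 <= k <= 5)%N -> derivatives_bounded k U.

Definition intrinsicD_bounded n m (U : 'rV[R]_n -> P2 m -> R) : Prop :=
  exists C : R, forall x mu y, norm2 (intrinsicD (U x) mu y) <= C.

Definition lipschitz_d1 n m k (F : 'rV[R]_n -> P2 m -> 'rV[R]_m -> 'rV[R]_k) :
  Prop := exists C : R, forall x x' mu mu' y y',
    norm2 (F x mu y - F x' mu' y') <=
      C * (norm2 (x - x') + wasserstein 1 mu mu' + norm2 (y - y')).

End P2.

Section Data.
Variables (R : realType) (d : nat).
Variable L : 'rV[R]_d -> 'rV[R]_d -> P2 R (d + d) -> R.
Variable G : 'rV[R]_d -> P2 R d -> R.

Definition hamiltonian (x p : 'rV[R]_d) (mu : P2 R (d + d)) : R :=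
  sup [set - dotp a p - L x a mu | a in [set: 'rV[R]_d]].

Definition pairfun (F : 'rV[R]_d -> 'rV[R]_d -> P2 R (d + d) -> R) :
  'rV[R]_(d + d) -> P2 R (d + d) -> R := fun z => F (lsubmx z) (rsubmx z).

Definition DxL x a mu : 'rV[R]_d := grad (fun x' => L x' a mu) x.
Definition DaL x a mu : 'rV[R]_d := grad (fun a' => L x a' mu) a.
Definition DaaL x a mu : 'M[R]_d := hessian (fun a' => L x a' mu) a.
Definition DpH x p mu : 'rV[R]_d := grad (fun p' => hamiltonian x p' mu) p.
Definition DxG x m : 'rV[R]_d := grad (fun x' => G x' m) x.

Definition G_regular : Prop :=
  [/\ class_C5_bounded G,
      (exists c : R, forall x m, c <= G x m),
      intrinsicD_bounded G &
      lipschitz_d1 (fun x m y => lfdV (DxG x) m y)].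

Definition L_coercive : Prop :=
  exists2 C : R, 0 < C &
    (forall x a mu (xi : 'rV[R]_d),
       C * dotp xi xi <= dotp (xi *m DaaL x a mu) xi) /\
    (forall x a mu,
       C^-1 * norm2 a ^+ 2 - C <= L x a mu /\
       L x a mu <= C * (1 + norm2 x ^+ 2 + norm2 a ^+ 2
                          + Num.sqrt (fine (moment 2 mu)))).

Definition L_regular : Prop :=
  [/\ class_C5_bounded (pairfun L),
      class_C5_bounded (pairfun hamiltonian),
      intrinsicD_bounded (pairfun L),
      L_coercive &
      lipschitz_d1 (fun z mu y => lfdV (DxL (lsubmx z) (rsubmx z)) mu y) /\
      lipschitz_d1 (fun z mu y => lfdV (DaL (lsubmx z) (rsubmx z)) mu y)].

Definition regularity_assumption : Prop := G_regular /\ L_regular.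

Definition square_integrable disp (T : measurableType disp)
    (P : probability T R) n (X : T -> 'rV[R]_n) : Prop :=
  measurable_fun setT (X : T -> borelV R n) /\
  (\int[P]_w (norm2 (X w) ^+ 2)%:E < +oo)%E.

Definition has_law disp (T : measurableType disp) (P : probability T R)
    n (X : T -> 'rV[R]_n) (mu : P2 R n) : Prop :=
  forall A : set (borelV R n), measurable A -> mu A = P (X @^-1` A).

Definition fixed_point_monotonicity : Prop :=
  exists CLa CLx : R, [/\ 0 < CLa, 0 <= CLx &
    forall (disp : measure_display) (T : measurableType disp)
      (P : probability T R) (X X' al al' : T -> 'rV[R]_d)
      (mu mu' : P2 R (d + d)),
      square_integrable P X -> square_integrable P X' ->
      square_integrable P al -> square_integrable P al' ->
      has_law P (fun w => row_mx (X w) (al w)) mu ->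
      has_law P (fun w => row_mx (X' w) (al' w)) mu' ->
      (CLa%:E * 'E_P[fun w => (norm2 (al w - al' w) ^+ 2)%R]
         - CLx%:E * 'E_P[fun w => (norm2 (X w - X' w) ^+ 2)%R]
       <= 'E_P[fun w =>
            (dotp (DaL (X w) (al w) mu - DaL (X' w) (al' w) mu')
                  (al w - al' w)
             + dotp (DxL (X w) (al w) mu - DxL (X' w) (al' w) mu')
                    (X w - X' w))%R])%E].

(* A point $\boldsymbol x\in(\mathbb R^d)^N$ is the N x d matrix whose i-th row
   is $x^i$. *)
Definition loo_measure N (x a : 'M[R]_(N, d)) (i : 'I_N) : P2 R (d + d) :=
  empirical [seq row_mx (row j x) (row j a) | j <- enum 'I_N & j != i].

Definition fixed_point N (x p a : 'M[R]_(N, d)) : Prop :=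
  forall i, row i a = - DpH (row i x) (row i p) (loo_measure x a i).

Definition is_aN N (aN : 'M[R]_(N, d) * 'M[R]_(N, d) -> 'M[R]_(N, d)) : Prop :=
  forall x p a, fixed_point x p a <-> a = aN (x, p).

End Data.

Section Blocks.
Variable R : realType.

Fixpoint class_C k (V W : normedModType R) (f : V -> W) : Prop :=
  continuous f /\
  if k is k'.+1 then
    forall v : V, (forall x, derivable f x v) /\ class_C k' ('D_v f)
  else True.

Variables N d : nat.
Implicit Types f : 'M[R]_(N, d) * 'M[R]_(N, d) -> 'rV[R]_d.

Inductive block := bx of 'I_N | bp of 'I_N.

Definition bvec (s : block) (b : 'I_d) : 'M[R]_(N, d) * 'M[R]_(N, d) :=
  match s with bx j => (delta_mx j b, 0) | bp j => (0, delta_mx j b) end.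

(* Square of the Euclidean norm of the tensor of derivatives of [f] with respect
   to the blocks listed in [ss], the head of [ss] being differentiated first. *)
Fixpoint sqnormD (ss : seq block) f :
    'M[R]_(N, d) * 'M[R]_(N, d) -> R :=
  match ss with
  | [::] => fun z => dotp (f z) (f z)
  | s :: ss' => fun z => \sum_(b < d) sqnormD ss' ('D_(bvec s b) f) z
  end.

Definition supnormD (ss : seq block) f : \bar R :=
  ereal_sup (range (fun z => (Num.sqrt (sqnormD ss f z))%:E)).

Definition weight (s : seq 'I_N) : R :=
  N%:R ^ (1 - (size (undup s))%:Z).

End Blocks.

(* Main.v *)
Require Import Defs.
From HB Require Import structures.
From mathcomp Require Import all_boot all_order all_algebra.
From mathcomp Require Import all_classical all_reals all_analysis.
From mathcomp Require Import measurable_realfun.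
From mathcomp Require Import ring lra zify.

(**
  Since $-a\cdot p-L$ is maximal at $a=-D_pH$, the map $a^N$ solves
  $D_aL(x^i,a^i,m^{N,-i}_{x,a})=-p^i$.  Monotonicity, applied to the empirical
  measure, makes this system strongly monotone in $a$ up to the error made by
  leaving particle $i$ out, which is $O(1/N)$ as a Lipschitz function of $a$ because
  $\frac{\delta}{\delta m}D_aL$ is Lipschitz.  Hence the Jacobian in $a$ is coercive
  uniformly in $N$ and $a^N$ is as smooth as the system.  A derivative of the left
  hand side in the variables of particles $j,k,\dots$ is bounded by
  $\omega^N_{i,j,k,\dots}$, since each derivative through the measure costs a factor
  $1/N$.  The weights are stable under products summed over a common index and
  under solving coercive systems whose matrix has entries bounded by
  $\omega^N_{i,j}$; differentiating the system repeatedly gives the bounds.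
*)

Set Implicit Arguments.
Unset Strict Implicit.
Unset Printing Implicit Defensive.
Import Order.TTheory GRing.Theory Num.Theory.
Import numFieldNormedType.Exports.
Local Open Scope classical_set_scope.
Local Open Scope ring_scope.

(** * Directional derivatives and the mean value theorem *)

Section Calculus.
Variables (R : realType) (V : normedModType R).
Implicit Types (f g : V -> R) (x v w : V).

(** The monotonicity assumption concerns the law of all particles, whereas each fixed-point equation
    leaves one particle out; the discrepancy has to be estimated as a difference between two action
    profiles, and this is what forces $N$ to be large. Derivatives are taken along coordinates only,
    and increments are expanded by the one-dimensional mean value theorem at intermediate points, in
    place of Fréchet derivatives and the implicit function theorem. The entries of the resulting
    matrices sit at different points, so such a matrix need not be coercive; only its limit is, and
    limits of solutions pass through determinants. A mere operator bound on the inverse Jacobian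
    would lose the decay of single entries, so coercivity is tested against vectors restricted to
    chosen sets of particles. Since $D_aL$ may be unbounded, bounds are imposed on its derivatives
    only: five orders for $L$ leave four for the system, hence four for $a^N$. Every constant is
    chosen before $N$. *)

Lemma cvg_derive f x v : derivable f x v ->
  h^-1 * (f (h *: v + x) - f x) @[h --> 0^'] --> 'D_v f x.
Proof. by []. Qed.

Lemma is_derive_quotient f x v D :
  h^-1 * (f (h *: v + x) - f x) @[h --> 0^'] --> D -> is_derive x v f D.
Proof.
by move=> fD; apply: DeriveDef; [apply/cvg_ex; exists D|exact: cvg_lim fD].
Qed.

Lemma derivable_cvg f x v : derivable f x v -> f (h *: v + x) @[h --> 0^'] --> f x.
Proof.
move=> fv.
have h0 : h * (h^-1 * (f (h *: v + x) - f x)) @[h --> 0^'] --> 0 * 'D_v f x.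
  apply: cvgM; last exact: cvg_derive.
  exact: cvg_within.
suff : f x + (f (h *: v + x) - f x) @[h --> 0^'] --> f x + 0.
  by rewrite addr0; under eq_cvg do rewrite addrC subrK.
apply: cvgD; first exact: cvg_cst.
rewrite mul0r in h0; apply: cvg_trans h0; apply: near_eq_cvg.
near=> h; rewrite mulVKf //.
by near: h; exact: nbhs_dnbhs_neq.
Unshelve. all: by end_near. Qed.

End Calculus.

Section MeanValue.
Variables (R : realType) (V : normedModType R).
Implicit Types (f : V -> R) (x v w : V).

Lemma cvg_finsum (T : Type) (F : set_system T) {FF : Filter F} (I : finType)
    (P : pred I) (f : I -> T -> R) (a : I -> R) :
  (forall i, P i -> f i t @[t --> F] --> a i) ->
  \sum_(i | P i) f i t @[t --> F] --> \sum_(i | P i) a i.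
Proof. by move=> fa; apply: cvg_big => //; exact: add_continuous. Qed.

Lemma cvg_finprod (T : Type) (F : set_system T) {FF : Filter F} (I : finType)
    (P : pred I) (f : I -> T -> R) (a : I -> R) :
  (forall i, P i -> f i t @[t --> F] --> a i) ->
  \prod_(i | P i) f i t @[t --> F] --> \prod_(i | P i) a i.
Proof. by move=> fa; apply: cvg_big => //; exact: mul_continuous. Qed.

Lemma derivable_line f v w : (forall x, derivable f x v) ->
  forall t : R, is_derive t 1 (fun s : R => f (s *: v + w)) ('D_v f (t *: v + w)).
Proof.
move=> fv t; apply: is_derive_quotient.
have -> : (fun h : R => h^-1 * (f ((h *: 1 + t) *: v + w) - f (t *: v + w))) =
          (fun h => h^-1 * (f (h *: v + (t *: v + w)) - f (t *: v + w))).
  by apply/funext => h; rewrite [h *: 1]mulr1 scalerDl addrA.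
exact: cvg_derive.
Qed.

Lemma mvt_line f v w (h : R) : (forall x, derivable f x v) ->
  exists2 t, `|t| <= `|h| &
    f (h *: v + w) - f w = h * 'D_v f (t *: v + w).
Proof.
move=> fv; have dF := derivable_line w fv.
have cF : continuous (fun s : R => f (s *: v + w)).
  by move=> s; apply: differentiable_continuous; apply/derivable1_diffP.
have [h0|h0] := leP 0 h.
  have [c ch e] := MVT_segment h0 (fun s _ => dF s) (continuous_subspaceT cF).
  exists c; first by move: ch; rewrite in_itv /= => /andP[c0 ch]; rewrite !ger0_norm.
  by move: e; rewrite scale0r add0r subr0 mulrC.
have [c ch e] := MVT_segment (ltW h0) (fun s _ => dF s) (continuous_subspaceT cF).
exists c.
  move: ch; rewrite in_itv /= => /andP[c0 ch]; rewrite !ler0_norm ?lerN2 //.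
  exact: ltW.
by move: e; rewrite scale0r add0r sub0r mulrN mulrC => /eqP;
  rewrite -subr_eq0 opprK => /eqP e; apply/eqP; rewrite -subr_eq0; apply/eqP;
  lra.
Qed.

(** The coordinates are moved one at a time, each move being an instance of [mvt_line]. Row [c] of
    [T] holds the coordinates of the intermediate point for the move along [e c]: later coordinates
    of the enumeration have already moved fully, earlier ones not yet. Afterwards only the bound on
    [T] matters, since it makes the intermediate points converge. *)
Lemma mvt_telescope (I : finType) (e : I -> V) f w (k : I -> R) :
  (forall c x, derivable f x (e c)) ->
  exists2 T : I -> I -> R, (forall c c', `|T c c'| <= `|k c'|) &
    f (\sum_c k c *: e c + w) - f w =
    \sum_c k c * 'D_(e c) f (\sum_c' T c c' *: e c' + w).
Proof.
move=> fe.
suff [T kT eT] : exists2 T : I -> I -> R, (forall c c', `|T c c'| <= `|k c'|) &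
    f (\sum_(c <- enum I) k c *: e c + w) - f w =
    \sum_(c <- enum I) k c * 'D_(e c) f (\sum_c' T c c' *: e c' + w).
  by exists T => //; move: eT; rewrite !big_enum.
elim: (enum I) (enum_uniq I) => [_|c s IHs /= /andP[cs us]].
  exists (fun _ _ => 0); first by move=> c c'; rewrite normr0.
  by rewrite !big_nil add0r subrr.
have [T kT eT] := IHs us.
have [t tk et] := mvt_line (\sum_(j <- s) k j *: e j + w) (k c) (fe c).
exists (fun c1 c2 => if c1 == c then
   (if c2 == c then t else if c2 \in s then k c2 else 0) else T c1 c2).
  move=> c1 c2; case: eqP => // _; case: eqP => [->//|_].
  by case: ifP; rewrite ?normr0.
rewrite !big_cons -addrA -(subrKA (f (\sum_(j <- s) k j *: e j + w))) et eT eqxx.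
congr (_ * 'D_(e c) f _ + _).
  rewrite addrA; congr (_ + w); rewrite (bigD1 c) //= eqxx; congr (_ + _).
  rewrite big_uniq //= [RHS](bigID (mem s)) /= [X in _ = _ + X]big1 ?addr0.
    apply: eq_big => [i|i si].
      by apply/idP/andP => [si|[]//]; split => //; apply: contraNneq cs => <-.
    by case: eqP => [ic|_]; [rewrite -ic si in cs|rewrite si].
  by move=> i /andP[ic /negPf is_]; rewrite (negPf ic) is_ scale0r.
rewrite big_seq [RHS]big_seq; apply: eq_bigr => c1 c1s.
by case: eqP => // c1c; rewrite -c1c c1s in cs.
Qed.

End MeanValue.

(** * Coordinates on configurations and the chain rule *)

Section Coordinates.
Variables (R : realType) (N d : nat).

Definition config := ('M[R]_(N, d) * 'M[R]_(N, d))%type.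
(** The Boolean selects the half of the pair: [false] for positions, [true] for the second
    component, which holds momenta in an argument of $a^N$ and actions in an argument of the
    system. *)
Definition coord := (bool * ('I_N * 'I_d))%type.
Implicit Types (c : coord) (z w : config).

Definition evc c : config :=
  if c.1 then (0, delta_mx c.2.1 c.2.2) else (delta_mx c.2.1 c.2.2, 0).

Definition co c z : R := (if c.1 then z.2 else z.1) c.2.1 c.2.2.

Definition pt c : 'I_N := c.2.1.

Lemma co_linear c (t : R) z w : co c (t *: z + w) = t * co c z + co c w.
Proof. by rewrite /co; case: c => [[]] [i b] /=; rewrite !mxE. Qed.

Lemma co0 c : co c 0 = 0.
Proof. by rewrite /co; case: c.1; rewrite mxE. Qed.

Lemma coD c z w : co c (z + w) = co c z + co c w.
Proof. by rewrite -{1}[z]scale1r co_linear mul1r. Qed.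

Lemma coZ c (t : R) z : co c (t *: z) = t * co c z.
Proof. by rewrite -[_ *: _]addr0 co_linear co0 addr0. Qed.

Lemma co_sum (I : Type) (s : seq I) (P : pred I) (F : I -> config) c :
  co c (\sum_(i <- s | P i) F i) = \sum_(i <- s | P i) co c (F i).
Proof. exact: (big_morph _ (coD c) (co0 c)). Qed.

Lemma co_evc c c' : co c (evc c') = (c == c')%:R.
Proof.
by case: c c' => [[] [i b]] [[] [j b']]; rewrite /co /evc /= !mxE // !xpair_eqE.
Qed.

Lemma co_ext z w : (forall c, co c z = co c w) -> z = w.
Proof.
case: z w => [u1 u2] [w1 w2] uw; congr (_, _); apply/matrixP => i b.
  exact: (uw (false, (i, b))).
exact: (uw (true, (i, b))).
Qed.

Lemma config_expand z : z = \sum_c co c z *: evc c.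
Proof.
apply: co_ext => c; rewrite co_sum (bigD1 c) //= big1 ?addr0.
  by rewrite coZ co_evc eqxx mulr1.
by move=> c' c'c; rewrite coZ co_evc eq_sym (negPf c'c) mulr0.
Qed.

Lemma continuous_co c : continuous (co c).
Proof.
move=> z; rewrite /co; case: c.1.
  exact (cvg_comp (snd : config -> _) (fun A : 'M[R]_(N, d) => A c.2.1 c.2.2)
    cvg_snd (@coord_continuous _ _ _ _ _ z.2)).
exact (cvg_comp (fst : config -> _) (fun A : 'M[R]_(N, d) => A c.2.1 c.2.2)
  cvg_fst (@coord_continuous _ _ _ _ _ z.1)).
Qed.

Lemma is_derive_co c z w : is_derive z w (co c) (co c w).
Proof.
apply: is_derive_quotient; apply: cvg_near_cst.
near=> h; rewrite co_linear addrK mulKf //.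
by near: h; exact: nbhs_dnbhs_neq.
Unshelve. all: by end_near. Qed.

Lemma cvg_config (T : Type) (F : set_system T) {FF : Filter F}
    (f : T -> config) w :
  (forall c, co c (f t) @[t --> F] --> co c w) -> f @ F --> w.
Proof.
move=> fw; rewrite [w]config_expand.
rewrite [X in X @ F](_ : f = fun t => \sum_c co c (f t) *: evc c); last first.
  by apply/funext => t; rewrite -config_expand.
apply: cvg_big => [|c _]; first exact: add_continuous.
exact: cvgZr_tmp.
Qed.

Lemma cvg_small (T : Type) (F : set_system T) {FF : Filter F} (k K : T -> R) :
  (forall t, `|k t| <= `|K t|) -> K t @[t --> F] --> 0 -> k t @[t --> F] --> 0.
Proof.
move=> kK /cvgr0Pnorm_lt K0; apply/cvgr0Pnorm_lt => e e0.
by near=> t; apply: le_lt_trans (kK t) _; near: t; exact: K0.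
Unshelve. all: by end_near. Qed.

(** Stated along an arbitrary filter, not along a line, because it is also applied to
    $(x,a^N(x,p))$, whose increments are not on a line and are not yet known to be
    differentiable. *)
Lemma mvt_config (T : Type) (F : set_system T) {FF : Filter F} (g : config -> R)
    (f : T -> config) w :
  (forall c x, derivable g x (evc c)) -> f @ F --> w ->
  exists2 xi : T -> coord -> config, (forall c, xi t c @[t --> F] --> w) &
    forall t, g (f t) - g w =
      \sum_c (co c (f t) - co c w) * 'D_(evc c) g (xi t c).
Proof.
move=> dg fw.
have /choice [X XP] : forall t, exists X : coord -> coord -> R,
   (forall c c', `|X c c'| <= `|co c' (f t) - co c' w|) /\
   g (f t) - g w = \sum_c (co c (f t) - co c w) *
      'D_(evc c) g (\sum_c' X c c' *: evc c' + w).
  move=> t; have [X X1 X2] := mvt_telescope w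
    (fun c => co c (f t) - co c w) dg.
  exists X; split => //; rewrite -X2; congr (g _ - _).
  rewrite -[LHS](subrK w); congr (_ + w).
  rewrite [LHS]config_expand; apply: eq_bigr => c _.
  by rewrite coD -scaleN1r coZ mulN1r.
exists (fun t c => \sum_c' X t c c' *: evc c' + w) => [c|t]; last exact: (XP t).2.
apply: cvg_config => c1; under eq_cvg do rewrite coD co_sum.
suff : \sum_c' co c1 (X t c c' *: evc c') + co c1 w @[t --> F] -->
    \sum_c' 0 * co c1 (evc c') + co c1 w.
  by rewrite big1 ?add0r // => i _; rewrite mul0r.
apply: cvgD; last exact: cvg_cst.
apply: cvg_finsum => c' _; under eq_cvg do rewrite coZ.
apply: cvgM; last exact: cvg_cst.
apply: (cvg_small (fun t => (XP t).1 c c')).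
suff : co c' (f t) - co c' w @[t --> F] --> co c' w - co c' w by rewrite subrr.
apply: cvgB; last exact: cvg_cst.
exact (cvg_comp f (co c') fw (@continuous_co c' w)).
Qed.

(** Continuous partial derivatives of [g] let the intermediate points of [mvt_config] go to the
    limit; of [f] only the difference quotients of its coordinates at [x] along [v] enter. *)
Lemma is_derive_comp (V : normedModType R) (g : config -> R) (f : V -> config)
    (x v : V) :
  (forall c y, derivable g y (evc c)) ->
  (forall c, continuous ('D_(evc c) g)) ->
  (forall c, derivable (co c \o f) x v) ->
  is_derive x v (g \o f)
    (\sum_c 'D_(evc c) g (f x) * 'D_v (co c \o f) x).
Proof.
move=> dg cdg df.
have cf : f (h *: v + x) @[h --> 0^'] --> f x.
  by apply: cvg_config => c; exact: (derivable_cvg (df c)).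
have [xi xix eg] := mvt_config dg cf.
apply: is_derive_quotient; rewrite /comp.
under eq_cvg do rewrite eg mulr_sumr.
apply: cvg_finsum => c _.
under eq_cvg do rewrite mulrA mulrC.
apply: cvgM.
  exact (cvg_comp (xi ^~ c) ('D_(evc c) g) (xix c) (cdg c (f x))).
exact: (cvg_derive (df c)).
Qed.

End Coordinates.

(** * Weights and weighted classes of functions *)

Section Weights.
Variables (R : realType) (N : nat).
Implicit Types (S T : seq 'I_N) (l : 'I_N).

(** $\omega^N$ with a natural exponent: truncated subtraction gives the value 1 on the empty list,
    and [weightE] identifies it with [weight] on the others. *)
Definition wt S : R := N%:R^-1 ^+ (size (undup S)).-1.

Lemma weightE S : S != [::] -> weight R S = wt S.
Proof.
case: S => // i S _; rewrite /weight /wt.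
have : (0 < size (undup (i :: S)))%N.
  by rewrite lt0n size_eq0; apply/eqP => /undup_nil.
case: (size _) => // n _ /=.
rewrite -[n.+1%:Z]/(1 + n)%:Z PoszD opprD addrA subrr add0r.
by rewrite -invr_expz -exprnP exprVn.
Qed.

Lemma wt_eqi S T : S =i T -> wt S = wt T.
Proof.
move=> ST; rewrite /wt; congr (_ ^+ _.-1).
by apply/perm_size/uniq_perm; rewrite ?undup_uniq // => i; rewrite !mem_undup.
Qed.

Lemma invN_ge0 : 0 <= N%:R^-1 :> R.
Proof. by rewrite invr_ge0 ler0n. Qed.

Lemma invN_le1 : N%:R^-1 <= 1 :> R.
Proof.
have [->|N0] := posnP N; first by rewrite invr0 ler01.
by rewrite invf_le1 ?ltr0n // ler1n.
Qed.

Lemma wt_ge0 S : 0 <= wt S. Proof. exact: exprn_ge0 invN_ge0. Qed.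

Lemma wt1 l : wt [:: l] = 1. Proof. by []. Qed.

Lemma wt_nil : wt [::] = 1. Proof. by []. Qed.

Lemma size_undup_card S : size (undup S) = #|[set i in S]%SET|.
Proof.
by rewrite cardsE -(card_uniqP (undup_uniq S)); apply: eq_card => i; rewrite mem_undup.
Qed.

Lemma wt_cons_notin l S : S != [::] -> l \notin S -> wt (l :: S) = N%:R^-1 * wt S.
Proof.
case: S => // i S _ lS; rewrite /wt [undup (l :: _)]/= (negPf lS) /=.
by rewrite -exprS prednK // lt0n size_eq0; case: ifP => // iS; apply/eqP => e;
  have := mem_undup S i; rewrite e iS.
Qed.

Lemma wt_cons_in l S : l \in S -> wt (l :: S) = wt S.
Proof.
by move=> lS; apply: wt_eqi => i; rewrite inE; case: eqP => // ->; rewrite lS.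
Qed.

Lemma wt_cons_ge l S : N%:R^-1 * wt S <= wt (l :: S).
Proof.
have [->|S0] := eqVneq S [::]; first by rewrite wt_nil wt1 mulr1 invN_le1.
have [lS|lS] := boolP (l \in S); last by rewrite wt_cons_notin.
by rewrite wt_cons_in // ler_piMl ?wt_ge0 ?invN_le1.
Qed.

(** Inclusion-exclusion: the two index sets share [l], so their sizes add up to at least one more
    than the size of the union, which contains [S ++ T]. *)
Lemma wt_mul_sub l S T : wt (l :: S) * wt (l :: T) <= wt (S ++ T).
Proof.
rewrite /wt -exprD; apply: ler_wiXn2l; [exact: invN_ge0|exact: invN_le1|].
have sl U : (0 < size (undup (l :: U)))%N.
  by rewrite lt0n size_eq0; apply/eqP => /undup_nil.
suff : ((size (undup (S ++ T))).+1 <=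
        size (undup (l :: S)) + size (undup (l :: T)))%N.
  by have := sl S; have := sl T; lia.
rewrite !size_undup_card.
set A := [set i in l :: S]%SET; set B := [set i in l :: T]%SET.
rewrite -cardsUI -addn1; apply: leq_add.
  by apply/subset_leq_card/fintype.subsetP => i; rewrite !inE mem_cat => /orP[] ->;
    rewrite !orbT.
by rewrite card_gt0; apply/set0Pn; exists l; rewrite !inE eqxx.
Qed.

Lemma sum_mem_le S : \sum_l (l \in S)%:R <= (size S)%:R :> R.
Proof.
rewrite -natr_sum ler_nat (eq_bigr (fun l => if l \in S then 1%N else 0%N)).
  by rewrite -big_mkcond sum1_card card_size.
by move=> l _; case: (l \in S).
Qed.

(** Indices in [S] or [T] are few, and each contributes at most [wt (S ++ T)] by [wt_mul_sub]. The
    remaining indices, up to $N$ of them, each contribute $1/N$ of that, so together they count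
    once. The map [p] sends a coordinate to its particle, and [D] bounds the number of coordinates
    per particle. *)
Lemma wt_conv (J : finType) (p : J -> 'I_N) (D : nat) S T :
  S != [::] -> T != [::] -> (forall l, (#|[pred j | p j == l]| <= D)%N) ->
  \sum_j wt (p j :: S) * wt (p j :: T) <=
    (D * (size S + size T + 1))%N%:R * wt (S ++ T).
Proof.
move=> S0 T0 pD; rewrite (partition_big p predT) //=.
have -> : (D * (size S + size T + 1))%N%:R * wt (S ++ T) =
    D%:R * ((size S)%:R * wt (S ++ T) + (size T)%:R * wt (S ++ T) + wt (S ++ T)).
  by rewrite natrM !natrD; ring.
apply: (@le_trans _ _ (\sum_l D%:R * (((l \in S)%:R * wt (S ++ T)) +
    ((l \in T)%:R * wt (S ++ T)) + N%:R^-1 * wt (S ++ T)))).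
  apply: ler_sum => l _.
  rewrite (eq_bigr (fun=> wt (l :: S) * wt (l :: T))); last first.
    by move=> j /eqP ->.
  rewrite sumr_const -[leLHS]mulr_natl; apply: ler_pM => //.
  - by rewrite mulr_ge0 ?wt_ge0.
  - by rewrite ler_nat pD.
  have w0 := wt_ge0 (S ++ T).
  have [lS|lS] := boolP (l \in S).
    rewrite mul1r -addrA ler_wpDr ?wt_mul_sub // addr_ge0 //.
      by rewrite mulr_ge0 ?ler0n.
    by rewrite mulr_ge0 ?invN_ge0.
  have [lT|lT] := boolP (l \in T).
    rewrite mul0r add0r mul1r ler_wpDr ?wt_mul_sub //.
    by rewrite mulr_ge0 ?invN_ge0.
  rewrite !mul0r !add0r.
  (* A new index costs $1/N$ in both factors; one of the two powers pays for the exponent lost when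
     [S] and [T] are merged. *)
  rewrite !wt_cons_notin // -mulrA ler_wpM2l ?invN_ge0 //.
  rewrite mulrCA /wt -exprD -exprS.
  apply: ler_wiXn2l; [exact: invN_ge0|exact: invN_le1|].
  have sl (U : seq 'I_N) : U != [::] -> (0 < size (undup U))%N.
    by move=> U0; rewrite lt0n size_eq0; apply: contraNneq U0 => /undup_nil ->.
  suff : (size (undup (S ++ T)) <= size (undup S) + size (undup T))%N.
    by have := sl S S0; have := sl T T0; lia.
  rewrite !size_undup_card.
  have -> : [set i in S ++ T]%SET = ([set i in S] :|: [set i in T])%SET.
    by apply/setP => i; rewrite !inE mem_cat.
  by rewrite cardsU leq_subr.
rewrite -mulr_sumr ler_wpM2l // !big_split /= sumr_const card_ord.
apply: lerD; first apply: lerD.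
- by rewrite -mulr_suml ler_wpM2r ?wt_ge0 // sum_mem_le.
- by rewrite -mulr_suml ler_wpM2r ?wt_ge0 // sum_mem_le.
- rewrite -[leLHS]mulr_natl mulrA ler_piMl ?wt_ge0 //.
  have [->|N0] := posnP N; first by rewrite mul0r ler01.
  by rewrite divff // pnatr_eq0 -lt0n.
Qed.

End Weights.

Section WeightedClass.
Variables (R : realType) (N d : nat).
Implicit Types (S T : seq 'I_N) (K : R) (f g : config R N d -> R)
  (c : coord N d).

(* [S] collects the index of the component and the particles with respect to
   which one has already differentiated, so that [wt R S] is the $\omega^N$ of the
   derivative at hand. *)
Fixpoint weighted (k : nat) S K g : Prop :=
  [/\ continuous g, forall z, `|g z| <= K * wt R S &
    if k is k'.+1 then forall c, (forall z, derivable g z (evc R c)) /\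
      weighted k' (pt c :: S) K ('D_(evc R c) g)
    else True].

Lemma weighted_continuous k S K g : weighted k S K g -> continuous g.
Proof. by case: k => [|k] []. Qed.

Lemma weighted_bound k S K g z : weighted k S K g -> `|g z| <= K * wt R S.
Proof. by case: k => [|k] []. Qed.

Lemma weightedW k S K g : weighted k.+1 S K g -> weighted k S K g.
Proof.
elim: k S g => [|k IH] S g [cg bg dg]; first by [].
split => // c; have [dgc Wc] := dg c; split => //; exact: IH.
Qed.

Lemma weighted_le k S K K' g : K <= K' -> weighted k S K g -> weighted k S K' g.
Proof.
move=> KK'; elim: k S g => [|k IH] S g [cg bg dg]; split => //.
- by move=> z; apply: le_trans (bg z) _; rewrite ler_wpM2r ?wt_ge0.
- by move=> z; apply: le_trans (bg z) _; rewrite ler_wpM2r ?wt_ge0.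
by move=> c; have [dgc Wc] := dg c; split => //; exact: IH.
Qed.

Lemma weighted_eqi k S S' K g : S =i S' -> weighted k S K g -> weighted k S' K g.
Proof.
elim: k S S' g => [|k IH] S S' g SS' [cg bg dg]; split => //.
- by move=> z; rewrite -(wt_eqi R SS').
- by move=> z; rewrite -(wt_eqi R SS').
move=> c; have [dgc Wc] := dg c; split => //; apply: IH Wc => i.
by rewrite !in_cons SS'.
Qed.

Lemma weighted_cst k S K (a : R) : 0 <= K -> `|a| <= K * wt R S ->
  weighted k S K (fun=> a).
Proof.
move=> K0; elim: k S a => [|k IH] S a aK; split => //.
- exact: cst_continuous.
- exact: cst_continuous.
move=> c; split => [z|]; first exact: derivable_cst.
have -> : 'D_(evc R c) (fun=> a) = (fun=> 0 : R).
  by apply/funext => z; rewrite derive_cst.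
by apply: IH; rewrite normr0 mulr_ge0 ?wt_ge0.
Qed.

Lemma weightedD k S K K' f g : weighted k S K f -> weighted k S K' g ->
  weighted k S (K + K') (fun z => f z + g z).
Proof.
elim: k S f g => [|k IH] S f g [cf bf df] [cg bg dg].
  split => // [z|z]; first by apply: cvgD; [exact: cf|exact: cg].
  by rewrite mulrDl (le_trans (ler_normD _ _)) // lerD.
split => [z|z|c]; first by apply: cvgD; [exact: cf|exact: cg].
  by rewrite mulrDl (le_trans (ler_normD _ _)) // lerD.
have [dfc Wf] := df c; have [dgc Wg] := dg c.
split => [z|]; first exact: derivableD.
have -> : 'D_(evc R c) (fun z => f z + g z) =
    (fun z => 'D_(evc R c) f z + 'D_(evc R c) g z).
  by apply/funext => z; exact: deriveD.
exact: IH.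
Qed.

Lemma weightedM k S K a g : weighted k S K g ->
  weighted k S (`|a| * K) (fun z => a * g z).
Proof.
elim: k S g => [|k IH] S g [cg bg dg].
  split => // [z|z]; first by apply: cvgM; [exact: cvg_cst|exact: cg].
  by rewrite normrM -mulrA ler_wpM2l.
split => [z|z|c]; first by apply: cvgM; [exact: cvg_cst|exact: cg].
  by rewrite normrM -mulrA ler_wpM2l.
have [dgc Wg] := dg c.
split => [z|]; first exact: derivableZ.
have -> : 'D_(evc R c) (fun z => a * g z) = (fun z => a * 'D_(evc R c) g z).
  by apply/funext => z; exact: deriveZ.
exact: IH.
Qed.

Lemma weightedN k S K g : weighted k S K g -> weighted k S K (fun z => - g z).
Proof.
move=> Wg; have -> : (fun z => - g z) = (fun z => -1 * g z).
  by apply/funext => z; rewrite mulN1r.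
by have := weightedM (-1) Wg; rewrite normrN1 mul1r.
Qed.

Lemma weighted_sum k S K (J : finType) (P : pred J) (f : J -> config R N d -> R) :
  0 <= K -> (forall j, P j -> weighted k S K (f j)) ->
  weighted k S (#|J|%:R * K) (fun z => \sum_(j | P j) f j z).
Proof.
move=> K0 Wf.
have -> : (fun z => \sum_(j | P j) f j z) =
          (fun z => \sum_(j <- enum J) (if P j then f j z else 0)).
  by apply/funext => z; rewrite big_enum /= [LHS]big_mkcond.
rewrite cardE; elim: (enum J) => [|j s IHs].
  have -> : (fun z => \sum_(j <- [::]) (if P j then f j z else 0)) = (fun=> 0).
    by apply/funext => z; rewrite big_nil.
  by apply: weighted_cst; rewrite /= ?mul0r // normr0.
have -> : (fun z => \sum_(j0 <- j :: s) (if P j0 then f j0 z else 0)) =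
   (fun z => (if P j then f j z else 0) +
      \sum_(j0 <- s) (if P j0 then f j0 z else 0)).
  by apply/funext => z; rewrite big_cons.
rewrite /= -natr1 mulrDl mul1r addrC; apply: weightedD => //.
case: (boolP (P j)) => [/Wf //|_].
by apply: weighted_cst; rewrite // normr0 mulr_ge0 ?wt_ge0.
Qed.

Lemma derivable_fsum (J : finType) (f : J -> config R N d -> R) z v :
  (forall j, derivable (f j) z v) ->
  is_derive z v (fun z => \sum_j f j z) (\sum_j 'D_v (f j) z).
Proof.
move=> df; apply: is_derive_quotient.
under eq_cvg do rewrite -sumrB mulr_sumr.
by apply: cvg_finsum => j _; exact: cvg_derive.
Qed.

(** Order zero is [wt_conv]. The Leibniz rule replaces the sum by two sums of the same form, with
    the new particle attached to [S] in one and to [T] in the other; this accounts for $2^k$ and for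
    the summand [k] in the constant. *)
Lemma weighted_prodsum k (J : finType) (p : J -> 'I_N) (D : nat) S T K K'
    (f g : J -> config R N d -> R) :
  0 <= K -> 0 <= K' -> S != [::] -> T != [::] ->
  (forall l, (#|[pred j | p j == l]| <= D)%N) ->
  (forall j, weighted k (p j :: S) K (f j)) ->
  (forall j, weighted k (p j :: T) K' (g j)) ->
  weighted k (S ++ T) ((2 ^ k * (D * (size S + size T + k + 1)))%N%:R * (K * K'))
    (fun z => \sum_j f j z * g j z).
Proof.
move=> K0 K'0 + + pD; elim: k S T f g => [|k IH] S T f g S0 T0 Wf Wg.
  split => // [z|z].
    apply: cvg_finsum => j _; apply: cvgM.
      exact: (weighted_continuous (Wf j)).
    exact: (weighted_continuous (Wg j)).
  rewrite mul1n addn0 (le_trans (ler_norm_sum _ _ _)) //.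
  apply: (@le_trans _ _ (\sum_j (K * K') * (wt R (p j :: S) * wt R (p j :: T)))).
    apply: ler_sum => j _; rewrite normrM mulrACA.
    by apply: ler_pM => //; [exact: (weighted_bound z (Wf j))|
      exact: (weighted_bound z (Wg j))].
  rewrite -mulr_sumr mulrC -mulrA [leRHS]mulrCA mulrC ler_wpM2l ?mulr_ge0 //.
  exact: wt_conv.
split => [z|z|c].
- apply: cvg_finsum => j _; apply: cvgM.
    exact: (weighted_continuous (Wf j)).
  exact: (weighted_continuous (Wg j)).
- have /(weighted_bound z) /= := IH S T f g S0 T0 (fun j => weightedW (Wf j))
    (fun j => weightedW (Wg j)).
  move/le_trans; apply; rewrite ler_wpM2r ?wt_ge0 // ler_wpM2r ?mulr_ge0 //.
  rewrite ler_nat expnS; nia.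
have dfg z j : is_derive z (evc R c) (fun z => f j z * g j z)
    ('D_(evc R c) (f j) z * g j z + f j z * 'D_(evc R c) (g j) z).
  have [_ _ /(_ c)[dfc _]] := Wf j; have [_ _ /(_ c)[dgc _]] := Wg j.
  have H : derivable (f j * g j) z (evc R c) by exact: derivableM.
  split; first exact: H.
  apply: etrans (deriveM (dfc z) (dgc z)) _.
  by rewrite addrC; congr (_ + _); exact: mulrC.
have dS z := @derivable_fsum J (fun j z => f j z * g j z) z (evc R c)
  (fun j => @ex_derive _ _ _ _ _ _ _ (dfg z j)).
split => [z|]; first exact: (@ex_derive _ _ _ _ _ _ _ (dS z)).
have -> : 'D_(evc R c) (fun z => \sum_j f j z * g j z) =
   (fun z => \sum_j 'D_(evc R c) (f j) z * g j z +
             \sum_j f j z * 'D_(evc R c) (g j) z).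
  apply/funext => z; rewrite (@derive_val _ _ _ _ _ _ _ (dS z)) -big_split /=.
  by apply: eq_bigr => j _; exact: derive_val.
have -> : (2 ^ k.+1 * (D * (size S + size T + k.+1 + 1)))%N%:R * (K * K') =
   (2 ^ k * (D * (size (pt c :: S) + size T + k + 1)))%N%:R * (K * K') +
   (2 ^ k * (D * (size S + size (pt c :: T) + k + 1)))%N%:R * (K * K') :> R.
  rewrite -mulrDl -natrD; congr (_%:R * _) => /=; rewrite expnS; lia.
apply: weightedD.
  apply: (IH (pt c :: S)) => // j; last exact: weightedW.
  have [_ _ /(_ c)[_]] := Wf j; apply: weighted_eqi => i.
  by rewrite !in_cons orbCA.
have := IH S (pt c :: T) f (fun j => 'D_(evc R c) (g j)) S0 isT.
move=> IH'; apply: weighted_eqi; last apply: IH' => // j.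
- by move=> i; rewrite !(in_cons, mem_cat) orbCA.
- exact: weightedW.
have [_ _ /(_ c)[_]] := Wg j; apply: weighted_eqi => i.
by rewrite !in_cons orbCA.
Qed.

End WeightedClass.

(** * Coercive linear systems *)

Section CoerciveSystems.
Variables (R : realType) (J : finType).
Implicit Types (M : J -> J -> R) (v r : J -> R).

Definition coercive (c : R) M := forall v : J -> R,
  c * \sum_i v i ^+ 2 <= \sum_i v i * \sum_j M i j * v j.

Lemma sqr_sum_norm_le (P : pred J) v :
  (\sum_(i | P i) `|v i|) ^+ 2 <= #|J|%:R * \sum_(i | P i) v i ^+ 2.
Proof.
have S0 : 0 <= \sum_(i | P i) v i ^+ 2 by apply: sumr_ge0 => i _; exact: sqr_ge0.
rewrite expr2 big_distrlr /=.
apply: (@le_trans _ _ (\sum_(i | P i) \sum_(j | P j)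
   (v i ^+ 2 / 2 + v j ^+ 2 / 2))).
  apply: ler_sum => i _; apply: ler_sum => j _.
  have := sqr_ge0 (`|v i| - `|v j|).
  by rewrite -(real_normK (num_real (v i))) -(real_normK (num_real (v j))); nra.
set S := \sum_(i | P i) v i ^+ 2.
have -> : \sum_(i | P i) \sum_(j | P j) (v i ^+ 2 / 2 + v j ^+ 2 / 2) =
   #|P|%:R * S.
  rewrite (eq_bigr (fun i => #|P|%:R * (v i ^+ 2 / 2) + S / 2)) => [|i _].
    rewrite big_split /= sumr_const -mulr_sumr -mulr_suml -/S -mulr_natl.
    by rewrite mulr1; field.
  by rewrite big_split /= sumr_const mulr_natl -mulr_suml //.
by rewrite ler_wpM2r // ler_nat max_card.
Qed.

(* Testing coercivity against the restriction of the solution to [P]. *)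
Lemma coercive_restrict (c : R) M r v (P : pred J) (rho : J -> R) :
  0 < c -> coercive c M -> (forall i, \sum_j M i j * v j = r i) ->
  (forall i, P i -> `|r i - \sum_(j | ~~ P j) M i j * v j| <= rho i) ->
  c ^+ 2 * \sum_(i | P i) v i ^+ 2 <= \sum_(i | P i) rho i ^+ 2.
Proof.
move=> c0 cM Mv rr.
have := cM (fun i => if P i then v i else 0).
have -> : \sum_i (if P i then v i else 0) ^+ 2 = \sum_(i | P i) v i ^+ 2.
  rewrite [RHS]big_mkcond; apply: eq_bigr => i _.
  by case: ifP => // _; rewrite expr0n.
have -> : \sum_i (if P i then v i else 0) * \sum_j M i j * (if P j then v j else 0)
    = \sum_(i | P i) v i * (r i - \sum_(j | ~~ P j) M i j * v j).
  rewrite [RHS]big_mkcond; apply: eq_bigr => i _.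
  case: ifP => // _; last by rewrite mul0r.
  congr (_ * _); rewrite -Mv [in RHS](bigID P) /= addrK [RHS]big_mkcond.
  by apply: eq_bigr => j _; case: ifP => // _; rewrite mulr0.
move=> H.
(* Young's inequality with weight [c / 2], so that half of the coercive term absorbs the product. *)
have : \sum_(i | P i) v i * (r i - \sum_(j | ~~ P j) M i j * v j) <=
    \sum_(i | P i) (c / 2 * v i ^+ 2 + rho i ^+ 2 / (2 * c)).
  apply: ler_sum => i Pi; have := rr i Pi; set g := r i - _ => gr.
  have g2 : g ^+ 2 <= rho i ^+ 2.
    by rewrite -(real_normK (num_real g)); apply: lerXn2r;
      rewrite ?nnegrE // (le_trans _ gr).
    rewrite -subr_ge0.
  have -> : c / 2 * v i ^+ 2 + rho i ^+ 2 / (2 * c) - v i * g =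
    ((c * v i - g) ^+ 2 + (rho i ^+ 2 - g ^+ 2)) / (2 * c).
    by field; rewrite gt_eqF.
  apply: divr_ge0; last by rewrite mulr_ge0 // ltW.
  by rewrite addr_ge0 ?sqr_ge0 // subr_ge0.
rewrite big_split /= -mulr_sumr -mulr_suml => H2.
have {H H2} := le_trans H H2; set S := \sum_(i | P i) v i ^+ 2.
set Q := \sum_(i | P i) rho i ^+ 2 => H.
have : c / 2 * S <= Q / (2 * c) by lra.
rewrite ler_pdivlMr ?mulr_gt0 //; lra.
Qed.

Lemma sum_enum_val (F : J -> R) : \sum_j F j = \sum_(k < #|J|) F (enum_val k).
Proof.
rewrite (reindex (fun k : 'I_#|J| => enum_val k)) //=.
by exists enum_rank => i _; rewrite ?enum_valK ?enum_rankK.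
Qed.

(** A left kernel vector, tested against itself, would violate coercivity. Determinants need
    ordinals as indices, hence the passage through [enum_val]. *)
Lemma coercive_det (c : R) M : 0 < c -> coercive c M ->
  \det (\matrix_(i < #|J|, j < #|J|) M (enum_val i) (enum_val j)) != 0.
Proof.
move=> c0 cM; apply/negP => /det0P[u u0 uM].
pose v i := u 0 (enum_rank i).
have := cM v.
have -> : \sum_i v i * (\sum_j M i j * v j) = 0.
  under eq_bigr do rewrite mulr_sumr.
  rewrite exchange_big /= big1 // => j _.
  under eq_bigr do rewrite mulrA.
  rewrite -mulr_suml sum_enum_val.
  move/rowP : uM => /(_ (enum_rank j)); rewrite !mxE.
  under eq_bigr do rewrite mxE enum_rankK.
  by under [X in X * _]eq_bigr do rewrite /v enum_valK; move=> ->; rewrite mul0r.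
rewrite pmulr_rle0 // => S0.
have v0 : forall i, v i = 0.
  move=> i; apply/eqP; rewrite -sqrf_eq0 eq_le sqr_ge0 andbT.
  apply: le_trans S0; rewrite (bigD1 i) //= lerDl.
  by apply: sumr_ge0 => j _; exact: sqr_ge0.
move/eqP : u0; apply; apply/rowP => i; rewrite mxE.
by have := v0 (enum_val i); rewrite /v enum_valK.
Qed.

Lemma cvg_det (T : Type) (F : set_system T) {FF : Filter F} n
    (A : T -> 'M[R]_n) (A0 : 'M[R]_n) :
  (forall i j, A t i j @[t --> F] --> A0 i j) -> \det (A t) @[t --> F] --> \det A0.
Proof.
move=> AA; rewrite /determinant; apply: cvg_finsum => s _.
apply: cvgM; first exact: cvg_cst.
by apply: cvg_finprod => i _; exact: AA.
Qed.

(* Cramer's rule replaces any continuity argument for the inverse matrix. *)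
Lemma cvg_coercive (T : Type) (F : set_system T) {FF : ProperFilter F} (c : R)
    (B : T -> J -> J -> R) M (rho q : T -> J -> R) r :
  0 < c -> coercive c M -> (forall i j, B t i j @[t --> F] --> M i j) ->
  (forall i, rho t i @[t --> F] --> r i) ->
  (\forall t \near F, forall i, \sum_j B t i j * q t j = rho t i) ->
  exists2 u, (forall i, \sum_j M i j * u j = r i) &
    (forall i, q t i @[t --> F] --> u i).
Proof.
move=> c0 cM BM rhor Bq.
pose mx (A : J -> J -> R) := \matrix_(i < #|J|, j < #|J|) A (enum_val i) (enum_val j).
have detM : \det (mx M) != 0 by exact: coercive_det c0 cM.
have detB : \det (mx (B t)) @[t --> F] --> \det (mx M).
  by apply: cvg_det => i j; rewrite mxE; under eq_cvg do rewrite mxE; exact: BM.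
pose sol (A : J -> J -> R) (w : J -> R) (i : J) :=
  (\det (mx A))^-1 * \sum_j (\adj (mx A)) (enum_rank i) j * w (enum_val j).
exists (sol M r) => [i|i]; last first.
  have e : \forall t \near F, sol (B t) (rho t) i = q t i.
    near=> t.
    (* Coercivity is known for the limit [M] only; the matrices [B t] inherit just a nonzero
       determinant, and only near the limit. *)
    have d0 : \det (mx (B t)) != 0.
      by near: t; apply: (cvgr_neq0 _ detB).
    have Bqt : forall i, \sum_j B t i j * q t j = rho t i by near: t.
    rewrite /sol.
    have -> : \sum_j (\adj (mx (B t))) (enum_rank i) j * rho t (enum_val j) =
       \det (mx (B t)) * q t i.
      have := congr1 (fun A : 'M[R]_(#|J|) => (A *m (\col_j q t (enum_val j))) (enum_rank i) 0)
        (mul_adj_mx (mx (B t))).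
      rewrite /= -mulmxA mul_scalar_mx [in RHS]mxE [in RHS]mxE enum_rankK => <-.
      rewrite mxE; apply: eq_bigr => j _; congr (_ * _).
      rewrite mxE -Bqt sum_enum_val.
      by apply: eq_bigr => k _; rewrite !mxE.
    by rewrite mulKf.
  suff : sol (B t) (rho t) i @[t --> F] --> sol M r i.
    by apply: cvg_trans; exact: near_eq_cvg.
  apply: cvgM; first exact: cvgV.
  apply: cvg_finsum => j _; apply: cvgM; last exact: rhor.
  rewrite mxE; under eq_cvg do rewrite mxE.
  apply: cvgM; first exact: cvg_cst.
  by apply: cvg_det => a b; rewrite !mxE; under eq_cvg do rewrite !mxE; exact: BM.
have := congr1 (fun A : 'M[R]_(#|J|) => (A *m (\col_j r (enum_val j))) (enum_rank i) 0)
   (mul_mx_adj (mx M)).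
rewrite /= -mulmxA mul_scalar_mx mxE [in RHS]mxE [in RHS]mxE enum_rankK => e.
apply: (mulfI detM); rewrite -e mulr_sumr sum_enum_val.
apply: eq_bigr => k _; rewrite !mxE enum_rankK /sol enum_valK mulrCA mulVKf //.
by congr (_ * _); apply: eq_bigr => j _; rewrite !mxE.
Unshelve. all: by end_near. Qed.

End CoerciveSystems.

Section WeightedSystems.
Variables (R : realType).

Lemma norm_le_of_sqr (x y : R) : 0 <= y -> x ^+ 2 <= y ^+ 2 -> `|x| <= y.
Proof.
move=> y0; rewrite -(real_normK (num_real x)).
by rewrite ler_pXn2r // ?nnegrE.
Qed.

Lemma sum_fiber_le N (J : finType) (p : J -> 'I_N) (D : nat) (F : 'I_N -> R) :
  (forall l, (#|[pred j | p j == l]| <= D)%N) -> (forall l, 0 <= F l) ->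
  \sum_j F (p j) <= D%:R * \sum_l F l.
Proof.
move=> pD F0; rewrite (partition_big p predT) //= mulr_sumr.
apply: ler_sum => l _; rewrite (eq_bigr (fun=> F l)) => [|j /eqP -> //].
by rewrite sumr_const -[leLHS]mulr_natl ler_wpM2r // ler_nat pD.
Qed.

(** In units of [k * wt R S], [B1] bounds every entry of the solution, [B2 / N] the residual of a
    row off [S] once the entries on [S] are moved to the right, and [B3 / N] that of a row once all
    other particles are moved. The successors replace square roots: $\sqrt m\le m+1$ for $m=D(s+1)$
    and $m=D$. *)
Definition solve_const (c K : R) (s D : nat) : R :=
  let B1 := ((D * s.+1).+1)%:R / c in
  let B2 := 1 + K * ((D * s)%:R * B1) in
  let B3 := 1 + K * ((D * s)%:R * B1 + D%:R * B2 / c) in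
  B1 + D.+1%:R * B3 / c.

(* First the $\ell^2$ bound gives $v = O(w)$, which is enough on the particles of
   [S].  Testing with $v$ off [S] gives $\|v\|_1 = O(w)$, because the off-diagonal
   entries of [M] are $O(1/N)$.  A single row tested against its own block then
   gives $v_i = O(w/N)$ off [S]. *)
Lemma weighted_system_bound N (J : finType) (p : J -> 'I_N) (D s : nat)
    (S : seq 'I_N) (c K k : R) (M : J -> J -> R) (v r : J -> R) :
  0 < c -> 0 <= K -> 0 <= k -> S != [::] -> (size S <= s)%N ->
  (forall l, (#|[pred j | p j == l]| <= D)%N) ->
  coercive c M -> (forall i j, `|M i j| <= K * wt R [:: p i; p j]) ->
  (forall i, \sum_j M i j * v j = r i) ->
  (forall i, `|r i| <= k * wt R (p i :: S)) ->
  forall i, `|v i| <= solve_const c K s D * k * wt R (p i :: S).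
Proof.
move=> c0 K0 k0 S0 Ss pD cM MK Mv rk i0.
have N0 : (0 < N)%N by apply: leq_ltn_trans (ltn_ord (p i0)).
pose n : R := N%:R; have n0 : 0 < n by rewrite ltr0n.
pose w := k * wt R S; have w0 : 0 <= w by rewrite mulr_ge0 ?wt_ge0.
pose mS (l : 'I_N) : R := (l \in S)%:R.
have sumS : \sum_l mS l <= s%:R.
  by rewrite (le_trans (sum_mem_le R S)) // ler_nat.
have wtS l : wt R (l :: S) = (if l \in S then 1 else n^-1) * wt R S.
  by case: ifPn => lS; [rewrite wt_cons_in // mul1r|rewrite wt_cons_notin].
have n1 : n^-1 <= 1 by exact: invN_le1.
have ni0 : 0 <= n^-1 by exact: invN_ge0.
have MN i j : p i != p j -> `|M i j| <= K / n.
  move=> pij; rewrite (le_trans (MK i j)) // ler_wpM2l //.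
  by rewrite wt_cons_notin ?inE // wt1 mulr1.
have rk' i : `|r i| <= w * (if p i \in S then 1 else n^-1).
  by rewrite (le_trans (rk i)) // wtS mulrCA mulrC.
rewrite /solve_const; set X : nat := (D * s.+1).+1.
set B1 := X%:R / c; set a : R := (D * s)%:R.
set B2 := 1 + K * (a * B1); set B3 := 1 + K * (a * B1 + D%:R * B2 / c).
have a0 : 0 <= a by exact: ler0n.
have B10 : 0 <= B1 by rewrite /B1 divr_ge0 ?ler0n // ltW.
have B20 : 0 <= B2 by rewrite /B2 addr_ge0 // mulr_ge0 // mulr_ge0.
have B30 : 0 <= B3.
  rewrite /B3 addr_ge0 // mulr_ge0 // addr_ge0 //; first by rewrite mulr_ge0.
  by rewrite divr_ge0 ?(mulr_ge0 _ B20) ?ler0n // ltW.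
(* The squared data sum to at most $w^2D(s+1)$: at most [s] particles lie in [S], and the others
   together contribute $N\cdot N^{-2}\le1$ per coordinate. *)
have v_le_B1 i : `|v i| <= w * B1.
  have H : c ^+ 2 * \sum_i v i ^+ 2 <=
     \sum_i (w * (if p i \in S then 1 else n^-1)) ^+ 2.
    apply: (@coercive_restrict _ _ c M r v predT) => // j _.
    by rewrite [X in r j - X]big1 ?subr0.
  have H2 : \sum_i (w * (if p i \in S then 1 else n^-1)) ^+ 2 <=
      w ^+ 2 * (D * s.+1)%N%:R.
    under eq_bigr do rewrite exprMn.
    rewrite -mulr_sumr ler_wpM2l ?sqr_ge0 //.
    apply: (@le_trans _ _ (D%:R * \sum_l (if l \in S then 1 else n^-1) ^+ 2)).
      by apply: (sum_fiber_le (F := fun l => (if l \in S then 1 else n^-1) ^+ 2)) => // l;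
        exact: sqr_ge0.
    rewrite natrM ler_wpM2l // -natr1.
    apply: (@le_trans _ _ (\sum_l (mS l + n^-1))).
      apply: ler_sum => l _; rewrite /mS; case: ifP => _.
        by rewrite expr1n lerDl.
      by rewrite add0r expr2 ler_piMl.
    rewrite big_split /= sumr_const card_ord lerD // -[_ *+ N]mulr_natl.
    by rewrite divff // gt_eqF.
  have H3 : v i ^+ 2 <= \sum_i v i ^+ 2.
    by rewrite (bigD1 i) //= lerDl sumr_ge0 // => j _; exact: sqr_ge0.
  have X1 : (D * s.+1)%N%:R <= X%:R ^+ 2 :> R.
    by rewrite -natrX ler_nat (leq_trans (leqnSn _)) // leq_pmulr.
  rewrite /B1 mulrA ler_pdivlMr //.
  have -> : `|v i| * c = `|v i * c| by rewrite normrM (gtr0_norm c0).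
  apply: norm_le_of_sqr; first by rewrite mulr_ge0.
  rewrite exprMn [in leRHS]exprMn mulrC.
  apply: (@le_trans _ _ (c ^+ 2 * \sum_i v i ^+ 2)).
    by rewrite ler_wpM2l ?sqr_ge0.
  apply: le_trans H (le_trans H2 _); rewrite ler_wpM2l ?sqr_ge0 //.
have sumA : \sum_(j | p j \in S) `|v j| <= w * (a * B1).
  apply: (@le_trans _ _ (\sum_j mS (p j) * (w * B1))).
    rewrite [leLHS]big_mkcond; apply: ler_sum => j _; rewrite /mS.
    by case: ifP => _; rewrite ?mul1r ?mul0r.
  rewrite -mulr_suml mulrCA ler_wpM2l // ler_wpM2r //.
  apply: le_trans (sum_fiber_le (F := mS) pD _) _; first by move=> l; exact: ler0n.
  by rewrite /a natrM ler_wpM2l.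
(* Rows off [S] see the entries on [S] only through coefficients at most $K/N$. The $\ell^2$ bound
   so obtained is turned into an $\ell^1$ bound by Cauchy-Schwarz over at most $DN$ indices, which
   consumes the factor $1/N$. *)
have sum_v' : \sum_(j | p j \notin S) `|v j| <= w * (D%:R * B2 / c).
  have H : c ^+ 2 * \sum_(i | p i \notin S) v i ^+ 2 <=
      \sum_(i | p i \notin S) (w * B2 / n) ^+ 2.
    apply: (@coercive_restrict _ _ c M r v (fun i => p i \notin S)) => // i iS.
    rewrite (le_trans (ler_normB _ _)) // /B2 mulrDr mulr1 mulrDl lerD //.
      by rewrite (le_trans (rk' i)) // (negPf iS).
    rewrite (le_trans (ler_norm_sum _ _ _)) //.
    apply: (@le_trans _ _ (\sum_(j | p j \in S) K / n * `|v j|)).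
      rewrite (eq_bigl (fun j => p j \in S)) => [|j]; last by rewrite negbK.
      apply: ler_sum => j jS; rewrite normrM ler_wpM2r // MN //.
      by apply: contraNneq iS => ->.
    rewrite -mulr_sumr [leRHS](_ : _ = K / n * (w * (a * B1))); last by field; rewrite gt_eqF.
    by rewrite ler_wpM2l // divr_ge0 // ltW.
  have J_le : #|J|%:R <= D%:R * n.
    have := sum_fiber_le (F := fun=> 1) pD (fun=> ler01).
    by rewrite !sumr_const card_ord.
  have H2 : \sum_(i | p i \notin S) (w * B2 / n) ^+ 2 <= D%:R * n * (w * B2 / n) ^+ 2.
    rewrite sumr_const -[leLHS]mulr_natl ler_wpM2r ?sqr_ge0 //.
    by rewrite (le_trans _ J_le) // ler_nat max_card.
  have H3 := sqr_sum_norm_le (fun j => p j \notin S) v.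
  have sge0 : 0 <= \sum_(j | p j \notin S) `|v j| by apply: sumr_ge0.
  rewrite -(ger0_norm sge0); apply: norm_le_of_sqr.
    by rewrite mulr_ge0 // divr_ge0 ?mulr_ge0 ?ler0n // ltW.
  apply: (le_trans H3).
  set Q := \sum_(j | _) v j ^+ 2 in H *.
  have Q0 : 0 <= Q by apply: sumr_ge0 => j _; exact: sqr_ge0.
  have {H H2} HQ := le_trans H H2.
  apply: (@le_trans _ _ (D%:R * n * Q)); first by rewrite ler_wpM2r.
  have -> : (w * (D%:R * B2 / c)) ^+ 2 =
     D%:R * n * (D%:R * n * (w * B2 / n) ^+ 2 / c ^+ 2).
    by field; rewrite !gt_eqF.
  rewrite ler_wpM2l ?mulr_ge0 ?ler0n //.
  by rewrite ler_pdivlMr ?exprn_gt0 // mulrC.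
have sum_v : \sum_j `|v j| <= w * (a * B1 + D%:R * B2 / c).
  by rewrite (bigID (fun j => p j \in S)) /= mulrDr lerD.
have [iS|iS] := boolP (p i0 \in S).
  rewrite wt_cons_in // -mulrA -/w mulrC (le_trans (v_le_B1 i0)) //.
  by rewrite ler_wpM2l // lerDl divr_ge0 ?mulr_ge0 ?ler0n // ltW.
have H : c ^+ 2 * \sum_(i | p i == p i0) v i ^+ 2 <=
    \sum_(i | p i == p i0) (w * B3 / n) ^+ 2.
  apply: (@coercive_restrict _ _ c M r v (fun i => p i == p i0)) => // i /eqP pi.
  rewrite (le_trans (ler_normB _ _)) // /B3 mulrDr mulr1 mulrDl lerD //.
    by rewrite (le_trans (rk' i)) // pi (negPf iS).
  rewrite (le_trans (ler_norm_sum _ _ _)) //.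
  apply: (@le_trans _ _ (\sum_j K / n * `|v j|)).
    rewrite [leLHS]big_mkcond; apply: ler_sum => j _; case: ifPn => pj.
      by rewrite normrM ler_wpM2r // MN // pi eq_sym.
    by rewrite mulr_ge0 // divr_ge0 // ltW.
  rewrite -mulr_sumr.
  rewrite [leRHS](_ : _ = K / n * (w * (a * B1 + D%:R * B2 / c))); last first.
    by field; rewrite !gt_eqF.
  by rewrite ler_wpM2l // divr_ge0 // ltW.
have H2 : \sum_(i | p i == p i0) (w * B3 / n) ^+ 2 <= D%:R * (w * B3 / n) ^+ 2.
  rewrite sumr_const -[leLHS]mulr_natl ler_wpM2r ?sqr_ge0 // ler_nat.
  exact: pD.
have H3 : v i0 ^+ 2 <= \sum_(i | p i == p i0) v i ^+ 2.
  by rewrite (bigD1 i0) //= lerDl sumr_ge0 // => j _; exact: sqr_ge0.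
have D1 : D%:R <= D.+1%:R ^+ 2 :> R.
  by rewrite -natrX ler_nat (leq_trans (leqnSn _)) // leq_pmulr.
apply: (@le_trans _ _ (w * (D.+1%:R * B3 / c) / n)); last first.
  rewrite wt_cons_notin // -/n.
  rewrite [leLHS](_ : _ = (D.+1%:R * B3 / c) * k * (n^-1 * wt R S)); last first.
    by rewrite /w; field; rewrite !gt_eqF.
  by rewrite ler_wpM2r ?mulr_ge0 ?wt_ge0 // ler_wpM2r // lerDr.
apply: norm_le_of_sqr.
  by rewrite mulr_ge0 // mulr_ge0 // divr_ge0 ?(mulr_ge0 _ B30) ?ler0n // ltW.
have -> : (w * (D.+1%:R * B3 / c) / n) ^+ 2 =
    D.+1%:R ^+ 2 * (w * B3 / n) ^+ 2 / c ^+ 2.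
  by field; rewrite !gt_eqF.
rewrite ler_pdivlMr ?exprn_gt0 // mulrC.
apply: (@le_trans _ _ (c ^+ 2 * \sum_(i | p i == p i0) v i ^+ 2)).
  by rewrite ler_wpM2l ?sqr_ge0.
by apply: le_trans H (le_trans H2 _); rewrite ler_wpM2r ?sqr_ge0.
Qed.

End WeightedSystems.

Section SystemCalculus.
Variables (R : realType) (J : finType).

Lemma coercive_inj (c : R) (M : J -> J -> R) (u v : J -> R) :
  0 < c -> coercive c M ->
  (forall i, \sum_j M i j * u j = \sum_j M i j * v j) -> u =1 v.
Proof.
move=> c0 cM uv i; apply/eqP; rewrite -subr_eq0 -sqrf_eq0 eq_le sqr_ge0 andbT.
have := cM (fun i => u i - v i); rewrite [leRHS]big1 => [|j _]; last first.
  rewrite (eq_bigr (fun k => M j k * u k - M j k * v k)) => [|k _].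
    by rewrite sumrB uv subrr mulr0.
  by rewrite mulrBr.
rewrite pmulr_rle0 // => H; apply: le_trans H.
by rewrite (bigD1 i) //= lerDl sumr_ge0 // => j _; exact: sqr_ge0.
Qed.

Lemma continuous_system (V : topologicalType) (c : R) (M : J -> J -> V -> R)
    (r v : J -> V -> R) :
  0 < c -> (forall z, coercive c (fun i j => M i j z)) ->
  (forall i j, continuous (M i j)) -> (forall i, continuous (r i)) ->
  (forall z i, \sum_j M i j z * v j z = r i z) ->
  forall i, continuous (v i).
Proof.
move=> c0 cM Mc rc Mv i z.
have [u Mu vu] := @cvg_coercive _ _ V (nbhs z) _ c (fun z i j => M i j z)
  (fun i j => M i j z) (fun z i => r i z) (fun z i => v i z) (fun i => r i z)
  c0 (cM z) (fun i j => Mc i j z) (fun i => rc i z) (nearW _ (fun z => Mv z)).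
have uv : u =1 (fun i => v i z).
  by apply: (coercive_inj c0 (cM z)) => k; rewrite Mu Mv.
by have := vu i; rewrite uv.
Qed.

(** The difference quotient of [v] solves a system with the matrix at the shifted point. The
    increment of the product is split so that [v] appears only at [z]; the right hand side then
    converges without any prior continuity of [v]. *)
Lemma derivable_system (V : normedModType R) (c : R) (M : J -> J -> V -> R)
    (r v : J -> V -> R) (z w : V) :
  0 < c -> coercive c (fun i j => M i j z) ->
  (forall i j, derivable (M i j) z w) -> (forall i, derivable (r i) z w) ->
  (forall z i, \sum_j M i j z * v j z = r i z) ->
  (forall i, derivable (v i) z w) /\
  (forall i, \sum_j M i j z * 'D_w (v j) z =
     'D_w (r i) z - \sum_j 'D_w (M i j) z * v j z).
Proof.
move=> c0 cM Md rd Mv.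
have q h i : \sum_j M i j (h *: w + z) * (h^-1 * (v j (h *: w + z) - v j z)) =
    h^-1 * (r i (h *: w + z) - r i z) -
     \sum_j h^-1 * (M i j (h *: w + z) - M i j z) * v j z.
  by rewrite -!Mv -sumrB mulr_sumr -sumrB; apply: eq_bigr => j _; ring.
have [u Mu vu] := @cvg_coercive _ _ R (0^') _ c
  (fun h i j => M i j (h *: w + z)) (fun i j => M i j z)
  (fun h i => h^-1 * (r i (h *: w + z) - r i z) -
     \sum_j h^-1 * (M i j (h *: w + z) - M i j z) * v j z)
  (fun h i => h^-1 * (v i (h *: w + z) - v i z))
  (fun i => 'D_w (r i) z - \sum_j 'D_w (M i j) z * v j z)
  c0 cM (fun i j => derivable_cvg (Md i j))
  (fun i => cvgB (cvg_derive (rd i)) (cvg_finsum (fun j _ =>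
      cvgM (cvg_derive (Md i j)) (cvg_cst _))))
  (nearW _ q).
have dv i : is_derive z w (v i) (u i) by exact: is_derive_quotient (vu i).
split=> i; first exact: (@ex_derive _ _ _ _ _ _ _ (dv i)).
by rewrite -Mu; apply: eq_bigr => j _; rewrite (@derive_val _ _ _ _ _ _ _ (dv j)).
Qed.

End SystemCalculus.

Section WeightedSolve.
Variables (R : realType) (d : nat).

(* Differentiating [M v = r] gives a system with the same matrix for the derivative
   of [v]. *)
Lemma weighted_solve (c K : R) (D k : nat) : 0 < c -> 0 <= K ->
  forall (s : nat) (K' : R), 0 <= K' -> exists2 C, 0 <= C &
  forall N (J : finType) (p : J -> 'I_N) (S : seq 'I_N)
    (M : J -> J -> config R N d -> R) (r v : J -> config R N d -> R),
  S != [::] -> (size S <= s)%N ->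
  (forall l, (#|[pred j | p j == l]| <= D)%N) ->
  (forall z, coercive c (fun i j => M i j z)) ->
  (forall i j, weighted k [:: p j; p i] K (M i j)) ->
  (forall i, weighted k (p i :: S) K' (r i)) ->
  (forall z i, \sum_j M i j z * v j z = r i z) ->
  forall i, weighted k (p i :: S) C (v i).
Proof.
move=> c0 K0.
(* The order zero estimate, stated for data of any order so that it also serves in the inductive
   step. *)
have bound k' s K' : 0 <= K' ->
  forall N (J : finType) (p : J -> 'I_N) (S : seq 'I_N)
    (M : J -> J -> config R N d -> R) (r v : J -> config R N d -> R),
  S != [::] -> (size S <= s)%N ->
  (forall l, (#|[pred j | p j == l]| <= D)%N) ->
  (forall z, coercive c (fun i j => M i j z)) ->
  (forall i j, weighted k' [:: p j; p i] K (M i j)) ->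
  (forall i, weighted k' (p i :: S) K' (r i)) ->
  (forall z i, \sum_j M i j z * v j z = r i z) ->
  forall i, continuous (v i) /\
    forall z, `|v i z| <= solve_const c K s D * K' * wt R (p i :: S).
  move=> K'0 N J p S M r v S0 Ss pD cM WM Wr Mv i; split.
    apply: (@continuous_system R J _ c M r v) => // [i' j|i'].
      exact: (weighted_continuous (WM i' j)).
    exact: (weighted_continuous (Wr i')).
  move=> z; apply: (@weighted_system_bound R N J p D s S c K K'
      (fun i j => M i j z) (fun i => v i z) (fun i => r i z)) => // [i' j|i'].
    rewrite (wt_eqi R (T := [:: p j; p i'])); first exact: (weighted_bound z (WM i' j)).
    by move=> l; rewrite !inE orbC.
  exact: (weighted_bound z (Wr i')).
have sc0 s : 0 <= solve_const c K s D.
  have a0 (x y : R) : 0 <= x -> 0 <= y -> 0 <= x + y by exact: addr_ge0.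
  have c0' : 0 <= c^-1 by rewrite invr_ge0 ltW.
  by rewrite /solve_const !(a0, mulr_ge0, ler0n, ler01).
elim: k => [|k IH] s K' K'0.
  exists (solve_const c K s D * K'); first by rewrite mulr_ge0.
  move=> N J p S M r v S0 Ss pD cM WM Wr Mv i.
  by have [cv bv] := bound 0%N s K' K'0 N J p S M r v S0 Ss pD cM WM Wr Mv i.
(* The induction hypothesis is used twice: here for [v] itself, which enters the right hand side of
   the differentiated system through a sum of size [P], and then for the derivative of [v], where
   the list is longer by the new particle. *)
have [C1 C10 H1] := IH s K' K'0.
pose P : R := (2 ^ k * (D * (2 + s + k + 1)))%N%:R * (K * C1).
have P0 : 0 <= P by rewrite !mulr_ge0.
have [C2 C20 H2] := IH s.+1 (K' + P) (addr_ge0 K'0 P0).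
exists (solve_const c K s D * K' + C2); first by rewrite addr_ge0 // mulr_ge0.
move=> N J p S M r v S0 Ss pD cM WM Wr Mv.
have Wv := H1 N J p S M r v S0 Ss pD cM (fun i j => weightedW (WM i j))
  (fun i => weightedW (Wr i)) Mv.
have dv z e := derivable_system (z := z) (w := evc R e) c0 (cM z)
  (fun i j => (let: And3 _ _ H := WM i j in (H e).1) z)
  (fun i => (let: And3 _ _ H := Wr i in (H e).1) z) Mv.
move=> i; have [cv bv] := bound k.+1 s K' K'0 N J p S M r v S0 Ss pD cM WM Wr Mv i.
split => // [z|e].
  by rewrite (le_trans (bv z)) // ler_wpM2r ?wt_ge0 // lerDl.
split => [z|]; first exact: (dv z e).1.
apply: (@weighted_le _ _ _ _ _ C2); first by rewrite lerDr mulr_ge0.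
suff : weighted k (p i :: pt e :: S) C2 ('D_(evc R e) (v i)).
  by apply: weighted_eqi => l; rewrite !in_cons orbCA.
apply: (H2 N J p (pt e :: S) M (fun i z => 'D_(evc R e) (r i) z -
   \sum_j 'D_(evc R e) (M i j) z * v j z) (fun i => 'D_(evc R e) (v i))) => //.
- by move=> i' j; exact: weightedW.
- move=> i'; apply: weightedD.
    have [_ _ /(_ e)[_]] := Wr i'; apply: weighted_eqi => l.
    by rewrite !in_cons orbCA.
  apply: weightedN.
  have := @weighted_prodsum R N d k J p D [:: pt e; p i'] S K C1
    (fun j => 'D_(evc R e) (M i' j)) v K0 C10 isT S0 pD.
  move=> Wp; have {Wp} : weighted k ([:: pt e; p i'] ++ S)
    ((2 ^ k * (D * (size [:: pt e; p i'] + size S + k + 1)))%N%:R * (K * C1))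
    (fun z => \sum_j 'D_(evc R e) (M i' j) z * v j z).
    apply: Wp => j; last exact: Wv.
    have [_ _ /(_ e)[_]] := WM i' j; apply: weighted_eqi => l.
    by rewrite !in_cons orbCA.
  move/(@weighted_le _ _ _ _ _ _ P); move=> Wp; apply: weighted_eqi (Wp _).
    by move=> l; rewrite /= !in_cons orbCA.
  rewrite /P ler_wpM2r ?mulr_ge0 // ler_nat leq_mul // leq_mul //=.
  by rewrite !leq_add2r leq_add2l.
- by move=> z i'; exact: (dv z e).2.
Qed.

End WeightedSolve.

(** * Composition with maps having weighted derivatives *)

Section Composition.
Variables (R : realType) (d : nat).

Lemma card_pt_fiber N (l : 'I_N) :
  (#|[pred c : coord N d | pt c == l]| <= 2 * d)%N.
Proof.
pose f (x : bool * 'I_d) : coord N d := (x.1, (l, x.2)).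
have -> : (2 * d)%N = #|{: bool * 'I_d}| by rewrite card_prod card_bool card_ord.
rewrite (leq_trans _ (leq_image_card f _)) //.
apply/subset_leq_card/fintype.subsetP => -[t [i b]]; rewrite inE /pt /= => /eqP ->.
exact: (codom_f f (t, b)).
Qed.

Lemma card_fst_fiber N (l : 'I_N) :
  (#|[pred j : 'I_N * 'I_d | j.1 == l]| <= d)%N.
Proof.
pose f (b : 'I_d) : 'I_N * 'I_d := (l, b).
rewrite -[X in (_ <= X)%N]card_ord (leq_trans _ (leq_image_card f _)) //.
apply/subset_leq_card/fintype.subsetP => -[i b]; rewrite inE /= => /eqP ->.
exact: (codom_f f b).
Qed.

Lemma sum_coord N (G : coord N d -> R) :
  \sum_c G c = \sum_j G (false, j) + \sum_j G (true, j).
Proof.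
rewrite addrC -(big_bool _ (fun t => \sum_j G (t, j))) pair_bigA /=.
by apply: eq_bigr => -[].
Qed.

(** Only the derivatives of the coordinates are bounded, one order below [k]: the maps of interest
    contain the positions and are unbounded. *)
Definition weighted_map N k K (F : config R N d -> config R N d) : Prop :=
  continuous F /\ forall c e, (forall z, derivable (co c \o F) z (evc R e)) /\
    if k is k'.+1 then weighted k' [:: pt e; pt c] K ('D_(evc R e) (co c \o F))
    else True.

Lemma weighted_mapW N k K (F : config R N d -> config R N d) :
  weighted_map k.+1 K F -> weighted_map k K F.
Proof.
move=> [cF dF]; split => // c e; have [dce Wce] := dF c e; split => //.
by case: k Wce dF => // k Wce _; exact: weightedW.
Qed.

(** By the chain rule a derivative of [U \o F] is a sum over coordinates of a composition of lower
    order times a derivative of [F], which is the form handled by [weighted_prodsum]. The outer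
    derivative lengthens [S], hence the induction for all [s]. *)
Lemma weighted_comp k : forall (s : nat) (K K' : R), 0 <= K -> 0 <= K' ->
  exists2 C, 0 <= C & forall N (S : seq 'I_N) (U : config R N d -> R)
    (F : config R N d -> config R N d),
  S != [::] -> (size S <= s)%N -> weighted_map k K' F -> weighted k S K U ->
  weighted k S C (U \o F).
Proof.
elim: k => [|k IH] s K K' K0 K'0.
  exists K => // N S U F S0 Ss [cF _] [cU bU _]; split => // [z|z].
    exact (cvg_comp F U (cF z) (cU (F z))).
  exact: bU.
have [C1 C10 H1] := IH s.+1 K K' K0 K'0.
pose P : R := (2 ^ k * (2 * d * (s + 1 + k + 1)))%N%:R * (C1 * K').
have P0 : 0 <= P by rewrite !mulr_ge0.
exists (K + P); first by rewrite addr_ge0.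
move=> N S U F S0 Ss WF WU.
have [cF dF] := WF; have [cU bU dU] := WU; split => [z|z|e].
- exact (cvg_comp F U (cF z) (cU (F z))).
- by rewrite (le_trans (bU _)) // ler_wpM2r ?wt_ge0 // lerDl.
have dUF z := is_derive_comp (f := F) (x := z) (v := evc R e)
  (fun c => (dU c).1) (fun c => weighted_continuous (dU c).2)
  (fun c => (dF c e).1 z).
split => [z|]; first exact: (@ex_derive _ _ _ _ _ _ _ (dUF z)).
have -> : 'D_(evc R e) (U \o F) = (fun z => \sum_c ('D_(evc R c) U \o F) z *
    'D_(evc R e) (co c \o F) z).
  by apply/funext => z; exact: (@derive_val _ _ _ _ _ _ _ (dUF z)).
apply: (@weighted_le _ _ _ _ _ P); first by rewrite lerDr.
have Wp := @weighted_prodsum R N d k (coord N d) (@pt N d) (2 * d) S [:: pt e] C1 K'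
  (fun c => 'D_(evc R c) U \o F) (fun c => 'D_(evc R e) (co c \o F)) C10 K'0 S0 isT
  (@card_pt_fiber N).
have {Wp} : weighted k (S ++ [:: pt e])
    ((2 ^ k * (2 * d * (size S + size [:: pt e] + k + 1)))%N%:R * (C1 * K'))
    (fun z => \sum_c ('D_(evc R c) U \o F) z * 'D_(evc R e) (co c \o F) z).
  apply: Wp => c; last first.
    by have [_] := dF c e; apply: weighted_eqi => l; rewrite !in_cons orbCA.
  apply: (H1 N (pt c :: S)) => //; first exact: weighted_mapW.
  exact: (dU c).2.
move/(@weighted_le _ _ _ _ _ _ P); move=> Wp; apply: weighted_eqi (Wp _).
  by move=> l; rewrite mem_cat !in_cons in_nil orbF orbC.
by rewrite /P ler_wpM2r ?mulr_ge0 // ler_nat leq_mul // leq_mul //= !leq_add2r.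
Qed.

Lemma is_derive_direction N (g : config R N d -> R) z v :
  (forall c y, derivable g y (evc R c)) ->
  (forall c, continuous ('D_(evc R c) g)) ->
  is_derive z v g (\sum_c 'D_(evc R c) g z * co c v).
Proof.
move=> dg cg.
have dc c := is_derive_co c z v.
have := is_derive_comp (f := id) (x := z) (v := v) dg cg
  (fun c => @ex_derive _ _ _ _ _ _ _ (dc c)).
by under eq_bigr do rewrite (@derive_val _ _ _ _ _ _ _ (dc _)).
Qed.

End Composition.

(** * Derivatives of the implicit function *)

Section ImplicitFunction.
Variables (R : realType) (d : nat).

Definition graph_map N (aN : config R N d -> 'M[R]_(N, d)) (z : config R N d) :
  config R N d := (z.1, aN z).

(** Abstracts what is used of the Lagrangian system. The weighted bounds start at the first
    derivatives, [Phi] itself being allowed to grow; monotonicity is in the actions at frozen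
    positions. *)
Record implicit_system (c0 K : R) N (Phi : 'I_N * 'I_d -> config R N d -> R)
    (aN : config R N d -> 'M[R]_(N, d)) : Prop := ImplicitSystem {
  sys_continuous : forall i, continuous (Phi i) ;
  sys_derivable : forall i c z, derivable (Phi i) z (evc R c) ;
  sys_weighted : forall i c, weighted 3 [:: pt c; i.1] K ('D_(evc R c) (Phi i)) ;
  sys_monotone : forall x (a a' : 'M[R]_(N, d)),
    c0 * \sum_(i : 'I_N * 'I_d) (a i.1 i.2 - a' i.1 i.2) ^+ 2 <=
    \sum_i (Phi i (x, a) - Phi i (x, a')) * (a i.1 i.2 - a' i.1 i.2) ;
  sys_eq : forall z i, Phi i (z.1, aN z) = - z.2 i.1 i.2 }.

Arguments sys_continuous {c0 K N Phi aN} _ i _ _ : rename.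
Arguments sys_derivable {c0 K N Phi aN} _ i c z : rename.
Arguments sys_weighted {c0 K N Phi aN} _ i c : rename.

Section Solution.
Variables (c0 K : R) (N : nat) (Phi : 'I_N * 'I_d -> config R N d -> R).
Variable (aN : config R N d -> 'M[R]_(N, d)).
Hypotheses (c0_gt0 : 0 < c0) (sys : implicit_system c0 K Phi aN).

Let F := graph_map aN.

Let cDPhi i c : continuous ('D_(evc R c) (Phi i)).
Proof. exact: (weighted_continuous (sys_weighted sys i c)). Qed.

Definition action_jacobian z (i j : 'I_N * 'I_d) : R :=
  'D_(evc R (true, j)) (Phi i) z.

(** Monotonicity between [z] and [z] shifted by [h] times a direction [V] that moves the actions
    only, divided by [h ^+ 2], in the limit of small [h]. *)
Lemma action_jacobian_coercive z : coercive c0 (action_jacobian z).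
Proof.
move=> v.
pose V : config R N d := (0, \matrix_(i, b) v (i, b)).
have coV j : co (true, j) V = v j by rewrite /co /= mxE; case: j.
have coV0 j : co (false, j) V = 0 by rewrite /co /= mxE.
have dV i := is_derive_direction z V (sys_derivable sys i) (@cDPhi i).
have eD i : 'D_V (Phi i) z = \sum_j action_jacobian z i j * v j.
  rewrite (@derive_val _ _ _ _ _ _ _ (dV i)) sum_coord big1 ?add0r.
    by apply: eq_bigr => j _; rewrite coV.
  by move=> j _; rewrite coV0 mulr0.
have -> : \sum_i v i * (\sum_j action_jacobian z i j * v j) =
    \sum_i v i * 'D_V (Phi i) z by apply: eq_bigr => i _; rewrite eD.
have H : \sum_i v i * (h^-1 * (Phi i (h *: V + z) - Phi i z)) @[h --> 0^'] -->
     \sum_i v i * 'D_V (Phi i) z.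
  apply: cvg_finsum => i _; apply: cvgM; first exact: cvg_cst.
  exact: (cvg_derive (@ex_derive _ _ _ _ _ _ _ (dV i))).
apply: cvgr_to_ge H _; near=> h.
have h0 : h != 0 by near: h; exact: nbhs_dnbhs_neq.
have := sys_monotone sys z.1 (h *: V.2 + z.2) z.2.
have -> : (z.1, h *: V.2 + z.2) = h *: V + z.
  by rewrite [RHS]surjective_pairing /= scaler0 add0r.
rewrite -surjective_pairing.
have dV2 i : (h *: V.2 + z.2) i.1 i.2 - z.2 i.1 i.2 = h * v i.
  by rewrite !mxE addrK; case: i.
under eq_bigr do rewrite dV2 exprMn.
under [leRHS]eq_bigr do rewrite dV2.
rewrite -mulr_sumr => H.
have h2 : 0 < h ^+ 2 by rewrite exprn_even_gt0.
rewrite -(ler_pM2l h2) mulrCA.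
apply: le_trans H _; rewrite mulr_sumr le_eqVlt; apply/orP; left; apply/eqP.
by apply: eq_bigr => i _; field.
Unshelve. all: by end_near. Qed.

(** Monotonicity at the new positions bounds the change of $a^N$ by the residual [g] of the old
    actions in the new equations; this residual is continuous and vanishes at [z]. *)
Lemma solution_continuous i b : continuous (fun z => aN z i b).
Proof.
move=> z.
pose g j (z' : config R N d) := - z'.2 j.1 j.2 - Phi j (z'.1, aN z).
have gz : \sum_j `|g j z'| / c0 @[z' --> z] --> 0.
  suff : \sum_j `|g j z'| / c0 @[z' --> z] --> \sum_j `|g j z| / c0.
    by rewrite big1 // => j _; rewrite /g (sys_eq sys) subrr normr0 mul0r.
  apply: cvg_finsum => j _; apply: cvgM; last exact: cvg_cst.
  apply: cvg_norm; rewrite /g; apply: cvgB.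
    exact (cvgN (@continuous_co R N d (true, j) z)).
  have cG : (z'.1, aN z) @[z' --> z] --> (z.1, aN z).
    exact (cvg_pair (@cvg_fst _ _ (nbhs z.1) (nbhs z.2) _) (cvg_cst (aN z))).
  exact (cvg_comp (fun z' : config R N d => (z'.1, aN z)) (Phi j) cG
    (sys_continuous sys j (z.1, aN z))).
suff H z' : `|aN z' i b - aN z i b| <= \sum_j `|g j z'| / c0.
  apply/cvgrPdist_le => e e0; move/cvgr0Pnorm_le : gz => /(_ e e0) gz.
  near=> z'; rewrite distrC (le_trans (H z')) //.
  rewrite (le_trans (ler_norm _)) //.
  by near: z'.
rewrite -mulr_suml; apply: norm_le_of_sqr.
  by rewrite divr_ge0 ?sumr_ge0 // ltW.
have := sys_monotone sys z'.1 (aN z') (aN z).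
under [X in _ <= X -> _]eq_bigr do rewrite (sys_eq sys) -/(g _ z').
set Del := fun j : 'I_N * 'I_d => aN z' j.1 j.2 - aN z j.1 j.2.
move=> H.
have H2 : \sum_j g j z' * Del j <= \sum_j (g j z' ^+ 2 / (2 * c0) + c0 / 2 * Del j ^+ 2).
  apply: ler_sum => j _; rewrite -subr_ge0.
  have -> : g j z' ^+ 2 / (2 * c0) + c0 / 2 * Del j ^+ 2 - g j z' * Del j =
     (g j z' - c0 * Del j) ^+ 2 / (2 * c0) by field; rewrite gt_eqF.
  by rewrite divr_ge0 ?sqr_ge0 // mulr_ge0 // ltW.
rewrite big_split /= -mulr_sumr -mulr_suml in H2.
have {H2} H3 := le_trans H H2.
have D1 : Del (i, b) ^+ 2 <= \sum_j Del j ^+ 2.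
  by rewrite (bigD1 (i, b)) //= lerDl sumr_ge0 // => j _; exact: sqr_ge0.
have G1 : \sum_j g j z' ^+ 2 <= (\sum_j `|g j z'|) ^+ 2.
  rewrite expr2 mulr_suml; apply: ler_sum => j _.
  rewrite -(real_normK (num_real (g j z'))) expr2 ler_wpM2l //.
  by rewrite (bigD1 j) //= lerDl sumr_ge0.
rewrite exprMn exprVn ler_pdivlMr ?exprn_gt0 //.
apply: le_trans G1; rewrite -/(Del (i, b)).
move: H3 D1; set A := \sum_j g j z' ^+ 2; set B := \sum_j Del j ^+ 2 => H3 D1.
have H4 : c0 / 2 * B <= A / (2 * c0) by move: H3; rewrite /B; lra.
rewrite ler_pdivlMr ?mulr_gt0 // in H4.
apply: (@le_trans _ _ (c0 / 2 * B * (2 * c0))) => //.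
have -> : c0 / 2 * B * (2 * c0) = B * c0 ^+ 2 by field.
by rewrite ler_wpM2r ?sqr_ge0.
Unshelve. all: by end_near. Qed.

Lemma graph_map_continuous : continuous F.
Proof.
move=> z; apply: cvg_config => -[[] [i b]].
  exact: solution_continuous.
exact: (@continuous_co R N d (false, (i, b)) z).
Qed.

(** What remains on differentiating the equation in [e] apart from the terms through $a^N$: the
    derivative of $-p$ for a momentum coordinate, minus the explicit position derivative of [Phi]
    otherwise. *)
Definition implicit_rhs (e : coord N d) (i : 'I_N * 'I_d) (z : config R N d) : R :=
  - (if e.1 then (e.2 == i)%:R else 'D_(evc R (false, e.2)) (Phi i) (F z)).

Lemma sum_coord_delta (e : coord N d) (D : 'I_N * 'I_d -> R) i :
  - (e == (true, i))%:R - \sum_j ((false, j) == e)%:R * D j =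
  - (if e.1 then (e.2 == i)%:R else D e.2).
Proof.
case: e => [[] e'] /=.
  rewrite big1 ?subr0; last by move=> j _; rewrite mul0r.
  by rewrite xpair_eqE.
rewrite /= oppr0 sub0r (bigD1 e') //= eqxx mul1r big1 ?addr0 // => j.
by move=> je; case: eqP => [[ej]|_]; rewrite ?mul0r //; rewrite ej eqxx in je.
Qed.

(** The mean value expansion of [Phi] between the two solutions is a linear system for the
    difference quotients of $a^N$. Continuity of $a^N$ makes its coefficients converge to the
    coercive Jacobian, and [cvg_coercive] yields the limit of the quotients together with the system
    that it solves. *)
Lemma solution_derivable e z :
  (forall i : 'I_N * 'I_d, derivable (fun z => aN z i.1 i.2) z (evc R e)) /\
  (forall i, \sum_j action_jacobian (F z) i j *
       'D_(evc R e) (fun z => aN z j.1 j.2) z = implicit_rhs e i z).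
Proof.
have lineE c h : co c (h *: evc R e + z) = h * (c == e)%:R + co c z.
  by rewrite co_linear co_evc.
have cline : h *: evc R e + z @[h --> 0^'] --> z.
  apply: cvg_config => c; under eq_cvg do rewrite lineE.
  suff : h * (c == e)%:R + co c z @[h --> 0^'] --> 0 * (c == e)%:R + co c z.
    by rewrite mul0r add0r.
  by apply: cvgD; [apply: cvgM; [exact: cvg_within|exact: cvg_cst]|exact: cvg_cst].
have cFl : F (h *: evc R e + z) @[h --> 0^'] --> F z.
  exact (cvg_comp (fun h => h *: evc R e + z) F cline (@graph_map_continuous z)).
have /choice [xi xiP] : forall i, exists xi : R -> coord N d -> config R N d,
   (forall c, xi t c @[t --> 0^'] --> F z) /\
   forall t, Phi i (F (t *: evc R e + z)) - Phi i (F z) =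
      \sum_c (co c (F (t *: evc R e + z)) - co c (F z)) * 'D_(evc R c) (Phi i) (xi t c).
  by move=> i; have [xi ? ?] := mvt_config (sys_derivable sys i) cFl; exists xi.
pose rho h i := - (e == (true, i))%:R - \sum_j ((false, j) == e)%:R *
    'D_(evc R (false, j)) (Phi i) (xi i h (false, j)).
pose rho0 i := - (e == (true, i))%:R - \sum_j ((false, j) == e)%:R *
    'D_(evc R (false, j)) (Phi i) (F z).
have rho0E i : rho0 i = implicit_rhs e i z.
  by rewrite /rho0 sum_coord_delta.
have cxi i c : 'D_(evc R c) (Phi i) (xi i h c) @[h --> 0^'] -->
    'D_(evc R c) (Phi i) (F z).
  exact (cvg_comp (fun h => xi i h c) _ ((xiP i).1 c) (@cDPhi i c (F z))).
(* Each entry is evaluated at its own intermediate point, so this matrix is not the Jacobian at any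
   single configuration. *)
have near_eq : \forall h \near 0^', forall i,
    \sum_j 'D_(evc R (true, j)) (Phi i) (xi i h (true, j)) *
      (h^-1 * (aN (h *: evc R e + z) j.1 j.2 - aN z j.1 j.2)) = rho h i.
  near=> h => i.
  have h0 : h != 0 by near: h; exact: nbhs_dnbhs_neq.
  have := (xiP i).2 h; rewrite !(sys_eq sys) sum_coord.
  have co0F j : co (false, j) (F (h *: evc R e + z)) - co (false, j) (F z) =
      h * ((false, j) == e)%:R.
    rewrite -[co _ (F z)]/(co (false, j) z).
    by rewrite -[co _ (F _)]/(co (false, j) (h *: evc R e + z)) lineE addrK.
  under eq_bigr do rewrite co0F.
  have -> : - (h *: evc R e + z).2 i.1 i.2 - - z.2 i.1 i.2 = - (h * (e == (true, i))%:R).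
    have -> : (h *: evc R e + z).2 i.1 i.2 = h * ((true, i) == e)%:R + z.2 i.1 i.2.
      exact: (lineE (true, i) h).
    by rewrite opprK eq_sym opprD subrK.
  move=> E.
  apply: (mulfI h0); rewrite /rho mulrBr mulrN.
  rewrite mulr_sumr -(addrK (\sum_j h * ((false, j) == e)%:R *
      'D_(evc R (false, j)) (Phi i) (xi i h (false, j))) (\sum__ _)).
  rewrite mulr_sumr; congr (_ - _); last by apply: eq_bigr => j _; rewrite mulrA.
  rewrite E addrC; congr (_ + _); apply: eq_bigr => j _.
  by rewrite mulrCA mulVKf // mulrC.
have [u Mu vu] := @cvg_coercive _ _ R (0^') _ c0
  (fun h i j => 'D_(evc R (true, j)) (Phi i) (xi i h (true, j)))
  (action_jacobian (F z)) rho
  (fun h i => h^-1 * (aN (h *: evc R e + z) i.1 i.2 - aN z i.1 i.2))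
  rho0 c0_gt0 (@action_jacobian_coercive (F z))
  (fun i j => cxi i (true, j))
  (fun i => cvgB (cvg_cst _) (cvg_finsum (fun j _ =>
     cvgM (cvg_cst _) (cxi i (false, j))))) near_eq.
have da i : is_derive z (evc R e) (fun z => aN z i.1 i.2) (u i).
  exact: is_derive_quotient (vu i).
split=> i; first exact: (@ex_derive _ _ _ _ _ _ _ (da i)).
rewrite -rho0E -Mu; apply: eq_bigr => j _.
by rewrite (@derive_val _ _ _ _ _ _ _ (da j)).
Unshelve. all: by end_near. Qed.

End Solution.

End ImplicitFunction.

Section ImplicitWeighted.
Variables (R : realType) (d : nat).

Lemma weighted_leqW N k k' (S : seq 'I_N) K (g : config R N d -> R) :
  (k <= k')%N -> weighted k' S K g -> weighted k S K g.
Proof.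
move=> /subnK <-; elim: (k' - k)%N => // n IH W; apply: IH.
by move: W; rewrite addSn => /weightedW.
Qed.

Lemma implicit_weighted_map N (k : nat) (c0 K C : R)
    (Phi : 'I_N * 'I_d -> config R N d -> R)
    (aN : config R N d -> 'M[R]_(N, d)) :
  0 < c0 -> implicit_system c0 K Phi aN -> 1 <= C ->
  (if k is k'.+1 then forall e (i : 'I_N * 'I_d), weighted k' [:: pt e; i.1] C
    ('D_(evc R e) (fun z => aN z i.1 i.2)) else True) ->
  weighted_map k C (graph_map aN).
Proof.
move=> c00 sys C1 WaN; split; first exact: graph_map_continuous sys.
move=> [[] j] e; split.
- move=> z; exact: (solution_derivable c00 sys e z).1.
- by case: k WaN => // k WaN; exact: WaN.
- by move=> z; exact: (@ex_derive _ _ _ _ _ _ _ (is_derive_co (false, j) z (evc R e))).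
case: k WaN => // k _.
have -> : 'D_(evc R e) (co (false, j) \o graph_map aN) =
    (fun=> ((false, j) == e)%:R).
  apply/funext => z; rewrite -co_evc.
  exact: (@derive_val _ _ _ _ _ _ _ (is_derive_co (false, j) z (evc R e))).
have C0 : 0 <= C by exact: le_trans C1.
apply: weighted_cst => //; case: eqP => [<-|_]; last by rewrite normr0 mulr_ge0 ?wt_ge0.
by rewrite normr1 wt_cons_in ?inE // wt1 mulr1.
Qed.

(** A bootstrap: bounding the derivative of $a^N$ to order [k] needs the coefficients, composed with
    [graph_map aN], to order [k], and these involve derivatives of $a^N$ one order lower. It stops
    at 3 with the bounds on the first derivatives of [Phi]. *)
Theorem implicit_weighted (c0 K : R) : 0 < c0 -> 0 <= K ->
  forall k, (k <= 3)%N -> exists2 C, 0 <= C & forall N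
    (Phi : 'I_N * 'I_d -> config R N d -> R)
    (aN : config R N d -> 'M[R]_(N, d)),
  implicit_system c0 K Phi aN ->
  forall e (i : 'I_N * 'I_d),
    weighted k [:: pt e; i.1] C ('D_(evc R e) (fun z => aN z i.1 i.2)).
Proof.
move=> c00 K0.
(* One turn of the bootstrap. The 1 in [1 + C'] pays for the position coordinates of [graph_map],
   whose derivatives are 0 or 1. *)
suff H k C' : (k <= 3)%N -> 0 <= C' -> exists2 C, 0 <= C & forall N
    (Phi : 'I_N * 'I_d -> config R N d -> R)
    (aN : config R N d -> 'M[R]_(N, d)),
  implicit_system c0 K Phi aN ->
  weighted_map k (1 + C') (graph_map aN) ->
  forall e (i : 'I_N * 'I_d),
    weighted k [:: pt e; i.1] C ('D_(evc R e) (fun z => aN z i.1 i.2)).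
  elim=> [|k IH] k3.
    have [C C0 HC] := H 0%N 0 k3 (lexx _); exists C => // N Phi aN sys.
    apply: (HC N Phi aN sys); rewrite addr0.
    exact: (implicit_weighted_map c00 sys).
  have [C' C'0 HC'] := IH (ltnW k3).
  have [C C0 HC] := H k.+1 C' k3 C'0; exists C => // N Phi aN sys.
  apply: (HC N Phi aN sys); apply: (implicit_weighted_map c00 sys).
    by rewrite lerDl.
  move=> e i; apply: (@weighted_le _ _ _ _ _ C'); first by rewrite lerDr.
  exact: (HC' N Phi aN sys).
move=> k3 C'0.
have C1 : 0 <= 1 + C' by rewrite addr_ge0.
have [C2 C20 H2] := @weighted_comp R d k 2 K (1 + C') K0 C1.
have [C3 C30 H3] := @weighted_solve R d c0 C2 d k c00 C20 1 (1 + C2) (addr_ge0 ler01 C20).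
exists C3 => // N Phi aN sys WF e i.
have Wc i' c : weighted k [:: pt c; i'.1] C2 ('D_(evc R c) (Phi i') \o graph_map aN).
  apply: H2 => //; apply: (weighted_leqW k3); exact: sys_weighted sys i' c.
apply: (@weighted_eqi _ _ _ _ (i.1 :: [:: pt e])).
  by move=> l; rewrite !inE orbC.
apply: (H3 N _ fst [:: pt e]
  (fun i j z => action_jacobian Phi (graph_map aN z) i j)
  (implicit_rhs Phi aN e)
  (fun i => 'D_(evc R e) (fun z => aN z i.1 i.2))) => //.
- exact: card_fst_fiber.
- by move=> z; exact: action_jacobian_coercive sys _.
- by move=> i' j; exact: (Wc i' (true, j)).
- move=> i'; rewrite /implicit_rhs.
  apply: weightedN; case eE : e.1.
    apply: weighted_cst; first by rewrite addr_ge0.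
    case: eqP => [ei|_]; last by rewrite normr0 mulr_ge0 ?wt_ge0 ?addr_ge0.
    by rewrite normr1 -ei wt_cons_in ?inE // wt1 mulr1 lerDl.
  apply: (@weighted_le _ _ _ _ _ C2); first by rewrite lerDr.
  apply: (@weighted_eqi _ _ _ _ [:: pt (false, e.2); i'.1]).
    by move=> l; rewrite !inE orbC.
  exact: Wc.
- by move=> z i'; exact: (solution_derivable c00 sys e z).2.
Qed.

End ImplicitWeighted.

(** * Discrete measures and Wasserstein distances *)

Section DiscreteMeasures.
Context (disp : measure_display) (T : measurableType disp) (R : realType).
Variables (I : finType) (i0 : I) (w : I -> {nonneg R}) (y : I -> T).

Definition discrete_measure :=
  msum (fun k => mscale (w (nth i0 (enum I) k)) (dirac (y (nth i0 (enum I) k))))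
    #|I|.

HB.instance Definition _ := Measure.on discrete_measure.

Lemma sum_nth_enum (F : I -> \bar R) :
  (\sum_(k < #|I|) F (nth i0 (enum I) k) = \sum_i F i)%E.
Proof.
by rewrite -[RHS]big_enum /= (big_nth i0) big_mkord cardE.
Qed.

Lemma discrete_measureE A :
  discrete_measure A = (\sum_i (w i)%:num * \1_A (y i))%:E.
Proof.
rewrite /discrete_measure /msum /mscale /=.
rewrite (sum_nth_enum (fun i => ((w i)%:num)%:E * dirac (y i) A)%E) -sumEFin.
by apply: eq_bigr => i _; rewrite diracE indicE EFinM.
Qed.

Lemma ge0_integral_discrete (f : T -> R) :
  measurable_fun setT f -> (forall x, 0 <= f x) ->
  (\int[discrete_measure]_x (f x)%:E = (\sum_i (w i)%:num * f (y i))%:E)%E.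
Proof.
move=> mf f0.
have mfE : measurable_fun setT (EFin \o f) by exact/measurable_EFinP.
rewrite ge0_integral_measure_sum //; last by move=> x _; rewrite lee_fin.
rewrite -sumEFin -(sum_nth_enum (fun i => ((w i)%:num * f (y i))%:E)).
apply: eq_bigr => k _; rewrite ge0_integral_mscale //; last first.
  by move=> x _; rewrite lee_fin.
by rewrite integral_dirac // diracT mul1e EFinM.
Qed.

Lemma integral_discrete (f : T -> R) : measurable_fun setT f ->
  (\int[discrete_measure]_x (f x)%:E = (\sum_i (w i)%:num * f (y i))%:E)%E.
Proof.
move=> mf; rewrite integralE.
have -> : ((fun x => (f x)%:E)^\+ = (fun x => (Num.max (f x) 0)%:E))%E.
  by apply/funext => x; rewrite funeposE -EFin_max.
have -> : ((fun x => (f x)%:E)^\- = (fun x => (Num.max (- f x) 0)%:E))%E.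
  by apply/funext => x; rewrite funenegE -EFinN -EFin_max.
have m0 : measurable_fun setT (fun x => Num.max (f x) 0) by exact: measurable_maxr.
have m1 : measurable_fun setT (fun x => Num.max (- f x) 0).
  by apply: measurable_maxr => //; exact: measurableT_comp.
rewrite !ge0_integral_discrete //; try by move=> x; rewrite le_max lexx orbT.
rewrite -EFinB -sumrB; congr (_%:E); apply: eq_bigr => i _.
rewrite -mulrBr; congr (_ * _).
by rewrite !maxEle; case: ifPn; case: ifPn; lra.
Qed.

Definition discrete_prob (w1 : \sum_i (w i)%:num = 1) := discrete_measure.

HB.instance Definition _ w1 := Measure.on (discrete_prob w1).

Lemma discrete_prob_setT w1 : discrete_prob w1 setT = 1%E.
Proof.
rewrite /discrete_prob discrete_measureE -w1; congr (_%:E).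
by apply: eq_bigr => i _; rewrite indicT mulr1.
Qed.

HB.instance Definition _ w1 := Measure_isProbability.Build _ _ _
  (discrete_prob w1) (discrete_prob_setT w1).

End DiscreteMeasures.

Section Represents.
Variables (R : realType) (n : nat).
Implicit Types (m : P2 R n) (I : finType).

(** Zero weights and repeated points are allowed, so a measure has many representations. Two
    measures written with the same weights are coupled index by index, which is how all Wasserstein
    distances are bounded here. *)
Definition represents m I (w : I -> R) (y : I -> 'rV[R]_n) : Prop :=
  (forall i, 0 <= w i) /\
  forall A : set (borelV R n), measurable A ->
    P2_prob m A = (\sum_i w i * \1_A (y i))%:E.

Lemma represents_sum1 m I w y : @represents m I w y -> \sum_i w i = 1.
Proof.
case=> _ /(_ _ measurableT); rewrite probability_setT => -[->].
by apply: eq_bigr => i _; rewrite indicT mulr1.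
Qed.

Lemma represents_inh m I w y : @represents m I w y -> I.
Proof.
move=> /represents_sum1 w1; case: (pickP I) => // I0.
by exfalso; move: w1; rewrite big_pred0 // => /esym/eqP; rewrite oner_eq0.
Qed.

Lemma continuous_measurable_borelV (f : 'rV[R]_n -> R) : continuous f ->
  measurable_fun setT (f : borelV R n -> R).
Proof.
move=> cf; apply: (measurability _ (RGenOpens.measurableE R)) => _ [_ [a [b ->]] <-].
rewrite setTI; apply: sub_sigma_algebra.
by apply: open_comp => [x _|]; [exact: cf|exact: interval_open].
Qed.

Lemma integral_represents m I w y (f : 'rV[R]_n -> R) : @represents m I w y ->
  continuous f -> \int[m]_x f x = \sum_i w i * f (y i).
Proof.
move=> rm cf; have i0 := represents_inh rm; have [w0 mE] := rm.
rewrite /Rintegral.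
rewrite (@eq_measure_integral _ _ _ setT (@discrete_measure _ (borelV R n) R I i0
   (fun i => NngNum (w0 i)) y)); last first.
  move=> A mA _; apply: etrans (mE A mA) _; symmetry.
  exact: discrete_measureE.
by rewrite integral_discrete //; exact: continuous_measurable_borelV.
Qed.

Lemma measurable_distX (q : nat) : measurable_fun setT
  (fun z : (borelV R n * borelV R n)%type => norm2 ((z.1 : 'rV[R]_n) - z.2) ^+ q).
Proof.
apply: measurable_funX.
have -> : (fun z : (borelV R n * borelV R n)%type => norm2 ((z.1 : 'rV[R]_n) - z.2)) =
   (@Num.sqrt R) \o (fun z : (borelV R n * borelV R n)%type =>
     \sum_i (((z.1 : 'rV[R]_n) 0 i - (z.2 : 'rV[R]_n) 0 i) ^+ 2)).
  apply/funext => z /=; rewrite /norm2 /dotp; congr (Num.sqrt _).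
  by apply: eq_bigr => i _; rewrite !mxE expr2.
apply: measurableT_comp.
  by apply: continuous_measurable_fun; exact: sqrt_continuous.
apply: measurable_sum => i; apply: measurable_funX; apply: measurable_funB.
  by apply: (measurableT_comp (f := (fun x : borelV R n => (x : 'rV[R]_n) 0 i)));
    [apply: continuous_measurable_borelV; exact: coord_continuous|exact: measurable_fst].
by apply: (measurableT_comp (f := (fun x : borelV R n => (x : 'rV[R]_n) 0 i)));
  [apply: continuous_measurable_borelV; exact: coord_continuous|exact: measurable_snd].
Qed.

Lemma wasserstein_represents q m m' I w y y' :
  @represents m I w y -> @represents m' I w y' ->
  wasserstein q m m' <= (\sum_i w i * norm2 (y i - y' i) ^+ q) `^ (q%:R^-1).
Proof.
move=> rm rm'; have i0 := represents_inh rm.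
have [w0 mE] := rm; have [_ mE'] := rm'.
have w1 : \sum_i (NngNum (w0 i))%:num = 1 by exact: represents_sum1 rm.
pose pi := @discrete_prob _ (borelV R n * borelV R n)%type R I i0
  (fun i => NngNum (w0 i)) (fun i => (y i, y' i)) w1.
set X := \sum_i _.
have X0 : 0 <= X.
  by apply: sumr_ge0 => i _; rewrite mulr_ge0 // exprn_ge0 // sqrtr_ge0.
rewrite /wasserstein; set S := [set _ | _ in _].
have SX : S X%:E.
  exists (pi : probability _ _).
    move=> A mA; split; rewrite ?mE ?mE' // /pi /= /discrete_prob discrete_measureE;
      congr (_%:E); apply: eq_bigr => i _; rewrite !indicE;
      congr (_ * _%:R); congr (nat_of_bool _); apply/idP/idP; rewrite !inE //=.
      by case.
    by case.
  rewrite /pi /= /discrete_prob ge0_integral_discrete //; first exact: measurable_distX.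
  by move=> z; rewrite exprn_ge0 // sqrtr_ge0.
(* The infimum is an extended real; it is caught between 0 and [X] so that [fine] returns its true
   value. *)
have inf_le : (ereal_inf S <= X%:E)%E by exact: ereal_inf_lbound.
have inf_ge : (0 <= ereal_inf S)%E.
  apply: le_ereal_inf_tmp => _ [p _ <-]; apply: integral_ge0 => z _.
  by rewrite lee_fin exprn_ge0 // sqrtr_ge0.
apply: ge0_ler_powR; rewrite ?nnegrE ?invr_ge0 ?fine_ge0 //.
by rewrite -lee_fin fineK // ge0_fin_numE // (le_lt_trans inf_le) ?ltry.
Qed.

Lemma wasserstein1_represents m m' I w y y' :
  @represents m I w y -> @represents m' I w y' ->
  wasserstein 1 m m' <= \sum_i w i * norm2 (y i - y' i).
Proof.
move=> rm rm'; rewrite (le_trans (wasserstein_represents 1 rm rm')) //.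
by rewrite invr1 powRr1 // sumr_ge0 // => i _; rewrite mulr_ge0 ?rm.1 ?sqrtr_ge0.
Qed.

Lemma wasserstein2_represents_lt m m' I w y y' (r : R) : 0 < r ->
  @represents m I w y -> @represents m' I w y' ->
  \sum_i w i * norm2 (y i - y' i) ^+ 2 < r ^+ 2 -> wasserstein 2 m m' < r.
Proof.
move=> r0 rm rm' lt; rewrite (le_lt_trans (wasserstein_represents 2 rm rm')) //.
have X0 : 0 <= \sum_i w i * norm2 (y i - y' i) ^+ 2.
  by apply: sumr_ge0 => i _; rewrite mulr_ge0 ?rm.1 // exprn_ge0 // sqrtr_ge0.
rewrite powR12_sqrt // -[ltRHS](ger0_norm (ltW r0)) -sqrtr_sqr.
by rewrite ltr_sqrt // exprn_gt0.
Qed.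

Lemma represents_mix t m m' I J w y w' y' :
  @represents m I w y -> @represents m' J w' y' ->
  represents (mix t m m')
    (fun k : I + J => match k with inl i => (1 - clamp01 t) * w i
                                 | inr j => clamp01 t * w' j end)
    (fun k => match k with inl i => y i | inr j => y' j end).
Proof.
move=> [w0 mE] [w0' mE']; split.
  by case=> i; rewrite mulr_ge0 ?onem_clamp01_ge0 ?clamp01_ge0.
move=> A mA; rewrite /mix /= /mix_measure measure_addE /= /mscale /=.
rewrite mE // mE' // -!EFinM -EFinD; congr (_%:E).
by rewrite big_sumType /= !mulr_sumr; congr (_ + _); apply: eq_bigr => i _; rewrite mulrA.
Qed.

(** Omitted points stay in the index set with weight zero, so that empirical measures of different
    subfamilies share one index set. *)
Lemma represents_empirical (I : finType) (p : pred I) (y : I -> 'rV[R]_n) :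
  (0 < #|p|)%N ->
  represents (empirical [seq y j | j <- enum I & p j])
    (fun j => if p j then #|p|%:R^-1 else 0) y.
Proof.
move=> p0; split.
  by move=> i; case: ifP => // _; rewrite invr_ge0 ler0n.
move=> A mA.
have -> : \sum_i (if p i then #|p|%:R^-1 else 0) * \1_A (y i) =
   #|p|%:R^-1 * \sum_(z <- [seq y j | j <- enum I & p j]) \1_A z :> R.
  rewrite big_map big_filter big_enum_cond /= mulr_sumr [RHS]big_mkcond /=.
  by apply: eq_bigr => i _; case: ifP => _; rewrite ?mul0r.
have sz : size [seq y j | j <- enum I & p j] = #|p|.
  by rewrite size_map -sum1_size big_filter big_enum_cond /= sum1_card.
case E : [seq y j | j <- enum I & p j] sz => [|z s] sz.
  by move: p0; rewrite -sz.
rewrite -sz /= /empirical_measure /mscale /= /msum /=.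
rewrite (eq_bigr (fun k : 'I_(size s).+1 => (\1_A (nth z (z :: s) k) : R)%:E)).
  by rewrite sumEFin -EFinM [in RHS](big_nth z) big_mkord.
by move=> k _; rewrite diracE indicE.
Qed.

(** Splits each atom in two, to match the weights of a mixture with [m]. *)
Lemma represents_double m I w y (c : R) : 0 <= c <= 1 -> @represents m I w y ->
  represents m (fun k : I + I => match k with inl i => (1 - c) * w i
                                            | inr i => c * w i end)
   (fun k => match k with inl i => y i | inr i => y i end).
Proof.
move=> /andP[c0 c1] [w0 mE]; split.
  by case=> i; rewrite mulr_ge0 // subr_ge0.
move=> A mA; rewrite mE // big_sumType /= -big_split; congr (_%:E).
by apply: eq_bigr => i _ /=; ring.
Qed.

End Represents.

(** * Continuity in the measure along mixtures *)

Section Continuity.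
Variable R : realType.

Lemma norm2_sqr n (x : 'rV[R]_n) : norm2 x ^+ 2 = dotp x x.
Proof. by rewrite /norm2 sqr_sqrtr // dotp_ge0. Qed.

Lemma norm2_0 n : norm2 (0 : 'rV[R]_n) = 0.
Proof.
by rewrite /norm2 /dotp big1 ?sqrtr0 // => i _; rewrite mxE mul0r.
Qed.

Lemma norm2_lt n (x : 'rV[R]_n) r : 0 < r -> dotp x x < r ^+ 2 -> norm2 x < r.
Proof.
move=> r0 xr; rewrite /norm2 -[ltRHS](ger0_norm (ltW r0)) -sqrtr_sqr.
by rewrite ltr_sqrt // exprn_gt0.
Qed.

Lemma norm2_near (T : Type) (F : set_system T) {FF : Filter F} n
    (x : T -> 'rV[R]_n) (x0 : 'rV[R]_n) :
  (forall q, x t 0 q @[t --> F] --> x0 0 q) ->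
  forall r, 0 < r -> \forall t \near F, norm2 (x t - x0) < r.
Proof.
move=> xx r r0.
have : dotp (x t - x0) (x t - x0) @[t --> F] -->
    \sum_(q < n) (x0 0 q - x0 0 q) * (x0 0 q - x0 0 q).
  rewrite /dotp; apply: cvg_finsum => q _; under eq_cvg do rewrite !mxE.
  by apply: cvgM; apply: cvgB => //; exact: cvg_cst.
rewrite big1 => [/cvgr0_norm_lt H|q _]; last by rewrite subrr mul0r.
have r2 : 0 < r ^+ 2 by rewrite exprn_gt0.
near=> t; apply: norm2_lt => //; rewrite (le_lt_trans (ler_norm _)) //.
by near: t; exact: H.
Unshelve. all: by end_near. Qed.

Lemma jcontinuous_cvg (T : Type) (F : set_system T) {FF : Filter F} n m
    (U : 'rV[R]_n -> P2 R m -> R) (x : T -> 'rV[R]_n) (x0 : 'rV[R]_n)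
    (mu : T -> P2 R m) (mu0 : P2 R m) :
  jcontinuous U -> (forall q, x t 0 q @[t --> F] --> x0 0 q) ->
  (forall r, 0 < r -> \forall t \near F, wasserstein 2 (mu t) mu0 < r) ->
  U (x t) (mu t) @[t --> F] --> U x0 mu0.
Proof.
move=> cU xx mm; apply/cvgrPdist_lt => e e0.
have [r r0 H] := cU x0 mu0 e e0; near=> t; rewrite distrC.
by apply: H; near: t; [exact: norm2_near|exact: mm].
Unshelve. all: by end_near. Qed.

(** Joint continuity is phrased through the distance, so even at a fixed measure one has to show
    that its distance to itself is small; the diagonal coupling of a representation does it. *)
Lemma continuous_jcontinuous n m (U : 'rV[R]_n -> P2 R m -> R) mu
    (I : finType) (w : I -> R) y :
  represents mu w y -> jcontinuous U -> continuous (fun x => U x mu).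
Proof.
move=> rmu cU x; apply: (@jcontinuous_cvg _ (nbhs x) _ _ _ U id x (fun=> mu) mu cU).
  by move=> q; exact: coord_continuous.
move=> r r0; near=> z; apply: (wasserstein2_represents_lt r0 rmu rmu).
by rewrite big1 ?exprn_gt0 // => i _; rewrite subrr norm2_0 expr0n mulr0.
Unshelve. all: by end_near. Qed.

Lemma clamp01_continuous : continuous (@clamp01 R).
Proof.
move=> t; apply: (@continuous_min _ R (cst 1) (cst 0 \max id)).
  exact: cvg_cst.
by apply: continuous_max; [exact: cvg_cst|exact: cvg_id].
Qed.

Lemma clamp01_le1 (t : R) : clamp01 t <= 1.
Proof. by rewrite /clamp01 ge_min lexx. Qed.

Section MixContinuity.
Variables (n : nat) (I : finType) (w : I -> R) (y y' : I -> 'rV[R]_n).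
Variables (mu nu : P2 R n).
Hypotheses (rmu : represents mu w y) (rnu : represents nu w y').

Let S := \sum_i w i * norm2 (y' i - y i) ^+ 2.

Lemma wasserstein2_mix_left (t r : R) : 0 < r -> S < r ^+ 2 ->
  wasserstein 2 (mix t mu nu) mu < r.
Proof.
move=> r0 Sr.
have c01 : 0 <= clamp01 t <= 1 by rewrite clamp01_ge0 clamp01_le1.
apply: (wasserstein2_represents_lt r0 (represents_mix t rmu rnu)
  (represents_double c01 rmu)).
rewrite big_sumType /= big1 ?add0r => [|i _].
  apply: le_lt_trans Sr; apply: ler_sum => i _.
  have w0 := rmu.1 i; rewrite -mulrA ler_piMl ?clamp01_le1 //.
  by rewrite mulr_ge0 // exprn_ge0 // sqrtr_ge0.
by rewrite subrr norm2_0 expr0n mulr0.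
Qed.

(* Common refinement of the mixtures at times [s <= t]. *)
Let w3 s t (k : I + I + I) := match k with
  | inl (inl i) => (1 - clamp01 t) * w i
  | inl (inr i) => (clamp01 t - clamp01 s) * w i
  | inr i => clamp01 s * w i end.

(** Between the two times only the mass gained by the second measure has to move, from [y] to [y'];
    the rest of the refinement stays in place. *)
Lemma wasserstein2_mix_lt (s t r : R) : 0 < r ->
  `|clamp01 t - clamp01 s| * S < r ^+ 2 ->
  wasserstein 2 (mix t mu nu) (mix s mu nu) < r.
Proof.
move=> r0.
have w0 := rmu.1.
have rep s' t' : clamp01 s' <= clamp01 t' ->
    represents (mix t' mu nu) (w3 s' t') (fun k => match k with
      | inl (inl i) => y i | inl (inr i) => y' i | inr i => y' i end) /\
    represents (mix s' mu nu) (w3 s' t') (fun k => match k with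
      | inl (inl i) => y i | inl (inr i) => y i | inr i => y' i end).
  move=> st; have [Hw Ht] := represents_mix t' rmu rnu.
  have [_ Hs] := represents_mix s' rmu rnu.
  have w3ge0 k : 0 <= w3 s' t' k.
    by case: k => [[]|] i /=; rewrite mulr_ge0 ?onem_clamp01_ge0 ?clamp01_ge0 ?subr_ge0.
  split; split => // A mA; rewrite ?Ht ?Hs // !big_sumType /= -!big_split /=;
    congr (_%:E); apply: eq_bigr => i _; ring.
have bound s' t' : clamp01 s' <= clamp01 t' ->
   \sum_k w3 s' t' k * norm2 (match k with
      | inl (inl i) => y i | inl (inr i) => y' i | inr i => y' i end -
      match k with
      | inl (inl i) => y i | inl (inr i) => y i | inr i => y' i end) ^+ 2 =
   `|clamp01 t' - clamp01 s'| * S.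
  move=> st; rewrite !big_sumType /= [X in X + _ + _]big1 => [|i _]; last first.
    by rewrite subrr norm2_0 expr0n mulr0.
  rewrite [X in _ + X]big1 => [|i _]; last by rewrite subrr norm2_0 expr0n mulr0.
  rewrite add0r addr0 ger0_norm ?subr_ge0 // /S mulr_sumr.
  by apply: eq_bigr => i _; rewrite -mulrA.
have norm2N (x : 'rV[R]_n) : norm2 (- x) = norm2 x.
  rewrite /norm2 /dotp; congr (Num.sqrt _); apply: eq_bigr => q _.
  by rewrite !mxE mulrNN.
case: (leP (clamp01 s) (clamp01 t)) => st lt.
  have [rt rs] := rep _ _ st; apply: (wasserstein2_represents_lt r0 rt rs).
  by rewrite bound.
have [rs rt] := rep _ _ (ltW st); apply: (wasserstein2_represents_lt r0 rt rs).
move: lt; rewrite distrC -(bound _ _ (ltW st)); congr (_ < _).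
by apply: eq_bigr => k _; rewrite -norm2N opprB.
Qed.

Lemma mix_continuous (U : 'rV[R]_n -> P2 R n -> R) x :
  jcontinuous U -> continuous (fun t => U x (mix t mu nu)).
Proof.
move=> cU t; apply: (@jcontinuous_cvg _ (nbhs t) _ _ _ U (fun=> x) x _ _ cU).
  by move=> q; exact: cvg_cst.
move=> r r0.
have H : `|clamp01 s - clamp01 t| * S @[s --> t] --> 0.
  suff : `|clamp01 s - clamp01 t| * S @[s --> t] --> `|clamp01 t - clamp01 t| * S.
    by rewrite subrr normr0 mul0r.
  apply: cvgM; last exact: cvg_cst.
  by apply: cvg_norm; apply: cvgB; [exact: clamp01_continuous|exact: cvg_cst].
have r2 : 0 < r ^+ 2 by rewrite exprn_gt0.
near=> s; apply: wasserstein2_mix_lt => //; rewrite (le_lt_trans (ler_norm _)) //.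
by near: s; move/cvgr0_norm_lt : H; exact.
Unshelve. all: by end_near. Qed.

End MixContinuity.

Lemma Rintegral01_dist (g : R -> R) (A e : R) : continuous g ->
  (forall t, 0 <= t <= 1 -> `|g t - A| <= e) ->
  `|\int[@lebesgue_measure R]_(t in `[0, 1]) g t - A| <= e.
Proof.
move=> cg gA.
have ig : (@lebesgue_measure R).-integrable `[0, 1] (EFin \o g).
  apply: continuous_compact_integrable; first exact: segment_compact.
  exact: continuous_subspaceT.
have mu01 : (@lebesgue_measure R) `[0%R, 1%R] = 1%E.
  by rewrite lebesgue_measure_itv /= lte_fin ltr01 -EFinD subr0.
have icst (a : R) : (@lebesgue_measure R).-integrable `[0, 1] (EFin \o (fun=> a)).
  apply: continuous_compact_integrable; first exact: segment_compact.
  by apply: continuous_subspaceT; exact: cst_continuous.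
have int_cst (a : R) : \int[@lebesgue_measure R]_(t in `[0, 1]) a = a.
  rewrite Rintegral_cst // -[RHS]mulr1; congr (_ * _); exact: (congr1 fine mu01).
rewrite ler_norml; apply/andP; split.
  rewrite lerBrDr -(int_cst (- e + A)); apply: le_Rintegral => // t.
  rewrite /= in_itv /= => /gA; rewrite ler_norml => /andP[]; lra.
rewrite lerBlDr -(int_cst (e + A)); apply: le_Rintegral => // t.
rewrite /= in_itv /= => /gA; rewrite ler_norml => /andP[]; lra.
Qed.

End Continuity.

Lemma is_lfd_lfd (R : realType) m (U : P2 R m -> R) :
  (exists f, is_lfd U f) -> is_lfd U (lfd U).
Proof. by move=> [f fU]; exact: (xgetPex (fun _ _ => 0) (ex_intro _ f fU)). Qed.

Lemma class_CP2_jcontinuous (R : realType) k n m (U : 'rV[R]_n -> P2 R m -> R) :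
  class_CP2 k U -> jcontinuous U.
Proof. by case: k => [|k] []. Qed.

Lemma cvg_line (R : realType) (V : normedModType R) (v z : V) :
  h *: v + z @[h --> (0 : R)^'] --> z.
Proof.
suff : h *: v + z @[h --> (0 : R)^'] --> 0 *: v + z by rewrite scale0r add0r.
apply: cvgD; last exact: cvg_cst.
by apply: cvgZr_tmp; exact: cvg_within.
Qed.

(** * Functions of the empirical measure *)

Section Particles.
Variables (R : realType) (N d : nat).
Implicit Types (z : config R N d) (i j l : 'I_N) (e : coord N d).

Definition particle j z : 'rV[R]_(d + d) := row_mx (row j z.1) (row j z.2).

Definition loo i z : P2 R (d + d) := loo_measure z.1 z.2 i.

Definition loo_weight i j : R := if j != i then N.-1%:R^-1 else 0.

Definition particle_coord l (c : 'I_(d + d)) : coord N d :=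
  match fintype.split c with
  | inl b => (false, (l, b)) | inr b => (true, (l, b)) end.

Definition coord_index e : 'I_(d + d) :=
  if e.1 then rshift d e.2.2 else lshift d e.2.2.

Lemma particleE j z c : particle j z 0 c = co (particle_coord j c) z.
Proof.
by rewrite /particle /particle_coord mxE; case: (fintype.split c) => b; rewrite mxE.
Qed.

Lemma particle_coord_eq l c e :
  (particle_coord l c == e) = (l == pt e) && (c == coord_index e).
Proof.
case: e => [t [j b]]; rewrite /coord_index /pt /=; rewrite /particle_coord.
case: (fintype.splitP c) => b' cb; case: t => //=.
- rewrite [LHS]/(_ == _) /=; symmetry; apply/negP => /andP[_ /eqP cE].
  by move: cb; rewrite cE /=; have := ltn_ord b'; lia.
- rewrite xpair_eqE /= xpair_eqE; congr (_ && _).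
  by rewrite -!val_eqE /= cb.
- rewrite xpair_eqE /= xpair_eqE; congr (_ && _).
  by rewrite -!val_eqE /= cb eqn_add2l.
- rewrite [LHS]/(_ == _) /=; symmetry; apply/negP => /andP[_ /eqP cE].
  by move: cb; rewrite cE /=; have := ltn_ord b; lia.
Qed.

Lemma particle_line l e (h : R) z : particle l (h *: evc R e + z) =
  (if l == pt e then h else 0) *: evec (coord_index e) + particle l z.
Proof.
apply/rowP => c; rewrite particleE co_linear co_evc particle_coord_eq.
rewrite [RHS]mxE particleE; congr (_ + _); rewrite !mxE /=.
by case: (l == pt e) => //=; rewrite ?mul0r ?mulr0.
Qed.

Lemma card_loo i : (0 < N)%N -> #|[pred j : 'I_N | j != i]| = N.-1.
Proof. by move=> N0; rewrite (cardC1 i) card_ord. Qed.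

Lemma represents_loo i z : (1 < N)%N ->
  represents (loo i z) (loo_weight i) (fun j => particle j z).
Proof.
move=> N1; have := @represents_empirical R (d + d) 'I_N (fun j => j != i)
  (fun j => particle j z).
rewrite (card_loo i (ltnW N1)); apply; lia.
Qed.

Lemma loo_weight_ge0 i j : 0 <= loo_weight i j.
Proof. by rewrite /loo_weight; case: ifP => // _; rewrite invr_ge0 ler0n. Qed.

(** Squared transport cost of pairing every particle with itself. *)
Definition loo_dist i z z' : R :=
  \sum_j loo_weight i j * norm2 (particle j z' - particle j z) ^+ 2.

Lemma loo_dist_near i z r : 0 < r -> \forall z' \near z, loo_dist i z z' < r.
Proof.
move=> r0; rewrite /loo_dist.
have : (\sum_j loo_weight i j * \sum_c (co (particle_coord j c) z' -
    co (particle_coord j c) z) * (co (particle_coord j c) z' -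
    co (particle_coord j c) z)) @[z' --> z] -->
  (\sum_j loo_weight i j * \sum_c (co (particle_coord j c) z -
    co (particle_coord j c) z) * (co (particle_coord j c) z -
    co (particle_coord j c) z)).
  apply: cvg_finsum => j _; apply: cvgM; first exact: cvg_cst.
  apply: cvg_finsum => c _.
  by apply: cvgM; apply: cvgB; do ?[exact: cvg_cst|exact: continuous_co].
rewrite [X in _ --> X]big1 => [|j _]; last first.
  by rewrite big1 ?mulr0 // => c _; rewrite subrr mul0r.
move/cvgr0_norm_lt => /(_ r r0) H; near=> z'.
have : `|\sum_j loo_weight i j * \sum_c (co (particle_coord j c) z' -
    co (particle_coord j c) z) * (co (particle_coord j c) z' -
    co (particle_coord j c) z)| < r by near: z'; exact: H.
apply: le_lt_trans; rewrite (le_trans _ (ler_norm _)) // le_eqVlt; apply/orP; left.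
apply/eqP; apply: eq_bigr => j _; rewrite norm2_sqr /dotp; congr (_ * _).
apply: eq_bigr => c _.
suff -> : (particle j z' - particle j z) 0 c = particle j z' 0 c - particle j z 0 c.
  by rewrite !particleE.
by rewrite !mxE.
Unshelve. all: by end_near. Qed.

Lemma loo_near i z r : (1 < N)%N -> 0 < r ->
  \forall z' \near z, wasserstein 2 (loo i z') (loo i z) < r.
Proof.
move=> N1 r0; have r2 : 0 < r ^+ 2 by rewrite exprn_gt0.
near=> z'; apply: (wasserstein2_represents_lt r0 (represents_loo i z' N1)
  (represents_loo i z N1)).
by near: z'; exact: loo_dist_near.
Unshelve. all: by end_near. Qed.

End Particles.

Section LiftDerivative.
Variables (R : realType) (N d n : nat).
Implicit Types (z : config R N d) (i j l : 'I_N) (e : coord N d).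
Implicit Types (U : 'rV[R]_n -> P2 R (d + d) -> R).

Definition select k (s : 'I_k -> coord N d) z : 'rV[R]_k := \row_q co (s q) z.

(* Mirrors [partial_m], which appends the variables of the particle [l] carrying
   the derivative. *)
Definition extend k (s : 'I_k -> coord N d) l (q : 'I_(k + (d + d))) : coord N d :=
  match fintype.split q with inl q => s q | inr c => particle_coord l c end.

Lemma select_extend k (s : 'I_k -> coord N d) l z :
  select (extend s l) z = row_mx (select s z) (particle l z).
Proof.
apply/rowP => q; rewrite [LHS]mxE [RHS]mxE /extend.
by case: (fintype.split q) => q'; [rewrite mxE|rewrite particleE].
Qed.

Lemma sum_evec k (t : 'I_k -> R) (q : 'I_k) :
  (\sum_p t p *: evec p : 'rV[R]_k) 0 q = t q.
Proof.
rewrite summxE (bigD1 q) //= big1 ?addr0 => [|p pq].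
  by rewrite !mxE !eqxx mulr1.
by rewrite !mxE /= eq_sym (negPf pq) mulr0.
Qed.

Lemma select_line k (s : 'I_k -> coord N d) e (h : R) z :
  select s (h *: evc R e + z) =
  \sum_q (h * (s q == e)%:R) *: evec q + select s z.
Proof.
apply/rowP => q; rewrite [LHS]mxE [RHS]mxE sum_evec co_linear co_evc.
by congr (_ + _); rewrite mxE.
Qed.

Variables (U : 'rV[R]_n -> P2 R (d + d) -> R) (s : 'I_n -> coord N d) (i : 'I_N).
Hypotheses (N1 : (1 < N)%N) (U1 : class_CP2 1 U).

(** First half of the increment: the Euclidean variables move while the measure is already at its
    new position. Joint continuity of [partial] absorbs that displacement in the limit. *)
Lemma lift_line_euclidean e z :
  h^-1 * (U (select s (h *: evc R e + z)) (loo i (h *: evc R e + z)) -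
          U (select s z) (loo i (h *: evc R e + z))) @[h --> 0^'] -->
  \sum_q (s q == e)%:R * partial q U (select s z) (loo i z).
Proof.
have [_ [dU cU _ _ _]] := U1.
have /choice [T TP] : forall h, exists T : 'I_n -> 'I_n -> R,
    (forall p q, `|T p q| <= `|h|) /\
    U (select s (h *: evc R e + z)) (loo i (h *: evc R e + z)) -
      U (select s z) (loo i (h *: evc R e + z)) =
    \sum_q (h * (s q == e)%:R) *
      partial q U (\sum_p T q p *: evec p + select s z) (loo i (h *: evc R e + z)).
  move=> h; have [T Th eT] := mvt_telescope (f := fun x => U x (loo i (h *: evc R e + z)))
    (select s z) (fun q => h * (s q == e)%:R)
    (fun q x => dU q x (loo i (h *: evc R e + z))).
  exists T; split => [p q|]; last by rewrite select_line eT.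
  apply: le_trans (Th p q) _; rewrite normrM ler_piMr //.
  by case: (s q == e); rewrite ?normr1 ?normr0.
have lim : \sum_q (s q == e)%:R * partial q U (\sum_p T h q p *: evec p + select s z)
      (loo i (h *: evc R e + z)) @[h --> 0^'] -->
    \sum_q (s q == e)%:R * partial q U (select s z) (loo i z).
  apply: cvg_finsum => q _; apply: cvgM; first exact: cvg_cst.
  apply: (@jcontinuous_cvg _ _ (0^') _ _ _ (partial q U)
    (fun h => \sum_p T h q p *: evec p + select s z) (select s z)
    (fun h => loo i (h *: evc R e + z)) (loo i z)).
  - by have [] := cU q.
  - move=> p.
    suff : T h q p + select s z 0 p @[h --> 0^'] --> 0 + select s z 0 p.
      rewrite add0r; apply: cvg_trans; apply: near_eq_cvg; near=> h.
      by rewrite -[in LHS](sum_evec (T h q)) [RHS]mxE.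
    apply: cvgD; last exact: cvg_cst.
    have id0 : h @[h --> (0 : R)^'] --> (0 : R) by exact: cvg_within.
    exact: (cvg_small (fun h => (TP h).1 q p) id0).
  - move=> r r0.
    exact: (@cvg_line R _ (evc R e) z _ (@loo_near _ _ _ i z r N1 r0)).
apply: cvg_trans lim; apply: near_eq_cvg; near=> h.
have h0 : h != 0 by near: h; exact: nbhs_dnbhs_neq.
rewrite (TP h).2 mulr_sumr; apply: eq_bigr => q _.
by rewrite -!mulrA mulKf.
Unshelve. all: by end_near. Qed.

(** Second half: in the integral formula for the linear derivative only the particle [pt e] changes,
    so the inner difference is its weight times an increment of [lfd] in space. The mean value
    theorem turns this into an intrinsic derivative, close to its value at [h = 0] uniformly along
    the mixture. *)
Lemma lift_line_measure e z :
  h^-1 * (U (select s z) (loo i (h *: evc R e + z)) -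
          U (select s z) (loo i z)) @[h --> 0^'] -->
  loo_weight R i (pt e) *
    partial_m (coord_index e) U (select (extend s (pt e)) z) (loo i z).
Proof.
have [_ [_ _ exU dlU cmU]] := U1.
set x := select s z; set l := pt e; set c := coord_index e.
set y := particle l z; set m0 := loo i z.
have [cf _ fE _] := is_lfd_lfd (exU x); set f := lfd (U x) in cf fE.
have DE mu v : partial_m c U (row_mx x v) mu = 'D_(evec c) (f mu) v.
  by rewrite /partial_m /intrinsicD row_mxKl row_mxKr mxE.
rewrite select_extend -/x -/y DE.
set D := 'D_(evec c) (f m0) y; set wl := loo_weight R i l.
have wl0 : 0 <= wl by exact: loo_weight_ge0.
have wl1 : wl <= 1.
  rewrite /wl /loo_weight; case: ifP => // _.
  by rewrite invf_le1 ?ltr0n ?ler1n; lia.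
apply/cvgrPdist_le => eps eps0.
have [cm _] := cmU c; have [r r0 near_D] := cm (row_mx x y) m0 eps eps0.
have r2 : 0 < r ^+ 2 by rewrite exprn_gt0.
near=> h.
have h0 : h != 0 by near: h; exact: nbhs_dnbhs_neq.
have hr : `|h| < r by near: h; exact: dnbhs0_lt.
have hS : loo_dist i z (h *: evc R e + z) < r ^+ 2.
  by near: h; exact: (@cvg_line R _ (evc R e) z _ (@loo_dist_near _ _ _ i z _ r2)).
set mh := loo i (h *: evc R e + z).
have rep0 := represents_loo i z N1; have reph := represents_loo i (h *: evc R e + z) N1.
pose g t := wl * (f (mix t m0 mh) (h *: evec c + y) - f (mix t m0 mh) y).
have -> : U x mh - U x m0 = \int[@lebesgue_measure R]_(t in `[0, 1]) g t.
  rewrite fE; congr Rintegral; apply/funext => t.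
  have cft : continuous (f (mix t m0 mh)).
    exact: (continuous_jcontinuous (represents_mix t rep0 reph) cf).
  rewrite (integral_represents rep0 cft) (integral_represents reph cft) -sumrB.
  rewrite (bigD1 l) //= big1 ?addr0 => [|j jl].
    by rewrite particle_line eqxx -mulrBr.
  by rewrite particle_line (negPf jl) scale0r add0r subrr.
have cg : continuous g.
  move=> t; apply: cvgM; first exact: cvg_cst.
  by apply: cvgB; apply: (mix_continuous rep0 reph cf).
have gD t : `|g t - h * (wl * D)| <= `|h| * eps.
  have dlf v : derivable (f (mix t m0 mh)) v (evec c) by exact: dlU.
  rewrite /g; have [t' t'h ->] := mvt_line y h dlf.
  have -> : wl * (h * 'D_(evec c) (f (mix t m0 mh)) (t' *: evec c + y)) - h * (wl * D)
      = h * (wl * ('D_(evec c) (f (mix t m0 mh)) (t' *: evec c + y) - D)) by ring.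
  rewrite normrM ler_wpM2l // normrM (ger0_norm wl0).
  have t'r : norm2 (row_mx x (t' *: evec c + y) - row_mx x y) < r.
    rewrite opp_row_mx add_row_mx subrr addrK; apply: norm2_lt => //.
    rewrite /dotp big_split_ord /= big1 ?add0r => [|q _]; last first.
      by rewrite row_mxEl mxE mul0r.
    rewrite (bigD1 c) //= big1 ?addr0 => [|q qc]; last first.
      by rewrite row_mxEr !mxE /= (negPf qc) mulr0 mul0r.
    rewrite row_mxEr !mxE !eqxx mulr1 -expr2 -(real_normK (num_real t')).
    by rewrite ltr_pXn2r ?nnegrE ?(le_lt_trans t'h) // ltW.
  (* Every mixture of the two measures stays within [r] of [m0], so one radius from joint continuity
     serves all [t]. *)
  have := near_D _ _ t'r (wasserstein2_mix_left rep0 reph t r0 hS).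
  rewrite !DE -/D => /ltW; apply: le_trans.
  by rewrite ler_piMl.
have := Rintegral01_dist cg (fun t _ => gD t).
set Q := Rintegral _ _ _ => HQ.
have h1 : 0 < `|h| by rewrite normr_gt0.
by rewrite distrC -(ler_pM2l h1) -normrM mulrBr mulVKf.
Unshelve. all: by end_near. Qed.

End LiftDerivative.

Section LiftWeighted.
Variables (R : realType) (d : nat).

Lemma is_derive_lift N n (U : 'rV[R]_n -> P2 R (d + d) -> R)
    (s : 'I_n -> coord N d) (i : 'I_N) e z : (1 < N)%N -> class_CP2 1 U ->
  is_derive z (evc R e) (fun z => U (select s z) (loo i z))
    (\sum_q (s q == e)%:R * partial q U (select s z) (loo i z) +
     loo_weight R i (pt e) *
       partial_m (coord_index e) U (select (extend s (pt e)) z) (loo i z)).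
Proof.
move=> N1 U1; apply: is_derive_quotient.
have H := cvgD (@lift_line_euclidean R N d n U s i N1 U1 e z)
  (@lift_line_measure R N d n U s i N1 U1 e z).
have -> : (fun h : R => h^-1 * (U (select s (h *: evc R e + z)) (loo i (h *: evc R e + z)) -
     U (select s z) (loo i z))) =
  (fun h => h^-1 * (U (select s (h *: evc R e + z)) (loo i (h *: evc R e + z)) -
          U (select s z) (loo i (h *: evc R e + z)))) +
  (fun h => h^-1 * (U (select s z) (loo i (h *: evc R e + z)) -
          U (select s z) (loo i z))).
  by apply/funext => h; rewrite fctE -mulrDr subrKA.
exact: H.
Qed.

Lemma loo_weight_le N (i l : 'I_N) (S : seq 'I_N) : (1 < N)%N ->
  loo_weight R i l * wt R S <= 2 * wt R (l :: S).
Proof.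
move=> N1; apply: (@le_trans _ _ (2 * (N%:R^-1 * wt R S))); last first.
  by rewrite ler_wpM2l // wt_cons_ge.
rewrite mulrA ler_wpM2r ?wt_ge0 // /loo_weight; case: ifP => _; last first.
  by rewrite mulr_ge0 // invr_ge0.
have N0 : (0 < N.-1)%N by lia.
rewrite -[leLHS]mul1r ler_pdivrMr ?ltr0n // mulrAC ler_pdivlMr ?ltr0n; last lia.
by rewrite mul1r -natrM ler_nat; lia.
Qed.

Lemma class_CP2W k n m (U : 'rV[R]_n -> P2 R m -> R) :
  class_CP2 k.+1 U -> class_CP2 1 U.
Proof.
move=> [cU [dU pU lU dlU mU]]; split => //; split => // [q|j].
  by split => //; exact: class_CP2_jcontinuous (pU q).
by split => //; exact: class_CP2_jcontinuous (mU j).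
Qed.

Lemma sum_le_of_ge0 (I : finType) (F : I -> R) i :
  (forall j, 0 <= F j) -> F i <= \sum_j F j.
Proof. by move=> F0; rewrite (bigD1 i) //= lerDl sumr_ge0. Qed.

Lemma lift_continuous0 N n (U : 'rV[R]_n -> P2 R (d + d) -> R)
    (s : 'I_n -> coord N d) (i : 'I_N) : (1 < N)%N -> jcontinuous U ->
  continuous (fun z => U (select s z) (loo i z)).
Proof.
move=> N1 cU z.
apply: (@jcontinuous_cvg _ _ (nbhs z) _ _ _ U (select s) (select s z) (loo i) (loo i z)).
- exact: cU.
- move=> q; rewrite mxE; under eq_cvg do rewrite mxE.
  exact: continuous_co.
- by move=> r; exact: loo_near.
Qed.

(** The powers of $1/N$ produced by measure derivatives are stored in the scalar [a], while [U]
    keeps bounds free of $N$. The bound is linear in [K], so that [C] depends on [U] and [k] only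
    and is fixed before the configuration. *)
Definition lift_bound k : Prop := forall n (U : 'rV[R]_n -> P2 R (d + d) -> R),
  class_CP2 k U -> (forall r, (r <= k)%N -> derivatives_bounded r U) ->
  exists2 C, 0 <= C & forall N (s : 'I_n -> coord N d) (i : 'I_N)
    (S : seq 'I_N) (a K : R),
  (1 < N)%N -> i \in S -> (forall q, pt (s q) \in S) -> 0 <= K ->
  `|a| <= K * wt R S ->
  weighted k S (K * C) (fun z => a * U (select s z) (loo i z)).

(** Needs bounds from the first derivatives on, so it applies to $D_aL$. A Euclidean derivative is
    nonzero only along a selected coordinate, whose particle is already in [S]; a derivative through
    the measure may add a particle, and its factor [loo_weight] pays for it. *)
Lemma weighted_lift_derive k : lift_bound k ->
  forall n (U : 'rV[R]_n -> P2 R (d + d) -> R),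
  class_CP2 k.+1 U ->
  (forall r, (r <= k)%N -> derivatives_bounded r.+1 U) ->
  exists2 C, 0 <= C & forall N (s : 'I_n -> coord N d) (i : 'I_N)
    (S : seq 'I_N) (a K : R) e,
  (1 < N)%N -> i \in S -> (forall q, pt (s q) \in S) -> 0 <= K ->
  `|a| <= K * wt R S ->
  (forall z, derivable (fun z => a * U (select s z) (loo i z)) z (evc R e)) /\
  weighted k (pt e :: S) (K * C)
    ('D_(evc R e) (fun z => a * U (select s z) (loo i z))).
Proof.
move=> IH n U CU bU; have [cU [dU pU lU dlU mU]] := CU.
have /choice [Cq HCq] : forall q, exists C, 0 <= C /\
    forall N (s : 'I_n -> coord N d) (i : 'I_N) (S : seq 'I_N) (a K : R),
    (1 < N)%N -> i \in S -> (forall q, pt (s q) \in S) -> 0 <= K ->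
    `|a| <= K * wt R S ->
    weighted k S (K * C) (fun z => a * partial q U (select s z) (loo i z)).
  move=> q; have [|C C0 HC] := IH _ _ (pU q); last by exists C.
  by move=> r rk; have [H _] := bU r rk; exact: H.
have /choice [Cm HCm] : forall c, exists C, 0 <= C /\
    forall N (s : 'I_(n + (d + d)) -> coord N d) (i : 'I_N) (S : seq 'I_N) (a K : R),
    (1 < N)%N -> i \in S -> (forall q, pt (s q) \in S) -> 0 <= K ->
    `|a| <= K * wt R S ->
    weighted k S (K * C) (fun z => a * partial_m c U (select s z) (loo i z)).
  move=> c; have [|C C0 HC] := IH _ _ (mU c); last by exists C.
  by move=> r rk; have [_ H] := bU r rk; exact: H.
pose C1 := \sum_q Cq q; pose C2 := \sum_c Cm c.
have C10 : 0 <= C1 by apply: sumr_ge0 => q _; exact: (HCq q).1.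
have C20 : 0 <= C2 by apply: sumr_ge0 => c _; exact: (HCm c).1.
exists (n%:R * C1 + 2 * C2); first by rewrite addr_ge0 // mulr_ge0.
move=> N s i S a K e N1 iS sS K0 aK.
have U1 := class_CP2W CU.
have dU1 z := is_derive_lift s i e z N1 U1.
split => [z|].
  by apply: derivableZ; exact: (@ex_derive _ _ _ _ _ _ _ (dU1 z)).
have -> : 'D_(evc R e) (fun z => a * U (select s z) (loo i z)) =
   (fun z => \sum_q (a * (s q == e)%:R) * partial q U (select s z) (loo i z) +
     (a * loo_weight R i (pt e)) *
       partial_m (coord_index e) U (select (extend s (pt e)) z) (loo i z)).
  apply/funext => z.
  have := deriveZ a (@ex_derive _ _ _ _ _ _ _ (dU1 z)).
  rewrite (@derive_val _ _ _ _ _ _ _ (dU1 z)) => E; apply: etrans E _.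
  rewrite [LHS]mulrDr mulr_sumr mulrA; congr (_ + _).
  by apply: eq_bigr => q _; rewrite mulrA.
have -> : K * (n%:R * C1 + 2 * C2) = n%:R * (K * C1) + K * (2 * C2) by ring.
apply: weightedD.
  rewrite -[in n%:R](card_ord n); apply: weighted_sum; first exact: mulr_ge0.
  move=> q _; apply: (@weighted_le _ _ _ _ _ (K * Cq q)).
    by rewrite ler_wpM2l // /C1 sum_le_of_ge0 // => q'; exact: (HCq q').1.
  apply: (HCq q).2 => //.
  - by rewrite in_cons iS orbT.
  - by move=> q'; rewrite in_cons sS orbT.
  - case: eqP => [<-|_]; last by rewrite mulr0 normr0 mulr_ge0 ?wt_ge0.
    by rewrite mulr1 wt_cons_in.
apply: (@weighted_le _ _ _ _ _ ((2 * K) * Cm (coord_index e))).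
  rewrite [leRHS]mulrCA -mulrA ler_wpM2l // ler_wpM2l //.
  by rewrite /C2 sum_le_of_ge0 // => c; exact: (HCm c).1.
apply: (HCm (coord_index e)).2 => //.
- by rewrite in_cons iS orbT.
- move=> q; rewrite /extend /particle_coord; case: (fintype.split q) => q'.
    by rewrite in_cons sS orbT.
  by case: (fintype.split q') => b; rewrite in_cons eqxx.
- by rewrite mulr_ge0.
- rewrite normrM (ger0_norm (loo_weight_ge0 _ _ _)).
  apply: (@le_trans _ _ (K * wt R S * loo_weight R i (pt e))).
    by rewrite ler_wpM2r ?loo_weight_ge0.
  rewrite -mulrA [wt R S * _]mulrC (mulrC 2) -mulrA ler_wpM2l //.
  exact: loo_weight_le.
Qed.

Lemma weighted_lift k : lift_bound k.
Proof.
have base n (U : 'rV[R]_n -> P2 R (d + d) -> R) (B : R) N (s : 'I_n -> coord N d)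
    (i : 'I_N) (S : seq 'I_N) (a K : R) : (forall x mu, `|U x mu| <= B) ->
    `|a| <= K * wt R S ->
    forall z, `|a * U (select s z) (loo i z)| <= K * B * wt R S.
  by move=> UB aK z; rewrite normrM mulrAC ler_pM.
elim: k => [|k IH] n U CU bU; have [B UB] := bU 0%N isT.
  exists `|B| => // N s i S a K N1 iS sS K0 aK; split => // [z|z].
    apply: cvgM; first exact: cvg_cst.
    exact: (lift_continuous0 N1 (class_CP2_jcontinuous CU)).
  by apply: base => // x mu; exact: le_trans (UB x mu) (ler_norm _).
have [C C0 HC] := weighted_lift_derive IH CU (fun r rk => bU r.+1 rk).
exists (`|B| + C); first by rewrite addr_ge0.
move=> N s i S a K N1 iS sS K0 aK; split => [z|z|e].
- apply: cvgM; first exact: cvg_cst.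
  exact: (lift_continuous0 N1 (class_CP2_jcontinuous CU)).
- apply: (@le_trans _ _ (K * `|B| * wt R S)).
    by apply: base => // x mu; exact: le_trans (UB x mu) (ler_norm _).
  by rewrite ler_wpM2r ?wt_ge0 // ler_wpM2l // lerDl.
have [dz Wz] := HC N s i S a K e N1 iS sS K0 aK.
by split => //; apply: weighted_le Wz; rewrite ler_wpM2l // lerDr.
Qed.

End LiftWeighted.

(** * The system satisfied by the fixed points *)

Section Tangent.
Variables (R : realType) (V : normedModType R).

(** The one-sided quotients of a function lying above a line that touches it at [x] squeeze the
    derivative. It serves both for the envelope formula and for stationarity of a maximiser. *)
Lemma derive_tangent (g : V -> R) (x v : V) (k : R) : derivable g x v ->
  (forall h : R, g x + h * k <= g (h *: v + x)) -> 'D_v g x = k.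
Proof.
move=> /cvg_derive dg gk; apply/eqP; rewrite eq_le; apply/andP; split.
  have /cvgr_to_le := cvg_dnbhs_at_left dg; apply; near=> h.
  have h0 : h < 0 by near: h; exact: nbhs_left_lt.
  by rewrite mulrC ler_ndivrMr // lerBrDl mulrC gk.
have /cvgr_to_ge := cvg_dnbhs_at_right dg; apply; near=> h.
have h0 : 0 < h by near: h; exact: nbhs_right_gt.
by rewrite mulrC ler_pdivlMr // lerBrDl mulrC gk.
Unshelve. all: by end_near. Qed.

Lemma eq_line (W : normedModType R) (f : V -> R) (g : W -> R) x v y w :
  (forall h : R, f (h *: v + x) = g (h *: w + y)) ->
  (derivable f x v = derivable g y w) * ('D_v f x = 'D_w g y).
Proof.
move=> fg; have E : (fun h : R => h^-1 *: ((f \o shift x) (h *: v) - f x)) =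
    (fun h : R => h^-1 *: ((g \o shift y) (h *: w) - g y)).
  apply/funext => h /=; rewrite fg; have := fg 0.
  by rewrite !scale0r !add0r => ->.
by split; rewrite ?/derivable ?/derive E.
Qed.

End Tangent.

Section Euclidean.
Variable R : realType.

Lemma evec_rshift d (b : 'I_d) : evec (rshift d b) = row_mx 0 (evec b) :> 'rV[R]_(d + d).
Proof.
apply/rowP => c; rewrite !mxE /=; case: (fintype.splitP c) => b' cb; rewrite !mxE /=.
  suff -> : (c == rshift d b) = false by [].
  by apply/negP => /eqP cE; move: cb; rewrite cE /=; have := ltn_ord b'; lia.
by congr (_%:R); rewrite -!val_eqE /= cb eqn_add2l.
Qed.

Lemma dotp_row_mx n m (x x' : 'rV[R]_n) (y y' : 'rV[R]_m) :
  dotp (row_mx x y) (row_mx x' y') = dotp x x' + dotp y y'.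
Proof.
rewrite /dotp big_split_ord /=; congr (_ + _); apply: eq_bigr => i _.
  by rewrite !row_mxEl.
by rewrite !row_mxEr.
Qed.

Lemma dotpDl n (x y z : 'rV[R]_n) : dotp (x + y) z = dotp x z + dotp y z.
Proof.
by rewrite /dotp -big_split; apply: eq_bigr => i _; rewrite /= mxE mulrDl.
Qed.

Lemma dotpZl n (a : R) (x z : 'rV[R]_n) : dotp (a *: x) z = a * dotp x z.
Proof.
by rewrite /dotp mulr_sumr; apply: eq_bigr => i _; rewrite mxE mulrA.
Qed.

Lemma dotpC n (x y : 'rV[R]_n) : dotp x y = dotp y x.
Proof. by apply: eq_bigr => i _; rewrite mulrC. Qed.

Lemma dotp_evec n (x : 'rV[R]_n) b : dotp (evec b) x = x 0 b.
Proof.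
rewrite /dotp (bigD1 b) //= big1 ?addr0 => [|c cb].
  by rewrite !mxE !eqxx mul1r.
by rewrite !mxE /= (negPf cb) mul0r.
Qed.

Lemma norm_entry_le n (x : 'rV[R]_n) b : `|x 0 b| <= norm2 x.
Proof.
apply: norm_le_of_sqr; first exact: sqrtr_ge0.
rewrite norm2_sqr /dotp (bigD1 b) //= -expr2 lerDl.
by apply: sumr_ge0 => i _; rewrite -expr2 sqr_ge0.
Qed.

Lemma continuous_dotp n (p : 'rV[R]_n) : continuous (fun a => dotp a p).
Proof.
move=> a; rewrite /dotp; apply: (@cvg_finsum R _ (nbhs a)) => i _.
apply: (@cvgM _ _ (nbhs a)); last exact: cvg_cst.
exact: coord_continuous.
Qed.

Lemma continuous_dotp_diag n : continuous (fun a : 'rV[R]_n => dotp a a).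
Proof.
move=> a; rewrite /dotp; apply: (@cvg_finsum R _ (nbhs a)) => i _.
by apply: (@cvgM _ _ (nbhs a)); exact: coord_continuous.
Qed.

Lemma compact_dotp_ball n (M : R) : compact [set a : 'rV[R]_n | dotp a a <= M].
Proof.
apply: bounded_closed_compact.
  exists (Num.sqrt M); split; first exact: num_real.
  move=> r Mr a /= aM.
  rewrite /Num.Def.normr /= mx_normrE; apply: bigmax_le.
    exact: le_trans (sqrtr_ge0 _) (ltW Mr).
  move=> [i b] _ /=; rewrite (ord1 i) (le_trans (norm_entry_le a b)) //.
  by rewrite (le_trans _ (ltW Mr)) // /norm2 ler_wsqrtr.
have -> : [set a : 'rV[R]_n | dotp a a <= M] = (fun a => dotp a a) @^-1` [set r | r <= M].
  by [].
by apply: closed_comp => [a _|]; [exact: continuous_dotp_diag|exact: closed_le].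
Qed.

End Euclidean.

(** * Legendre duality *)

Section Legendre.
Variables (R : realType) (d : nat).
Variable L : 'rV[R]_d -> 'rV[R]_d -> P2 R (d + d) -> R.

(** Coercivity provides a maximiser [a0]. The affine function of the momentum given by [a0] lies
    below the Hamiltonian and touches it at [p], so $-D_pH=a0$; stationarity of [a0] is then the
    claim. *)
Lemma legendre_stationary (C : R) x p mu :
  0 < C -> (forall a, C^-1 * norm2 a ^+ 2 - C <= L x a mu) ->
  continuous (fun a => L x a mu) ->
  (forall a b, derivable (fun a => L x a mu) a (evec b)) ->
  (forall b, derivable (fun p => hamiltonian L x p mu) p (evec b)) ->
  DaL L x (- DpH L x p mu) mu = - p.
Proof.
move=> C0 Lge cL dL dH.
pose f q a := - dotp a q - L x a mu.
have f_le q a : f q a <= C + C / 2 * dotp q q - C^-1 / 2 * dotp a a.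
  rewrite /f; have := Lge a; rewrite norm2_sqr => La.
  have : 0 <= C / 2 * dotp (q + C^-1 *: a) (q + C^-1 *: a).
    by rewrite mulr_ge0 ?dotp_ge0 // divr_ge0 // ltW.
  have -> : dotp (q + C^-1 *: a) (q + C^-1 *: a) =
     dotp q q + 2 * C^-1 * dotp a q + C^-1 ^+ 2 * dotp a a.
    rewrite dotpDl !dotpZl (dotpC q) (dotpC a (q + _)) !dotpDl !dotpZl.
    by rewrite (dotpC q a); ring.
  have -> : C / 2 * (dotp q q + 2 * C^-1 * dotp a q + C^-1 ^+ 2 * dotp a a) =
    C / 2 * dotp q q + dotp a q + C^-1 / 2 * dotp a a.
    by field; rewrite gt_eqF.
  lra.
have bnd q : ubound [set f q a | a in [set: 'rV[R]_d]] (C + C / 2 * dotp q q).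
  move=> _ [a _ <-]; rewrite (le_trans (f_le q a)) // gerBl.
  by rewrite mulr_ge0 ?dotp_ge0 // divr_ge0 // invr_ge0 ltW.
have H_ge q a : f q a <= hamiltonian L x q mu.
  apply: ub_le_sup; last by exists a.
  by exists (C + C / 2 * dotp q q); exact: bnd.
(* Beyond this squared radius the bound [f_le] drops below the value at the zero action, so a
   maximum over the ball is global. *)
pose M := 2 * C * (C + C / 2 * dotp p p - f p 0).
have zero_in : [set a : 'rV[R]_d | dotp a a <= M] 0.
  rewrite /= {1}/dotp big1 => [|i _]; last by rewrite mxE mul0r.
  apply: mulr_ge0; first by rewrite mulr_ge0 // ltW.
  by rewrite subr_ge0; apply: bnd; exists 0.
have [a0 _ a0max] : exists2 a, a \in [set a : 'rV[R]_d | dotp a a <= M] &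
    forall b, b \in [set a : 'rV[R]_d | dotp a a <= M] -> f p b <= f p a.
  apply: EVT_max_rV; last 2 first.
  - exact: compact_dotp_ball.
  - apply: continuous_subspaceT => a; rewrite /f.
    apply: (@cvgB _ _ _ (nbhs a)); last exact: cL.
    exact (cvgN (@continuous_dotp R d p a)).
  by exists 0.
have a0_ge a : f p a <= f p a0.
  have [aM|aM] := leP (dotp a a) M; first by apply: a0max; rewrite inE.
  have : f p 0 <= f p a0 by apply: a0max; rewrite inE.
  apply: le_trans; rewrite (le_trans (f_le p a)) //.
  rewrite lerBlDr -lerBlDl; move: aM => /ltW; rewrite /M => aM.
  have c2 : 0 < 2 * C by rewrite mulr_gt0.
  rewrite -(ler_pM2l c2); apply: le_trans aM _.
  by rewrite le_eqVlt; apply/orP; left; apply/eqP; field; rewrite gt_eqF.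
have HE : hamiltonian L x p mu = f p a0.
  apply/eqP; rewrite eq_le H_ge andbT; apply: ge_sup; first by exists (f p 0); exists 0.
  by move=> _ [a _ <-]; exact: a0_ge.
have DHE : - DpH L x p mu = a0.
  apply/rowP => b; rewrite mxE mxE.
  apply/eqP; rewrite eqr_oppLR; apply/eqP; apply: derive_tangent; first exact: dH.
  move=> h; apply: le_trans (H_ge _ a0); rewrite HE /f.
  by rewrite !(dotpC a0) dotpDl dotpZl dotp_evec mulrN; lra.
rewrite DHE; apply/rowP => b; rewrite !mxE; apply: derive_tangent; first exact: dL.
move=> h; have := a0_ge (h *: evec b + a0); rewrite /f dotpDl dotpZl dotp_evec; lra.
Qed.

End Legendre.

Section LagrangianSystem.
Variables (R : realType) (d : nat).
Variable L : 'rV[R]_d -> 'rV[R]_d -> P2 R (d + d) -> R.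

Definition DaL_pair (b : 'I_d) : 'rV[R]_(d + d) -> P2 R (d + d) -> R :=
  partial (rshift d b) (pairfun L).

(* By Legendre duality the fixed points [a] are the solutions of
   [Phi i (x, a) = - p]. *)
Definition Phi N (i : 'I_N * 'I_d) (z : config R N d) : R :=
  DaL_pair i.2 (particle i.1 z) (loo i.1 z).

Lemma pair_line F x a (b : 'I_d) mu (h : R) :
  (fun a' : 'rV[R]_d => F x a' mu) (h *: evec b + a) =
  (fun w => pairfun F w mu) (h *: evec (rshift d b) + row_mx x a).
Proof.
by rewrite /pairfun evec_rshift scale_row_mx add_row_mx row_mxKl row_mxKr scaler0 add0r.
Qed.

Lemma DaL_pairE x a mu b : DaL L x a mu 0 b = DaL_pair b (row_mx x a) mu.
Proof.
rewrite mxE /DaL_pair /partial.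
exact: (@eq_line R _ _ _ _ a (evec b) (row_mx x a) (evec (rshift d b))
  (fun h => pair_line L x a b mu h)).2.
Qed.

Lemma derivable_pair F k x a mu b : class_CP2 k.+1 (pairfun F) ->
  derivable (fun a' : 'rV[R]_d => F x a' mu) a (evec b).
Proof.
move=> [_ [dF _ _ _ _]].
rewrite (@eq_line R _ _ _ _ a (evec b) (row_mx x a) (evec (rshift d b))
  (fun h => pair_line F x a b mu h)).1.
exact: dF.
Qed.

Lemma select_particle N (l : 'I_N) (z : config R N d) :
  select (particle_coord l) z = particle l z.
Proof. by apply/rowP => c; rewrite mxE particleE. Qed.

Lemma pt_particle_coord N (l : 'I_N) c : pt (particle_coord l c : coord N d) = l.
Proof. by rewrite /particle_coord; case: (fintype.split c). Qed.

(** Orders 2 to 5 of $L$ are orders 1 to 4 of $D_aL$, that is, orders 0 to 3 of the derivatives of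
    [Phi]. The lift starts from the coordinates of particle $i$ with the list [[:: i.1]] and unit
    coefficient. *)
Lemma Phi_weighted : class_C5_bounded (pairfun L) -> exists2 K, 0 <= K &
  forall N (i : 'I_N * 'I_d), (1 < N)%N -> continuous (Phi i) /\
    forall e, (forall z, derivable (Phi i) z (evc R e)) /\
      weighted 3 [:: pt e; i.1] K ('D_(evc R e) (Phi i)).
Proof.
move=> [[cL [dL pL lL dlL mL]] bL].
have /choice [C HC] : forall b : 'I_d, exists C, 0 <= C /\
    forall N (s : 'I_(d + d) -> coord N d) (i : 'I_N)
    (S : seq 'I_N) (a K : R) e,
  (1 < N)%N -> i \in S -> (forall q, pt (s q) \in S) -> 0 <= K ->
  `|a| <= K * wt R S ->
  (forall z, derivable (fun z => a * DaL_pair b (select s z) (loo i z)) z (evc R e)) /\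
  weighted 3 (pt e :: S) (K * C)
    ('D_(evc R e) (fun z => a * DaL_pair b (select s z) (loo i z))).
  move=> b; have [r r3|C C0 HC] := weighted_lift_derive (@weighted_lift R d 3)
    (pL (rshift d b)); last by exists C.
  by have [|H _] := bL r.+2; [lia|exact: H].
exists (\sum_b C b); first by apply: sumr_ge0 => b _; exact: (HC b).1.
move=> N i N1.
have PhiE : Phi i = fun z => 1 * DaL_pair i.2 (select (particle_coord i.1) z) (loo i.1 z).
  by apply/funext => z; rewrite mul1r select_particle.
split.
  have -> : Phi i = fun z => DaL_pair i.2 (select (particle_coord i.1) z) (loo i.1 z).
    by apply/funext => z; rewrite select_particle.
  apply: lift_continuous0 => //.
  by have [] := pL (rshift d i.2).
move=> e; have [||||dz Wz] := (HC i.2).2 N (@particle_coord N d i.1) i.1 [:: i.1] 1 1 e N1.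
- by rewrite mem_seq1.
- by move=> q; rewrite pt_particle_coord mem_seq1.
- exact: ler01.
- by rewrite wt1 mulr1 normr1.
rewrite PhiE; split => //; apply: weighted_le Wz.
by rewrite mul1r; apply: sum_le_of_ge0 => b; exact: (HC b).1.
Qed.

Lemma Phi_fixed_point N (aN : config R N d -> 'M[R]_(N, d)) :
  (1 < N)%N -> L_regular L -> is_aN L aN ->
  forall z i, Phi i (z.1, aN z) = - z.2 i.1 i.2.
Proof.
move=> N1 [[CL _] [CH _] _ [C C0 [_ coer]] _] HaN z [i b].
have rep := represents_loo i (z.1, aN z) N1.
have fp : fixed_point L z.1 z.2 (aN z) by apply/HaN; case: (z).
have := @legendre_stationary R d L C (row i z.1) (row i z.2)
  (loo i (z.1, aN z)) C0.
rewrite -(fp i); move=> H.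
rewrite /Phi /= -DaL_pairE H ?mxE //.
- by move=> a; have [] := coer (row i z.1) a (loo i (z.1, aN z)).
- move=> a; set x := row i z.1; set mu := loo _ _ in rep *.
  have -> : (fun a' => L x a' mu) = (fun a' => pairfun L (row_mx x a') mu).
    by apply/funext => a'; rewrite /pairfun row_mxKl row_mxKr.
  apply: (@jcontinuous_cvg _ _ (nbhs a) _ _ _ (pairfun L) (fun a' => row_mx x a')
     (row_mx x a) (fun=> mu) mu); first exact: class_CP2_jcontinuous CL.
    move=> q; rewrite mxE; under eq_cvg do rewrite mxE.
    case: (fintype.split q) => q'; first exact: cvg_cst.
    exact: coord_continuous.
  move=> r r0; apply: (@filterE _ (nbhs a)) => _; apply: (wasserstein2_represents_lt r0 rep rep).
  by rewrite big1 ?exprn_gt0 // => j _; rewrite subrr norm2_0 expr0n mulr0.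
- by move=> a b'; exact: (@derivable_pair L 4).
- by move=> b'; exact: (@derivable_pair (hamiltonian L) 4).
Qed.

End LagrangianSystem.

(** * Monotonicity of the finite system *)

Section FullMonotonicity.
Variables (R : realType) (d : nat).
Variable L : 'rV[R]_d -> 'rV[R]_d -> P2 R (d + d) -> R.

Definition full N (z : config R N d) : P2 R (d + d) :=
  empirical [seq particle j z | j <- enum 'I_N & true].

Lemma represents_full N (z : config R N d) : (0 < N)%N ->
  represents (full z) (fun=> N%:R^-1) (fun j => particle j z).
Proof.
move=> N0; have := @represents_empirical R (d + d) 'I_N (fun=> true)
  (fun j => particle j z).
have -> : #|(fun=> true) : pred 'I_N| = N by rewrite (eq_card (B := predT)) ?card_ord.
exact.
Qed.

Definition Psi N (i : 'I_N * 'I_d) (z : config R N d) : R :=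
  DaL_pair L i.2 (particle i.1 z) (full z).

Lemma measurable_nat_fun dT (T : measurableType dT) (f : nat -> T) :
  measurable_fun setT f.
Proof. by []. Qed.

Lemma Psi_monotone : fixed_point_monotonicity L -> exists2 c, 0 < c &
  forall N (x a a' : 'M[R]_(N, d)), (0 < N)%N ->
  c * \sum_(i : 'I_N * 'I_d) (a i.1 i.2 - a' i.1 i.2) ^+ 2 <=
  \sum_i (Psi i (x, a) - Psi i (x, a')) * (a i.1 i.2 - a' i.1 i.2).
Proof.
move=> [c [cx [c0 cx0 H]]]; exists c => // N x a a' N0.
have i0 : 'I_N := Ordinal N0.
have w0 : 0 <= N%:R^-1 :> R by rewrite invr_ge0.
have nN0 : N%:R != 0 :> R by rewrite pnatr_eq0 -lt0n.
have w1 : \sum_(i < N) (NngNum w0)%:num = 1.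
  by rewrite sumr_const card_ord /= -[LHS]mulr_natl divff.
(* Random vectors are read off a particle drawn uniformly; on [nat] every function is measurable,
   and [rowf] is set to 0 outside the range, where [P] has no mass. Both positions are taken equal
   to [x], so all position terms vanish. *)
pose P := @discrete_prob _ nat R 'I_N i0 (fun=> NngNum w0) (fun i => i : nat) w1.
pose rowf (A : 'M[R]_(N, d)) (k : nat) : 'rV[R]_d :=
  if insub k is Some i then row i A else 0.
have rowfE A (i : 'I_N) : rowf A i = row i A by rewrite /rowf valK.
have int (f : nat -> R) : (\int[P]_k (f k)%:E = (\sum_(i < N) N%:R^-1 * f i)%:E)%E.
  exact: integral_discrete.
have sq A : square_integrable (P : probability _ _) (rowf A).
  split; first exact: measurable_nat_fun.
  by rewrite int ltry.
have law A B : has_law (P : probability _ _) (fun k => row_mx (rowf A k) (rowf B k))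
    (full (A, B)).
  move=> S mS; rewrite (represents_full (A, B) N0).2 //.
  rewrite /P /= /discrete_prob discrete_measureE; congr (_%:E).
  apply: eq_bigr => i _; congr (_ * _); rewrite !indicE; congr (nat_of_bool _)%:R.
  by apply/idP/idP; rewrite !inE /= /particle /= !rowfE.
have := H _ _ (P : probability _ _) (rowf x) (rowf x) (rowf a) (rowf a') _ _
  (sq x) (sq x) (sq a) (sq a') (law x a) (law x a').
rewrite unlock !int -!EFinM -EFinB lee_fin.
set S1 := \sum_(i < N) _ * norm2 (rowf a i - _) ^+ 2.
set S2 := \sum_(i < N) _ * norm2 (rowf x i - _) ^+ 2.
have -> : S2 = 0.
  by rewrite /S2 big1 // => i _; rewrite subrr norm2_0 expr0n mulr0.
rewrite mulr0 subr0.
have -> : S1 = N%:R^-1 * \sum_(i : 'I_N * 'I_d) (a i.1 i.2 - a' i.1 i.2) ^+ 2.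
  rewrite /S1 -mulr_sumr; congr (_ * _).
  rewrite -(pair_bigA _ (fun i b => (a i b - a' i b) ^+ 2)) /=.
  apply: eq_bigr => i _; rewrite norm2_sqr /dotp; apply: eq_bigr => b _.
  by rewrite !rowfE !mxE expr2.
set S3 := \sum_(i < N) _.
have -> : S3 = N%:R^-1 * \sum_i (Psi i (x, a) - Psi i (x, a')) * (a i.1 i.2 - a' i.1 i.2).
  rewrite /S3 -mulr_sumr; congr (_ * _).
  rewrite -(pair_bigA _ (fun i b => (Psi (i, b) (x, a) - Psi (i, b) (x, a')) *
    (a i b - a' i b))) /=.
  apply: eq_bigr => i _; rewrite subrr [dotp _ 0]big1 => [|b _]; last first.
    by rewrite [X in _ * X]mxE mulr0.
  rewrite addr0 /dotp; apply: eq_bigr => b _.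
  have subE (A B : 'rV[R]_d) : (A - B) 0 b = A 0 b - B 0 b by rewrite !mxE.
  by rewrite !subE !DaL_pairE !rowfE !mxE.
by rewrite mulrCA ler_pM2l // invr_gt0 ltr0n.
Qed.

End FullMonotonicity.

Section LeaveOneOutError.
Variables (R : realType) (d : nat).
Variable L : 'rV[R]_d -> 'rV[R]_d -> P2 R (d + d) -> R.

Lemma Rintegral01_sub_le (g g' : R -> R) (e : R) : continuous g -> continuous g' ->
  (forall t, `|g t - g' t| <= e) ->
  `|\int[@lebesgue_measure R]_(t in `[0, 1]) g t -
    \int[@lebesgue_measure R]_(t in `[0, 1]) g' t| <= e.
Proof.
move=> cg cg' gg'.
have int (h : R -> R) : continuous h ->
    (@lebesgue_measure R).-integrable `[0, 1] (EFin \o h).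
  move=> ch; apply: continuous_compact_integrable; first exact: segment_compact.
  exact: continuous_subspaceT.
rewrite -RintegralB //; [|exact: int|exact: int].
rewrite -[X in `|X|]subr0; apply: Rintegral01_dist => [t|t _].
  by apply: cvgB; [exact: cg|exact: cg'].
by rewrite subr0.
Qed.

(** With its counterpart [represents_prodr] it rewrites two measures of different weights over one
    product index with common weights, as continuity along their mixture requires. *)
Lemma represents_prodl m (mu : P2 R m) (I J : finType) (w : I -> R) y (w' : J -> R) :
  represents mu w y -> (forall j, 0 <= w' j) -> \sum_j w' j = 1 ->
  represents mu (fun k : I * J => w k.1 * w' k.2) (fun k => y k.1).
Proof.
move=> [w0 mE] w'0 w'1; split => [k|A mA]; first by rewrite mulr_ge0.
rewrite mE // -(pair_bigA _ (fun i j => w i * w' j * \1_A (y i))) /=; congr (_%:E).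
by apply: eq_bigr => i _; rewrite -mulr_suml -mulr_sumr w'1 mulr1.
Qed.

Lemma represents_prodr m (mu : P2 R m) (I J : finType) (w : J -> R) y (w' : I -> R) :
  represents mu w y -> (forall i, 0 <= w' i) -> \sum_i w' i = 1 ->
  represents mu (fun k : I * J => w' k.1 * w k.2) (fun k => y k.2).
Proof.
move=> [w0 mE] w'0 w'1; split => [k|A mA]; first by rewrite mulr_ge0.
rewrite mE // -(pair_bigA _ (fun i j => w' i * w j * \1_A (y j))) /= exchange_big /=.
congr (_%:E); apply: eq_bigr => j _; rewrite -!mulr_suml w'1 mul1r //.
Qed.

Variables (N : nat) (x a a' : 'M[R]_(N, d)).
Hypothesis N1 : (1 < N)%N.

Let del (j : 'I_N) := norm2 (row j a - row j a').
Let n : R := N%:R.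

(** Off [i] the difference is $1/(N(N-1))\le 2/N^2$, so the signed measure has total variation
    $O(1/N)$. *)
Lemma sub_loo_weight_le (i j : 'I_N) :
  `|n^-1 - loo_weight R i j| <= (if j == i then n^-1 else 2 * n^-1 ^+ 2).
Proof.
have n1 : 1 < n by rewrite /n -[1]/(1%:R) ltr_nat.
have n0 : 0 < n by exact: lt_trans n1.
rewrite /loo_weight; case: eqP => _ /=.
  by rewrite subr0 ger0_norm // invr_ge0 ltW.
have -> : N.-1%:R = n - 1 by rewrite /n -subn1 natrB // ltnW.
have n10 : 0 < n - 1 by rewrite subr_gt0.
have n2 : 2 <= n by rewrite /n ler_nat.
rewrite distrC ger0_norm.
  have -> : (n - 1)^-1 - n^-1 = n^-1 * (n - 1)^-1.
    by field; rewrite !gt_eqF.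
  have le2 : (n - 1)^-1 <= 2 / n.
    by rewrite -[leLHS]div1r ler_pdivrMr // mulrAC ler_pdivlMr //; lra.
  have -> : 2 * n^-1 ^+ 2 = n^-1 * (2 / n) by field; rewrite gt_eqF.
  by rewrite ler_wpM2l // invr_ge0 ltW.
by rewrite subr_ge0 lef_pV2 ?posrE // gerBl.
Qed.

Lemma loo_weight_le2 (i j : 'I_N) : loo_weight R i j <= 2 * n^-1.
Proof.
have [->|ji] := eqVneq j i.
  by rewrite /loo_weight eqxx mulr_ge0 // invr_ge0 ler0n.
have := loo_weight_le R i j [:: i] N1.
by rewrite wt1 mulr1 wt_cons_notin ?inE // wt1 mulr1.
Qed.

Let del0 j : 0 <= del j. Proof. exact: sqrtr_ge0. Qed.

Let n0 : 0 < n. Proof. by rewrite ltr0n; lia. Qed.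

Lemma norm2_sub_particle j : norm2 (particle j (x, a) - particle j (x, a')) = del j.
Proof.
rewrite /particle /= opp_row_mx add_row_mx subrr /norm2 dotp_row_mx.
by rewrite {1}/dotp big1 ?add0r // => i _; rewrite mxE mul0r.
Qed.

Lemma wasserstein1_mix_loo_full (i : 'I_N) t :
  wasserstein 1 (mix t (loo i (x, a)) (full (x, a)))
                (mix t (loo i (x, a')) (full (x, a'))) <= 3 / n * \sum_j del j.
Proof.
have N0 : (0 < N)%N by exact: ltnW.
apply: le_trans (wasserstein1_represents
  (represents_mix t (represents_loo i (x, a) N1) (represents_full (x, a) N0))
  (represents_mix t (represents_loo i (x, a') N1) (represents_full (x, a') N0))) _.
rewrite big_sumType /=.
have c0 := clamp01_ge0 t; have c1 := onem_clamp01_ge0 t.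
rewrite (_ : 3 / n = 2 * n^-1 + n^-1); last by field; rewrite gt_eqF.
rewrite mulrDl !mulr_sumr lerD //; apply: ler_sum => j _; rewrite norm2_sub_particle.
  rewrite -[leLHS]mulrA; apply: (@le_trans _ _ (loo_weight R i j * del j)).
    by rewrite ler_piMl ?mulr_ge0 ?loo_weight_ge0 // gerBl.
  by rewrite ler_wpM2r // loo_weight_le2.
by rewrite -[leLHS]mulrA ler_piMl ?mulr_ge0 ?invr_ge0 ?ler0n // clamp01_le1.
Qed.

(* Psi - Phi is an average against $m^N - m^{N,-i}$, of mass $O(1/N)$, of a function
   which is Lipschitz in all its arguments, hence also in the actions. *)
Lemma leave_one_out_error (C : R) (i : 'I_N * 'I_d) : 0 <= C ->
  class_CP2 5 (pairfun L) ->
  (forall w w' mu mu' y y',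
    norm2 (lfdV (DaL L (lsubmx w) (rsubmx w)) mu y -
           lfdV (DaL L (lsubmx w') (rsubmx w')) mu' y') <=
    C * (norm2 (w - w') + wasserstein 1 mu mu' + norm2 (y - y'))) ->
  `|(Psi L i (x, a) - Phi L i (x, a)) - (Psi L i (x, a') - Phi L i (x, a'))| <=
  C / n * (4 * del i.1 + 11 / n * \sum_j del j).
Proof.
move=> C0 CL lipC.
have N0 : (0 < N)%N by exact: ltnW.
case: i => i b /=; set Sd := \sum_j del j.
have [_ [_ /(_ (rshift d b)) CP _ _ _]] := CL.
have lfdP w : is_lfd (DaL_pair L b w) (lfd (DaL_pair L b w)).
  by have [_ [_ _ ex _ _]] := CP; exact: is_lfd_lfd (ex w).
have lfdE w mu y : lfd (DaL_pair L b w) mu y =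
    lfdV (DaL L (lsubmx w) (rsubmx w)) mu y 0 b.
  rewrite mxE; congr (lfd _ mu y); apply/funext => nu.
  by rewrite DaL_pairE hsubmxK.
pose g (A : 'M[R]_(N, d)) t := \sum_j (n^-1 - loo_weight R i j) *
  lfd (DaL_pair L b (particle i (x, A))) (mix t (loo i (x, A)) (full (x, A)))
    (particle j (x, A)).
have gE A : Psi L (i, b) (x, A) - Phi L (i, b) (x, A) =
    \int[@lebesgue_measure R]_(t in `[0, 1]) g A t.
  have [cf _ fE _] := lfdP (particle i (x, A)).
  rewrite /Psi /Phi /= fE; congr Rintegral; apply/funext => t.
  have rl := represents_loo i (x, A) N1; have rf := represents_full (x, A) N0.
  have cft := continuous_jcontinuous (represents_mix t rl rf) cf.
  rewrite (integral_represents rl cft) (integral_represents rf cft) -sumrB.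
  by apply: eq_bigr => j _; rewrite mulrBl.
have cg A : continuous (g A).
  have [cf _ _ _] := lfdP (particle i (x, A)) => t.
  apply: cvg_finsum => j _; apply: cvgM; first exact: cvg_cst.
  have rl := represents_loo i (x, A) N1; have rf := represents_full (x, A) N0.
  have rl' := represents_prodl rl rf.1 (represents_sum1 rf).
  have rf' := represents_prodr rf rl.1 (represents_sum1 rl).
  exact: (mix_continuous rl' rf' cf).
rewrite !gE; apply: Rintegral01_sub_le => // t.
rewrite /g -sumrB (le_trans (ler_norm_sum _ _ _)) //.
pose B j := C * (del i + 3 / n * Sd + del j).
have B0 j : 0 <= B j.
  by rewrite mulr_ge0 // !addr_ge0 // mulr_ge0 ?sumr_ge0 // divr_ge0 // ltW.
apply: (@le_trans _ _ (\sum_j (if j == i then n^-1 else 2 * n^-1 ^+ 2) * B j)).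
  apply: ler_sum => j _; rewrite -mulrBr normrM ler_pM ?sub_loo_weight_le //.
  rewrite !lfdE.
  set u := lfdV _ _ _; set v := lfdV _ _ _.
  have -> : u 0 b - v 0 b = (u - v) 0 b by rewrite !mxE.
  rewrite (le_trans (norm_entry_le _ _)) // (le_trans (lipC _ _ _ _ _ _)) //.
  by rewrite ler_wpM2l // !norm2_sub_particle lerD // lerD // wasserstein1_mix_loo_full.
rewrite (bigD1 i) //= eqxx.
have sum_le : \sum_(j | j != i) (if j == i then n^-1 else 2 * n^-1 ^+ 2) * B j <=
    2 * n^-1 ^+ 2 * \sum_j B j.
  rewrite mulr_sumr [leLHS]big_mkcond; apply: ler_sum => j _.
  case: (eqVneq j i) => _ //=.
  by rewrite mulr_ge0 ?B0 // mulr_ge0 // exprn_ge0 // invr_ge0 ltW.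
apply: le_trans (lerD (lexx _) sum_le) _.
have -> : \sum_j B j = C * (n * (del i + 3 / n * Sd) + Sd).
  rewrite /B -mulr_sumr big_split /= sumr_const card_ord -/Sd.
  by rewrite -[_ *+ N]mulr_natl.
(* Particle [i] gives $2\,del_i+\frac3n Sd$ and the others $2\,del_i+\frac8n Sd$, both times $C/n$;
   hence 4 and 11. *)
rewrite /B le_eqVlt; apply/orP; left; apply/eqP; field; rewrite gt_eqF //.
Qed.

End LeaveOneOutError.

Section PhiMonotone.
Variables (R : realType) (d : nat).
Variable L : 'rV[R]_d -> 'rV[R]_d -> P2 R (d + d) -> R.

Lemma Phi_monotone : L_regular L -> fixed_point_monotonicity L ->
  exists2 c, 0 < c & exists N0, forall N (x a a' : 'M[R]_(N, d)),
  (N0 <= N)%N -> (1 < N)%N /\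
  c * \sum_(i : 'I_N * 'I_d) (a i.1 i.2 - a' i.1 i.2) ^+ 2 <=
  \sum_i (Phi L i (x, a) - Phi L i (x, a')) * (a i.1 i.2 - a' i.1 i.2).
Proof.
move=> [[CL _] _ _ _ [_ [C lipC]]] /Psi_monotone[c c0 mono].
exists (c / 2); first by rewrite divr_gt0.
(* Cauchy-Schwarz bounds the total error by $15\,d|C|/n$ times the squared distance, $15=4+11$; it
   uses at most half of [c] as soon as $n\ge X$. The [.+2] below ensures at least two particles. *)
pose X : R := 30 * d%:R * `|C| / c.
have X0 : 0 <= X by rewrite divr_ge0 ?mulr_ge0 ?ler0n // ltW.
exists (Num.bound X).+2 => N x a a' NN0.
have N1 : (1 < N)%N by exact: leq_trans NN0.
split => //; pose n : R := N%:R.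
have n0 : 0 < n by rewrite ltr0n ltnW.
have Xn : X <= n.
  by rewrite (le_trans (ltW (archi_boundP X0))) // ler_nat; lia.
pose del (j : 'I_N) := norm2 (row j a - row j a').
have del0 j : 0 <= del j by exact: sqrtr_ge0.
pose Del (i : 'I_N * 'I_d) := a i.1 i.2 - a' i.1 i.2.
have Del_le i : `|Del i| <= del i.1.
  have -> : Del i = (row i.1 a - row i.1 a') 0 i.2 by rewrite !mxE.
  exact: norm_entry_le.
pose E i := (Psi L i (x, a) - Phi L i (x, a)) - (Psi L i (x, a') - Phi L i (x, a')).
have E_le i : `|E i| <= `|C| / n * (4 * del i.1 + 11 / n * \sum_j del j).
  apply: leave_one_out_error => // w w' mu mu' y y'.
  apply: le_trans (lipC _ _ _ _ _ _) _; rewrite ler_wpM2r ?ler_norm //.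
  by rewrite !addr_ge0 ?sqrtr_ge0 ?powR_ge0.
have sumdel2 : \sum_j del j ^+ 2 = \sum_i Del i ^+ 2.
  rewrite -(pair_bigA _ (fun i b => (a i b - a' i b) ^+ 2)) /=.
  apply: eq_bigr => j _; rewrite norm2_sqr /dotp; apply: eq_bigr => b _.
  by rewrite !mxE expr2.
have sumE : \sum_i E i * Del i <= c / 2 * \sum_i Del i ^+ 2.
  apply: (@le_trans _ _ (\sum_(i : 'I_N * 'I_d)
      `|C| / n * (4 * del i.1 + 11 / n * \sum_j del j) * del i.1)).
    apply: ler_sum => i _; rewrite (le_trans (ler_norm _)) // normrM.
    by rewrite ler_pM.
  rewrite -(pair_bigA _ (fun i (b : 'I_d) =>
     `|C| / n * (4 * del i + 11 / n * \sum_j del j) * del i)) /=.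
  set Sd := \sum_j del j.
  rewrite [leLHS](_ : _ =
    \sum_i d%:R * (`|C| / n * (4 * del i + 11 / n * Sd) * del i)); last first.
    by apply: eq_bigr => i _; rewrite sumr_const card_ord [RHS]mulr_natl.
  have -> : \sum_i d%:R * (`|C| / n * (4 * del i + 11 / n * Sd) * del i) =
     d%:R * `|C| / n * (4 * \sum_j del j ^+ 2 + 11 / n * Sd ^+ 2).
    rewrite (eq_bigr (fun i => d%:R * `|C| / n * 4 * del i ^+ 2 +
      d%:R * `|C| / n * (11 / n * Sd) * del i)) => [|i _]; last first.
      by field; rewrite gt_eqF.
    rewrite big_split /= -!mulr_sumr -/Sd; ring.
  have Sd2 : Sd ^+ 2 <= n * \sum_j del j ^+ 2.
    have := sqr_sum_norm_le (fun=> true) del; rewrite card_ord.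
    by under eq_bigr do rewrite ger0_norm //.
  have Sd2' : 11 / n * Sd ^+ 2 <= 11 * \sum_j del j ^+ 2.
    rewrite -mulrA ler_wpM2l // mulrC ler_pdivrMr // mulrC.
    exact: Sd2.
  rewrite -sumdel2; set Q := \sum_j del j ^+ 2 in Sd2 Sd2' *.
  have Q0 : 0 <= Q by apply: sumr_ge0 => j _; exact: sqr_ge0.
  apply: (@le_trans _ _ (d%:R * `|C| / n * (15 * Q))).
    apply: ler_wpM2l; last lra.
    by rewrite divr_ge0 ?mulr_ge0 ?ler0n // ltW.
  have Xn' : 30 * d%:R * `|C| <= n * c by rewrite -ler_pdivrMr.
  rewrite mulrAC ler_pdivrMr // mulrAC; nra.
have := mono N x a a' (ltnW N1).
have -> : \sum_i (Psi L i (x, a) - Psi L i (x, a')) * (a i.1 i.2 - a' i.1 i.2) =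
  \sum_i (Phi L i (x, a) - Phi L i (x, a')) * (a i.1 i.2 - a' i.1 i.2) +
  \sum_i E i * Del i.
  by rewrite -big_split /=; apply: eq_bigr => i _; rewrite /E /Del; ring.
rewrite -/(Del _).
move: sumE; set A := \sum_i E i * Del i; set B := \sum_i Del i ^+ 2.
set D := \sum_i (Phi L i (x, a) - _) * _; move=> ? ?; nra.
Qed.

End PhiMonotone.

(** * From coordinate derivatives to the class $C^k$ *)

Section Smoothness.
Variables (R : realType) (N d : nat).

(** The qualitative part of [weighted], which also fits $a^N$ itself, for which no bound on the
    values is available. *)
Fixpoint smooth k (g : config R N d -> R) : Prop :=
  continuous g /\
  if k is k'.+1 then forall c, (forall z, derivable g z (evc R c)) /\
    smooth k' ('D_(evc R c) g)
  else True.

Lemma smooth_continuous k g : smooth k g -> continuous g.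
Proof. by case: k => [|k] []. Qed.

Lemma weighted_smooth k S K g : weighted k S K g -> smooth k g.
Proof.
elim: k S g => [|k IH] S g [cg _ dg]; split => // c.
by have [dgc Wc] := dg c; split => //; exact: IH Wc.
Qed.

Lemma smooth_sum k (J : finType) (a : J -> R) (g : J -> config R N d -> R) :
  (forall j, smooth k (g j)) -> smooth k (fun z => \sum_j g j z * a j).
Proof.
elim: k g => [|k IH] g sg.
  split => // z; apply: cvg_finsum => j _; apply: cvgM; last exact: cvg_cst.
  exact: (smooth_continuous (sg j)).
split => [z|c].
  apply: cvg_finsum => j _; apply: cvgM; last exact: cvg_cst.
  exact: (smooth_continuous (sg j)).
have dga z j : is_derive z (evc R c) (fun z => g j z * a j) ('D_(evc R c) (g j) z * a j).
  have [_ /(_ c)[dg _]] := sg j; apply: is_derive_quotient.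
  under eq_cvg do rewrite -mulrBl mulrA.
  by apply: cvgM; [exact: cvg_derive|exact: cvg_cst].
have dS z := @derivable_fsum R N d J (fun j z => g j z * a j) z (evc R c)
  (fun j => @ex_derive _ _ _ _ _ _ _ (dga z j)).
split => [z|]; first exact: (@ex_derive _ _ _ _ _ _ _ (dS z)).
have -> : 'D_(evc R c) (fun z => \sum_j g j z * a j) =
    (fun z => \sum_j 'D_(evc R c) (g j) z * a j).
  apply/funext => z; rewrite (@derive_val _ _ _ _ _ _ _ (dS z)).
  by apply: eq_bigr => j _; exact: (@derive_val _ _ _ _ _ _ _ (dga z j)).
by apply: IH => j; have [_ /(_ c)[]] := sg j.
Qed.

(** [class_C] asks for derivatives in every direction; by [is_derive_direction] these are constant
    linear combinations of coordinate derivatives, a form stable under iteration. *)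
Lemma smooth_class_C k (f : config R N d -> 'M[R]_(N, d)) :
  (forall i b, smooth k (fun z => f z i b)) -> class_C k f.
Proof.
have cont (g : config R N d -> 'M[R]_(N, d)) :
    (forall i b, continuous (fun z => g z i b)) -> continuous g.
  move=> cg; have -> : g = fun z => \sum_i \sum_j g z i j *: delta_mx i j.
    by apply/funext => z; rewrite -matrix_sum_delta.
  move=> z.
  apply: cvg_big => [|i _]; first exact: add_continuous.
  apply: cvg_big => [|j _]; first exact: add_continuous.
  by apply: cvgZr_tmp; exact: cg.
elim: k f => [|k IH] f sf.
  by split => //; apply: cont => i b; exact: smooth_continuous (sf i b).
split; first by apply: cont => i b; exact: smooth_continuous (sf i b).
move=> v.
have df z i b : is_derive z v (fun z => f z i b)
    (\sum_c 'D_(evc R c) (fun z => f z i b) z * co c v).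
  have [_ sfib] := sf i b; apply: is_derive_direction => [c y|c].
    exact: (sfib c).1.
  exact: smooth_continuous (sfib c).2.
have dfm z : derivable f z v.
  by apply/derivable_mxP => i b; exact: (@ex_derive _ _ _ _ _ _ _ (df z i b)).
split => //; apply: IH => i b.
have -> : (fun z => 'D_v f z i b) =
    (fun z => \sum_c 'D_(evc R c) (fun z => f z i b) z * co c v).
  apply/funext => z; rewrite derive_mx // mxE.
  exact: (@derive_val _ _ _ _ _ _ _ (df z i b)).
by apply: smooth_sum => c; have [_ /(_ c)[]] := sf i b.
Qed.

End Smoothness.

(** * Norms of the block derivatives *)

Section BlockNorms.
Variables (R : realType) (N d : nat).
Implicit Types (f : config R N d -> 'rV[R]_d) (ss : seq (block N)).

Definition block_coord (s : block N) (b : 'I_d) : coord N d :=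
  match s with bx j => (false, (j, b)) | bp j => (true, (j, b)) end.

Definition block_particle (s : block N) : 'I_N :=
  match s with bx j => j | bp j => j end.

Lemma bvecE s b : bvec R s b = evc R (block_coord s b).
Proof. by case: s. Qed.

Lemma pt_block_coord s b : pt (block_coord s b) = block_particle s.
Proof. by case: s. Qed.

Lemma derive_entry f z v b : (forall b, derivable (fun z => f z 0 b) z v) ->
  'D_v f z 0 b = 'D_v (fun z => f z 0 b) z.
Proof.
move=> df; rewrite derive_mx ?mxE //.
by apply/derivable_mxP => i b'; rewrite (ord1 i).
Qed.

(** One factor [d] comes from the components of [f] and one from each block; the particles of the
    blocks join [S] as they are differentiated. *)
Lemma sqnormD_le ss : forall k S K f, (size ss <= k)%N -> 0 <= K ->
  (forall b, weighted k S K (fun z => f z 0 b)) -> forall z,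
  sqnormD ss f z <= d%:R ^+ (size ss).+1 *
    (K * wt R (map block_particle ss ++ S)) ^+ 2.
Proof.
elim: ss => [|s ss IH] k S K f ssk K0 Wf z.
  rewrite /= expr1 /dotp mulr_natl -[d in _ *+ d]card_ord -sumr_const.
  apply: ler_sum => b _; rewrite -expr2 -(real_normK (num_real (f z 0 b))).
  by rewrite lerXn2r ?nnegrE ?mulr_ge0 ?wt_ge0 // (weighted_bound z (Wf b)).
case: k ssk Wf => // k ssk Wf.
rewrite /= exprS -mulrA [leRHS]mulr_natl -[d in _ *+ d]card_ord -sumr_const.
apply: ler_sum => b _; rewrite bvecE.
rewrite (wt_eqi R (T := map block_particle ss ++ block_particle s :: S)); last first.
  by move=> i; rewrite /= !(in_cons, mem_cat) orbCA.
rewrite -(pt_block_coord s b).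
apply: (IH k _ K _ ssk K0) => b'.
have -> : (fun z => 'D_(evc R (block_coord s b)) f z 0 b') =
    'D_(evc R (block_coord s b)) (fun z => f z 0 b').
  apply/funext => z'; apply: derive_entry => b1.
  by have [_ _ /(_ (block_coord s b))[]] := Wf b1.
by have [_ _ /(_ (block_coord s b))[]] := Wf b'.
Qed.

(** The first block is split off because weighted bounds hold for the derivatives of [f] only. At
    most three blocks and one component give at most $d^4$ under the root, crudely replaced by $d^4$
    outside it. *)
Lemma supnormD_le s ss (K : R) (i : 'I_N) f : (size ss <= 2)%N -> (0 < d)%N -> 0 <= K ->
  (forall e b, (forall z, derivable (fun z => f z 0 b) z (evc R e)) /\
    weighted 3 [:: pt e; i] K ('D_(evc R e) (fun z => f z 0 b))) ->
  (supnormD (s :: ss) f <=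
    (d%:R ^+ 4 * K * wt R (i :: map block_particle (s :: ss)))%:E)%E.
Proof.
move=> ss2 d0 K0 Wf; apply: ge_ereal_sup => _ [z _ <-]; rewrite lee_fin.
set w := wt R _; have w0 : 0 <= w by exact: wt_ge0.
have d1 : 1 <= d%:R :> R by rewrite ler1n.
have Kw0 : 0 <= d%:R ^+ 4 * K * w by rewrite !mulr_ge0 ?exprn_ge0.
rewrite -[leRHS](ger0_norm Kw0) -sqrtr_sqr ler_wsqrtr //=.
apply: (@le_trans _ _ (\sum_(b < d) d%:R ^+ (size ss).+1 * (K * w) ^+ 2)).
  apply: ler_sum => b _; rewrite bvecE.
  rewrite /w (wt_eqi R (T := map block_particle ss ++ [:: block_particle s; i])); last first.
    by move=> l; rewrite /= !(in_cons, mem_cat, in_nil) orbF orbC -orbA orbCA.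
  rewrite -(pt_block_coord s b).
  apply: (@sqnormD_le ss 3) => //; first by rewrite (leq_trans ss2).
  move=> b'.
  have -> : (fun z => 'D_(evc R (block_coord s b)) f z 0 b') =
      'D_(evc R (block_coord s b)) (fun z => f z 0 b').
    by apply/funext => z'; apply: derive_entry => b1; exact: (Wf _ b1).1.
  exact: (Wf (block_coord s b) b').2.
rewrite sumr_const card_ord -[leLHS]mulr_natl mulrA -exprS -mulrA [leRHS]exprMn.
rewrite ler_wpM2r ?sqr_ge0 // -exprM ler_weXn2l //=; lia.
Qed.

End BlockNorms.

(** * Assembling the estimates *)

Theorem proposition3p2 (R : realType) (d : nat)
    (L : 'rV[R]_d -> 'rV[R]_d -> P2 R (d + d) -> R)
    (G : 'rV[R]_d -> P2 R d -> R) :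
  (1 <= d)%N ->
  regularity_assumption L G ->
  fixed_point_monotonicity L ->
  exists (C : R) (N0 : nat), forall N : nat, (N0 <= N)%N ->
  forall aN : 'M[R]_(N, d) * 'M[R]_(N, d) -> 'M[R]_(N, d),
  is_aN L aN ->
  let a i := fun z => row i (aN z) in
  class_C 4 aN /\
  forall i j k l : 'I_N,
  [/\ (supnormD [:: bx j] (a i) + supnormD [:: bp j] (a i)
       <= (C * weight R [:: i; j])%:E)%E,
      (supnormD [:: bx j; bx k] (a i) + supnormD [:: bp j; bx k] (a i)
         + supnormD [:: bp j; bp k] (a i)
       <= (C * weight R [:: i; j; k])%:E)%E &
      (supnormD [:: bx j; bx k; bx l] (a i)
         + supnormD [:: bp j; bx k; bx l] (a i)
         + supnormD [:: bp j; bp k; bx l] (a i)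
         + supnormD [:: bp j; bp k; bp l] (a i)
       <= (C * weight R [:: i; j; k; l])%:E)%E].
Proof.
move=> d1 [_ regL] mono.
have [c c0 [N0 monoPhi]] := Phi_monotone regL mono.
have [K K0 WPhi] : exists2 K, 0 <= K & forall N (i : 'I_N * 'I_d), (1 < N)%N ->
    continuous (Phi L i) /\ forall e, (forall z, derivable (Phi L i) z (evc R e)) /\
      weighted 3 [:: pt e; i.1] K ('D_(evc R e) (Phi L i)).
  by case: regL => CL *; exact: Phi_weighted CL.
have [C C0 HC] := @implicit_weighted R d c K c0 K0 3 (leqnn _).
pose B : R := d%:R ^+ 4 * C.
have B0 : 0 <= B by rewrite mulr_ge0 ?exprn_ge0.
(* At most four norms are added in each item. *)
exists (4 * B), N0 => N NN0 aN HaN a.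
have [N1 _] := monoPhi N 0 0 0 NN0.
have sys : implicit_system c K (@Phi _ _ L N) aN.
  split.
  - by move=> i; exact: (WPhi N i N1).1.
  - by move=> i e z; exact: ((WPhi N i N1).2 e).1.
  - by move=> i e; exact: ((WPhi N i N1).2 e).2.
  - by move=> x u u'; exact: (monoPhi N x u u' NN0).2.
  - exact: Phi_fixed_point.
have Wa i e b : (forall z, derivable (fun z => a i z 0 b) z (evc R e)) /\
    weighted 3 [:: pt e; i] C ('D_(evc R e) (fun z => a i z 0 b)).
  have -> : (fun z => a i z 0 b) = (fun z => aN z i b).
    by apply/funext => z; rewrite mxE.
  split => [z|]; first exact: (solution_derivable c0 sys e z).1 (i, b).
  exact: HC sys e (i, b).
split.
  (* Order four is continuity of $a^N$ plus three orders for its first derivatives. *)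
  apply: smooth_class_C => i b; split; first exact: (solution_continuous c0 sys).
  move=> e; have [dz Wz] := Wa i e b.
  have aE : (fun z => aN z i b) = (fun z => a i z 0 b).
    by apply/funext => z; rewrite mxE.
  by rewrite aE; split => //; exact: weighted_smooth Wz.
move=> i j k l.
have bound s ss : (size ss <= 2)%N -> (supnormD (s :: ss) (a i) <=
    (B * weight R (i :: map (@block_particle N) (s :: ss)))%:E)%E.
  by move=> ss2; rewrite weightE //; apply: supnormD_le => // e b; exact: Wa.
have w0 S : 0 <= B * weight R (i :: S) :> R by rewrite weightE // mulr_ge0 ?wt_ge0.
split; rewrite -mulrA.
- apply: (@le_trans _ _ (B * weight R [:: i; j] + B * weight R [:: i; j])%:E).
    by rewrite EFinD; apply: leeD; exact: bound.
  by rewrite lee_fin; have := w0 [:: j]; lra.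
- apply: (@le_trans _ _ (B * weight R [:: i; j; k] + B * weight R [:: i; j; k] +
      B * weight R [:: i; j; k])%:E).
    by rewrite !EFinD; apply: leeD; [apply: leeD|]; exact: bound.
  by rewrite lee_fin; have := w0 [:: j; k]; lra.
- apply: (@le_trans _ _ (B * weight R [:: i; j; k; l] + B * weight R [:: i; j; k; l] +
      B * weight R [:: i; j; k; l] + B * weight R [:: i; j; k; l])%:E).
    by rewrite !EFinD; apply: leeD; [apply: leeD; [apply: leeD|]|]; exact: bound.
  by rewrite lee_fin; have := w0 [:: j; k; l]; lra.
Qed.
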